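(* Let $M\subset\mathbb{C}^{n+1}$ ($n\geq 1$) be a real hypersurface defined by $\varrho=0$, where $\varrho$ is a smooth real-valued function with $d\varrho\neq 0$ on $M$. Assume there is a positive definite Hermitian matrix $(a_{j\bar k})$ with constant entries such that along $M$ $$\frac{\partial^2\varrho}{\partial z_j\partial\bar z_k}=a_{j\bar k}+o(\varrho).$$ Let $\theta=\iota^{*}(i\bar\partial\varrho)$, where $\iota\colon M\to\mathbb{C}^{n+1}$ is the inclusion, and let $|\partial\varrho|^2=\sum_{j,k=1}^{n+1}a^{j\bar k}\varrho_j\varrho_{\bar k}$. If $M$ is $\mathbb{C}$-convex, then $(M,\theta)$ has $\frac12$-positive holomorphic sectional curvature. More precisely, for every $(1,0)$-vector $Z\in T^{(1,0)}(M)$, $Z\neq 0$, the Tanaka–Webster holomorphic sectional curvature $K$ and the holomorphic sectional torsion $A$ of $(M,\theta)$ satisfy $$K(Z)\geq\frac12|\partial\varrho|^{-2}\geq\frac12|A(Z)|.$$ The inequalities are sharp.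
   Context: Here $\varrho_j=\partial\varrho/\partial z_j$, $\varrho_{\bar k}=\partial\varrho/\partial\bar z_k$, $\varrho_{jk}=\partial^2\varrho/\partial z_j\partial z_k$, $\varrho_{j\bar k}=\partial^2\varrho/\partial z_j\partial\bar z_k$; $(a^{j\bar k})$ is the inverse transpose of $(a_{j\bar k})$, so that $|\partial\varrho|^2$ is the squared length of $\partial\varrho$ in the metric dual to $a_{j\bar k}dz^j\otimes d\bar z^k$. The notation $\varrho_{j\bar k}=a_{j\bar k}+o(\varrho)$ along $M$ means that $(\varrho_{j\bar k}-a_{j\bar k})/\varrho\to0$ as one approaches $M$ (in particular $\varrho_{j\bar k}=a_{j\bar k}$ on $M$). $T^{(1,0)}(M)=T^{(1,0)}(\mathbb{C}^{n+1})\cap\mathbb{C}T(M)$. $M$ is $\mathbb{C}$-convex if the Hessian $$\mathrm{Hess}_\varrho(p;\eta)=\sum_{j,k}\mathrm{Re}\,(\varrho_{jk}(p)\eta_j\eta_k)+\sum_{j,k}\varrho_{j\bar k}(p)\eta_j\overline{\eta_k}$$ is $\geq 0$ for every $p\in M$ and every $\eta\in\mathbb{C}^{n+1}$ in the complex tangent space at $p$, i.e. with $\sum_j\varrho_j(p)\eta_j=0$. $M$ is strictly pseudoconvex and $\theta$ is a pseudohermitian structure: a real 1-form with kernel $H(M)=\mathrm{Re}\,T^{(1,0)}(M)$ and $d\theta$ positive definite on $H(M)$. The Reeb field $T$ satisfies $T\rfloor d\theta=0$, $\theta(T)=1$. For a local frame $Z_\alpha$ ($\alpha=1,\dots,n$)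 of $T^{(1,0)}(M)$, $Z_{\bar\alpha}=\overline{Z_\alpha}$, with $\{\theta^\alpha,\theta^{\bar\alpha},\theta\}$ dual to $\{Z_\alpha,Z_{\bar\alpha},T\}$, one has $d\theta=i h_{\alpha\bar\beta}\theta^\alpha\wedge\theta^{\bar\beta}$; indices are raised and lowered with $h_{\alpha\bar\beta}$ and its inverse transpose. The Tanaka–Webster connection forms $\omega_\alpha{}^\beta$ satisfy $d\theta^\beta=\theta^\alpha\wedge\omega_\alpha{}^\beta+A^\beta{}_{\bar\alpha}\theta\wedge\theta^{\bar\alpha}$ and $dh_{\alpha\bar\beta}=\omega_\alpha{}^\gamma h_{\gamma\bar\beta}+h_{\alpha\bar\gamma}\omega_{\bar\beta}{}^{\bar\gamma}$, where $\omega_{\bar\beta}{}^{\bar\gamma}=\overline{\omega_\beta{}^\gamma}$; the (symmetric) pseudohermitian torsion $A_{\alpha\beta}$ is the complex conjugate of $A_{\bar\alpha\bar\beta}=h_{\gamma\bar\beta}A^\gamma{}_{\bar\alpha}$. The Tanaka–Webster curvature $R_\alpha{}^\beta{}_{\gamma\bar\sigma}$ is the coefficient of $\theta^\gamma\wedge\theta^{\bar\sigma}$ in $d\omega_\alpha{}^\beta-\omega_\alpha{}^\gamma\wedge\omega_\gamma{}^\beta$. For nonzero $Z=\zeta^\alpha Z_\alpha$ with $|Z|^2=h_{\alpha\bar\beta}\zeta^\alpha\overline{\zeta^\beta}$, $$K(Z)=\tfrac12R_{\alpha\bar\beta\gamma\bar\sigma}\zeta^\alpha\overline{\zeta^\beta}\zeta^\gamma\overline{\zeta^\sigma}/|Z|^4,\qquad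 A(Z)=iA_{\alpha\beta}\zeta^\alpha\zeta^\beta/|Z|^2.$$ For a constant $C_0$, a pseudohermitian manifold $(M,\theta)$ is said to have $C_0$-positive holomorphic sectional curvature if $K(Z)-C_0|A(Z)|>0$ for all $Z\in T^{(1,0)}(M)$, $Z\neq0$.
   Formalization: ''1/2-positive'' (strict) fails for C-convex M: the tube Σ(Re z_j)²=1 has K=½|A| for some Z. Proved instead: C_0-positivity for every C_0<1/2, and 1/2-positivity when the Hessian is >0 on nonzero complex tangent vectors; the precise inequalities and their sharpness are as stated. *)

(* Defs.v *)
From HB Require Import structures.
From mathcomp Require Import all_boot all_order all_algebra.
From mathcomp Require Import complex.
From mathcomp Require Import all_classical all_reals all_analysis.
Set Implicit Arguments.
Unset Strict Implicit.
Unset Printing Implicit Defensive.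
Import Order.TTheory GRing.Theory Num.Theory.
Import numFieldNormedType.Exports.
Local Open Scope classical_set_scope.
Local Open Scope ring_scope.
Local Open Scope complex_scope.

(* C^m as a normed space over R: the pair (x, y) stands for z = x + iy.  Points
   of C^m and real tangent vectors to C^m both have this type. *)
Definition Cn (R : realType) (m : nat) : normedModType R :=
  ('rV[R]_m * 'rV[R]_m)%type.

(* The j-th complex coordinate z_j(v); on tangent vectors, dz_j(v). *)
Definition zc (R : realType) m (v : Cn R m) (j : 'I_m) : R[i] :=
  v.1 0 j +i* v.2 0 j.

Definition ex (R : realType) m (j : 'I_m) : Cn R m := (delta_mx 0 j, 0).
Definition ey (R : realType) m (j : 'I_m) : Cn R m := (0, delta_mx 0 j).

Fixpoint Ck (R : realType) m (k : nat) (W : set (Cn R m)) (f : Cn R m -> R) :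
    Prop :=
  match k with
  | 0 => forall p, W p -> {for p, continuous f}
  | k'.+1 => (forall p, W p -> differentiable f p) /\
             (forall v : Cn R m, Ck k' W ('D_v f))
  end.

Definition smooth (R : realType) m (W : set (Cn R m)) (f : Cn R m -> R) : Prop :=
  forall k, Ck k W f.

Definition smoothC (R : realType) m (W : set (Cn R m)) (f : Cn R m -> R[i]) :
    Prop :=
  smooth W (fun p => complex.Re (f p)) /\ smooth W (fun p => complex.Im (f p)).

Definition realC (R : realType) m (f : Cn R m -> R) : Cn R m -> R[i] :=
  fun p => (f p)%:C.

Definition derC (R : realType) m (v : Cn R m) (f : Cn R m -> R[i]) (p : Cn R m) :
    R[i] :=
  'D_v (fun q => complex.Re (f q)) p +i* 'D_v (fun q => complex.Im (f q)) p.

(* The Wirtinger derivatives d/dz_j and d/d(conj z_j). *)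
Definition dz (R : realType) m (j : 'I_m) (f : Cn R m -> R[i]) (p : Cn R m) :
    R[i] :=
  2^-1 * (derC (ex R j) f p - 'i * derC (ey R j) f p).
Definition dzb (R : realType) m (j : 'I_m) (f : Cn R m -> R[i]) (p : Cn R m) :
    R[i] :=
  2^-1 * (derC (ex R j) f p + 'i * derC (ey R j) f p).

(* rho_j, rho_kbar, rho_jk and rho_(j kbar). *)
Definition rho1 (R : realType) m (rho : Cn R m -> R) (j : 'I_m) :=
  dz j (realC rho).
Definition rho1b (R : realType) m (rho : Cn R m -> R) (k : 'I_m) :=
  dzb k (realC rho).
Definition rho2 (R : realType) m (rho : Cn R m -> R) (j k : 'I_m) :=
  dz j (dz k (realC rho)).
Definition rho11 (R : realType) m (rho : Cn R m -> R) (j k : 'I_m) :=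
  dz j (dzb k (realC rho)).

Definition hypersurface (R : realType) m (U : set (Cn R m)) (rho : Cn R m -> R) :
    set (Cn R m) :=
  [set p | U p /\ rho p = 0].

Definition defining_function (R : realType) m (U : set (Cn R m))
    (rho : Cn R m -> R) : Prop :=
  [/\ open U, smooth U rho &
      forall p, hypersurface U rho p -> exists v : Cn R m, 'D_v rho p != 0].

Definition posdef_hermitian (R : realType) m (a : 'M[R[i]]_m) : Prop :=
  (forall j k, a k j = (a j k)^*) /\
  (forall v : 'rV[R[i]]_m, v != 0 ->
     0 < \sum_j \sum_k a j k * v 0 j * (v 0 k)^*).

(* rho_(j kbar) = a_(j kbar) + o(rho) along M; the inequality also forces
   rho_(j kbar) = a_(j kbar) on M. *)
Definition levi_constant_along (R : realType) m (U : set (Cn R m))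
    (rho : Cn R m -> R) (a : 'M[R[i]]_m) : Prop :=
  forall p, hypersurface U rho p -> forall (j k : 'I_m) (eps : R), 0 < eps ->
    \forall q \near p,
      `| rho11 rho j k q - a j k | <= (eps * `| rho q |)%:C.

(* |d rho|^2 for the dual metric; a^(j kbar) is the inverse transpose of a. *)
Definition dual_normsq (R : realType) m (a : 'M[R[i]]_m) (rho : Cn R m -> R)
    (p : Cn R m) : R[i] :=
  \sum_j \sum_k (invmx a)^T j k * rho1 rho j p * rho1b rho k p.

(* sum_j eta_j d/dz_j at p belongs to T^(1,0)(M). *)
Definition T10 (R : realType) m (rho : Cn R m -> R) (p : Cn R m)
    (eta : 'rV[R[i]]_m) : Prop :=
  \sum_j rho1 rho j p * eta 0 j = 0.

Definition hess (R : realType) m (rho : Cn R m -> R) (p : Cn R m)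
    (eta : 'rV[R[i]]_m) : R[i] :=
  \sum_j \sum_k (complex.Re (rho2 rho j k p * eta 0 j * eta 0 k))%:C
  + \sum_j \sum_k rho11 rho j k p * eta 0 j * (eta 0 k)^*.

Definition C_convex (R : realType) m (U : set (Cn R m)) (rho : Cn R m -> R) :
    Prop :=
  forall p eta, hypersurface U rho p -> T10 rho p eta -> 0 <= hess rho p eta.

(* C-convexity alone gives K - C0 |A| > 0 only for C0 < 1/2: the C-convex tube
   2 |Re z|^2 = 1, with a the identity, has K(Z) = |A(Z)| / 2 for some Z.  The
   value C0 = 1/2 is reached under this strict form of C-convexity. *)
Definition strictly_C_convex (R : realType) m (U : set (Cn R m))
    (rho : Cn R m -> R) : Prop :=
  forall p eta, hypersurface U rho p -> T10 rho p eta -> eta != 0 ->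
    0 < hess rho p eta.

(* Complex-valued differential forms on C^m, as functions of a point and of real
   tangent vectors.  A form on M is represented by a form on an open subset of
   C^m restricted to vectors tangent to M: forms on M extend locally, and d
   commutes with the restriction. *)
Definition form1 (R : realType) m := Cn R m -> Cn R m -> R[i].
Definition form2 (R : realType) m := Cn R m -> Cn R m -> Cn R m -> R[i].

Definition smooth_form1 (R : realType) m (W : set (Cn R m)) (phi : form1 R m) :
    Prop :=
  (forall p (c : R) (u v : Cn R m), W p ->
     phi p (c *: u + v) = c%:C * phi p u + phi p v) /\
  (forall v, smoothC W (fun p => phi p v)).

Definition wedge (R : realType) m (phi psi : form1 R m) : form2 R m :=
  fun p u v => phi p u * psi p v - phi p v * psi p u.

Definition conj_form (R : realType) m (phi : form1 R m) : form1 R m :=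
  fun p v => (phi p v)^*.

Definition scale_form (R : realType) m (f : Cn R m -> R[i]) (phi : form1 R m) :
    form1 R m :=
  fun p v => f p * phi p v.

(* The exterior derivative; u and v are extended as constant vector fields. *)
Definition ext_d (R : realType) m (phi : form1 R m) : form2 R m :=
  fun p u v => derC u (fun q => phi q v) p - derC v (fun q => phi q u) p.

(* A complex tangent vector is the pair of its real and imaginary parts. *)
Definition cvec (R : realType) m := (Cn R m * Cn R m)%type.

Definition ev1 (R : realType) m (phi : Cn R m -> R[i]) (X : cvec R m) : R[i] :=
  phi X.1 + 'i * phi X.2.
Definition ev2 (R : realType) m (Phi : Cn R m -> Cn R m -> R[i])
    (X Y : cvec R m) : R[i] :=
  ev1 (fun u => ev1 (Phi u) Y) X.

(* The real vector with dz_j(v) = eta_j. *)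
Definition toCn (R : realType) m (eta : 'rV[R[i]]_m) : Cn R m :=
  (map_mx (@complex.Re R) eta, map_mx (@complex.Im R) eta).

(* sum_j eta_j d/dz_j = (v - i J v) / 2 with v = toCn eta, and its conjugate. *)
Definition vec10 (R : realType) m (eta : 'rV[R[i]]_m) : cvec R m :=
  (2^-1 *: toCn eta, - (2^-1 *: toCn ('i *: eta))).
Definition vec01 (R : realType) m (eta : 'rV[R[i]]_m) : cvec R m :=
  (2^-1 *: toCn eta, 2^-1 *: toCn ('i *: eta)).

(* theta = i dbar rho. *)
Definition theta (R : realType) m (rho : Cn R m -> R) : form1 R m :=
  fun p v => 'i * \sum_k rho1b rho k p * (zc v k)^*.

Definition tangent (R : realType) m (rho : Cn R m -> R) (p v : Cn R m) : Prop :=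
  'D_v rho p = 0.

Definition eq1_on (R : realType) m (S : set (Cn R m)) (rho : Cn R m -> R)
    (phi psi : form1 R m) : Prop :=
  forall p u, S p -> tangent rho p u -> phi p u = psi p u.
Definition eq2_on (R : realType) m (S : set (Cn R m)) (rho : Cn R m -> R)
    (Phi Psi : form2 R m) : Prop :=
  forall p u v, S p -> tangent rho p u -> tangent rho p v ->
    Phi p u v = Psi p u v.

(* A local frame of T^(1,0)(M) with the associated pseudohermitian data:
     frame a = Z_a,         reeb = T,              coframe a = theta^a,
     levi a b = h_(a bbar), conn a b = omega_a^b,  tors b a = A^b_(abar). *)
Record ph_data (R : realType) (n : nat) := PhData {
  frame : 'I_n -> Cn R n.+1 -> 'rV[R[i]]_n.+1;
  reeb : Cn R n.+1 -> Cn R n.+1;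
  coframe : 'I_n -> form1 R n.+1;
  levi : 'I_n -> 'I_n -> Cn R n.+1 -> R[i];
  conn : 'I_n -> 'I_n -> form1 R n.+1;
  tors : 'I_n -> 'I_n -> Cn R n.+1 -> R[i] }.

Definition ph_smooth (R : realType) n (W : set (Cn R n.+1)) (D : ph_data R n) :
    Prop :=
  [/\ (forall a j, smoothC W (fun p => frame D a p 0 j)),
      (forall j, smoothC W (fun p => zc (reeb D p) j)),
      (forall a, smooth_form1 W (coframe D a)) &
      [/\ forall a b, smoothC W (levi D a b),
          forall a b, smooth_form1 W (conn D a b) &
          forall a b, smoothC W (tors D a b)]].

Definition is_frame (R : realType) n (S : set (Cn R n.+1))
    (rho : Cn R n.+1 -> R) (D : ph_data R n) : Prop :=
  forall p, S p ->
    (forall a, T10 rho p (frame D a p)) /\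
    row_free (\matrix_(a < n, j < n.+1) frame D a p 0 j).

Definition is_reeb (R : realType) n (S : set (Cn R n.+1))
    (rho : Cn R n.+1 -> R) (D : ph_data R n) : Prop :=
  forall p, S p ->
    [/\ tangent rho p (reeb D p),
        theta rho p (reeb D p) = 1 &
        forall v, tangent rho p v -> ext_d (theta rho) p (reeb D p) v = 0].

Definition is_coframe (R : realType) n (S : set (Cn R n.+1)) (D : ph_data R n) :
    Prop :=
  forall p (a b : 'I_n), S p ->
    [/\ ev1 (coframe D a p) (vec10 (frame D b p)) = (a == b)%:R,
        ev1 (coframe D a p) (vec01 (frame D b p)) = 0 &
        coframe D a p (reeb D p) = 0].

Definition is_levi (R : realType) n (S : set (Cn R n.+1))
    (rho : Cn R n.+1 -> R) (D : ph_data R n) : Prop :=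
  eq2_on S rho (ext_d (theta rho))
    (fun p u v => 'i * \sum_a \sum_b
       levi D a b p * wedge (coframe D a) (conj_form (coframe D b)) p u v).

(* The two structure equations of the Tanaka-Webster connection. *)
Definition is_tanaka_webster (R : realType) n (S : set (Cn R n.+1))
    (rho : Cn R n.+1 -> R) (D : ph_data R n) : Prop :=
  (forall b, eq2_on S rho (ext_d (coframe D b))
    (fun p u v =>
       \sum_a wedge (coframe D a) (conn D a b) p u v
       + \sum_a tors D b a p
           * wedge (theta rho) (conj_form (coframe D a)) p u v)) /\
  (forall a b, eq1_on S rho
    (fun p u => derC u (levi D a b) p)
    (fun p u => \sum_c conn D a c p u * levi D c b p
              + \sum_c levi D a c p * (conn D b c p u)^*)).

Definition ph_structure_near (R : realType) n (U : set (Cn R n.+1))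
    (rho : Cn R n.+1 -> R) (p : Cn R n.+1) (D : ph_data R n) : Prop :=
  exists W : set (Cn R n.+1), let S := W `&` hypersurface U rho in
    [/\ open W, W p, W `<=` U & ph_smooth W D] /\
    [/\ is_frame S rho D, is_reeb S rho D, is_coframe S D, is_levi S rho D &
        is_tanaka_webster S rho D].

(* R_a^b_(c sbar): the coefficient of theta^c /\ theta^sbar in
   d omega_a^b - omega_a^g /\ omega_g^b, i.e. its value on (Z_c, Z_sbar). *)
Definition curv (R : realType) n (D : ph_data R n) (p : Cn R n.+1)
    (a b c s : 'I_n) : R[i] :=
  ev2 (fun u v => ext_d (conn D a b) p u v
                  - \sum_g wedge (conn D a g) (conn D g b) p u v)
      (vec10 (frame D c p)) (vec01 (frame D s p)).

(* R_(a bbar c sbar). *)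
Definition curv_low (R : realType) n (D : ph_data R n) (p : Cn R n.+1)
    (a b c s : 'I_n) : R[i] :=
  \sum_d levi D d b p * curv D p a d c s.

(* A_(ab), the conjugate of A_(abar bbar). *)
Definition tors_low (R : realType) n (D : ph_data R n) (p : Cn R n.+1)
    (a b : 'I_n) : R[i] :=
  (\sum_c levi D c b p * tors D c a p)^*.

(* The component zeta^a = theta^a(Z) of Z = sum_j Z_j d/dz_j. *)
Definition zeta (R : realType) n (D : ph_data R n) (p : Cn R n.+1)
    (Z : 'rV[R[i]]_n.+1) (a : 'I_n) : R[i] :=
  ev1 (coframe D a p) (vec10 Z).

Definition normsq (R : realType) n (D : ph_data R n) (p : Cn R n.+1)
    (Z : 'rV[R[i]]_n.+1) : R[i] :=
  \sum_a \sum_b levi D a b p * zeta D p Z a * (zeta D p Z b)^*.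

Definition hol_sec_curv (R : realType) n (D : ph_data R n) (p : Cn R n.+1)
    (Z : 'rV[R[i]]_n.+1) : R[i] :=
  2^-1 * (\sum_a \sum_b \sum_c \sum_s
            curv_low D p a b c s * zeta D p Z a * (zeta D p Z b)^*
              * zeta D p Z c * (zeta D p Z s)^*)
  / normsq D p Z ^+ 2.

Definition hol_sec_tors (R : realType) n (D : ph_data R n) (p : Cn R n.+1)
    (Z : 'rV[R[i]]_n.+1) : R[i] :=
  'i * (\sum_a \sum_b tors_low D p a b * zeta D p Z a * zeta D p Z b)
  / normsq D p Z.

(* C0-positive holomorphic sectional curvature of (M, theta).  On R[i], 0 < x
   means that x is real and positive. *)
Definition positive_hol_sec_curv (R : realType) n (U : set (Cn R n.+1))
    (rho : Cn R n.+1 -> R) (C0 : R) : Prop :=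
  forall p (D : ph_data R n) Z, hypersurface U rho p ->
    ph_structure_near U rho p D -> T10 rho p Z -> Z != 0 ->
    0 < hol_sec_curv D p Z - C0%:C * `| hol_sec_tors D p Z |.

(* Main.v *)
(** Let [g] be the [a]-gradient of [rho], so that [hform a x g] is [d' rho (x)],
    and let [N = |d rho|^2].  On vectors tangent to M one has
    [dz = theta^b Z_b + (i theta / N) g], an [a]-orthogonal decomposition.
    Taking the exterior derivative of [hform (dz, Z_c) = theta^b h_(b cbar)] and
    comparing with the structure equations determines the Tanaka-Webster
    connection, [omega_b^d h_(d cbar) = hform (dZ_b, Z_c) - (i/N) theta h_(b cbar)],
    and the torsion [A_(bc) = - (i/N) rho_(Z_b Z_c)].  Since [hform] is flat, one
    more exterior derivative gives the Gauss equation
    [R_(b cbar d sbar) = (h_(b cbar) h_(d sbar) + h_(b sbar) h_(d cbar)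
    - rho_(Z_b Z_d) conj(rho_(Z_c Z_s))) / N].
    With [h = |Z|^2] and [r = |rho_(Z Z)|] this reads
    [K(Z) = (2 h^2 - r^2) / (2 N h^2)] and [|A(Z)| = r / (N h)], while C-convexity,
    applied to the rotations of [Z], is the inequality [r <= h].  Equality [r = h]
    holds for real tangent vectors of the tube [|Re z| = 1]. *)

Require Import Defs.
From HB Require Import structures.
From mathcomp Require Import all_boot all_order all_algebra.
From mathcomp Require Import complex.
From mathcomp Require Import all_classical all_reals all_analysis.
From mathcomp Require Import ring lra.
Import Order.TTheory GRing.Theory Num.Theory.
Import numFieldNormedType.Exports.
Local Open Scope classical_set_scope.
Local Open Scope complex_scope.
Local Open Scope ring_scope.
Set Implicit Arguments.
Unset Strict Implicit.
Unset Printing Implicit Defensive.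

(** * Differentiation in normed spaces *)

(** The geometric identities hold only on M, while derivatives are taken in C^(n+1) of data extended
    off M. Each differentiation is therefore applied to a function or form that vanishes on M, and
    only along tangent vectors; [derive_tangent_eq0] and [ext_d_tangent_eq0] justify this with the
    intermediate value theorem and one transversal direction in place of local coordinates on M.
    Forms are evaluated on real vectors, so an identity mixes the linear and the antilinear
    dependence on a (1,0)-vector Z; testing it on k Z with k = 1 and k = i separates the two. The
    factorization K - |A| / 2 = (h - r) (2 h + r) / (2 N h^2) shows why the constant 1/2 calls for r
    < h, whereas C-convexity gives r <= h. Sharpness asserts that frame, connection and torsion
    exist, so a complete pseudohermitian structure on the tube is written down and checked against
    the structure equations. *)

Section RealAnalysis.
Context {R : realType} {V : normedModType R}.
Implicit Types (f g : V -> R) (p u v : V).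

Lemma differentiable_approx f p (eps : R) : differentiable f p -> 0 < eps ->
  exists2 d : R, 0 < d & forall h : V, `|h| < d ->
    `|f (h + p) - f p - 'D_h f p| <= eps * `|h|.
Proof.
move=> df e0; have /diff_locallyxP[_ H] := df.
move/funext: H => /eqaddoP/(_ eps e0) /nbhs_ballP [d d0 Hd].
exists d => // h hd; rewrite deriveE //.
have := Hd h; rewrite -ball_normE /= sub0r normrN => /(_ hd).
by rewrite !fctE opprD addrA.
Qed.

Lemma deriveDv f p u v : differentiable f p ->
  'D_(u + v) f p = 'D_u f p + 'D_v f p.
Proof. by move=> df; rewrite !deriveE // linearD. Qed.

Lemma deriveZv f p (c : R) v : differentiable f p ->
  'D_(c *: v) f p = c * 'D_v f p.
Proof. by move=> df; rewrite !deriveE // linearZ. Qed.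

Lemma is_derive_line f p u (s : R) : differentiable f (s *: u + p) ->
  is_derive s 1 (fun t : R => f (t *: u + p)) ('D_u f (s *: u + p)).
Proof.
move=> df; have := @diff_derivable _ _ _ f (s *: u + p) u df.
rewrite /derivable => H.
have E : (fun h : R => h^-1 *: (f ((h *: 1 + s) *: u + p) - f (s *: u + p)))
   = (fun h : R => h^-1 *: (f (h *: u + (s *: u + p)) - f (s *: u + p))).
  apply/funext => h; congr (_ *: (f _ - _)).
  by rewrite scalerDl [h *: 1]mulr1 addrA.
apply: DeriveDef; first by rewrite /derivable /= E.
by rewrite /derive /= E.
Qed.


(** The bound is only asked for e <= 1, which lets [derive_tangent_eq0] keep its transversal
    displacement below the tangential one. *)
Lemma eq0_small (x C : R) :
  (forall e : R, 0 < e -> e <= 1 -> `|x| <= e * C) -> x = 0.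
Proof.
move=> H; apply/eqP; rewrite -normr_le0; apply/ler_addgt0Pr => e e0.
rewrite add0r; have C0 : 0 <= C.
  by have := H 1 ltr01 (lexx _); rewrite mul1r; apply: le_trans.
have C1 : 0 < C + 1 by rewrite ltr_wpDl.
have m0 : 0 < Num.min 1 (e / (C + 1)) by rewrite lt_min ltr01 divr_gt0.
have m1 : Num.min 1 (e / (C + 1)) <= 1 by rewrite ge_min lexx.
have /le_trans := H _ m0 m1; apply.
have : Num.min 1 (e / (C + 1)) <= e / (C + 1) by rewrite ge_min lexx orbT.
move/(ler_wpM2r C0)/le_trans; apply.
by rewrite mulrAC ler_pdivrMr // ler_pM2l // lerDl.
Qed.

(* Applying the mean value theorem to [s |-> f (p + s u + t v) - f (p + s u)]
   only requires ['D_u f] to be differentiable at [p] itself. *)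
Lemma second_difference f p u v (eps : R) :
  (\forall q \near p, differentiable f q) -> differentiable ('D_u f) p ->
  0 < eps -> exists2 d : R, 0 < d & forall t : R, 0 < t -> t < d ->
    `|f (t *: u + (t *: v + p)) - f (t *: u + p) - f (t *: v + p) + f p
      - t ^+ 2 * 'D_v ('D_u f) p| <= eps * t ^+ 2.
Proof.
move=> /nbhs_ballP[e /= e0 He] dg eps0.
(* For 0 <= s <= t both s u + t v and s u have norm at most t M, and the summand 1 keeps M positive.
   With eps / (2 M) each of the two approximation errors is at most eps t / 2. *)
set M := `|u| + `|v| + 1.
have M0 : 0 < M by rewrite ltr_wpDl // addr_ge0.
have e'0 : 0 < eps / (2 * M) by rewrite divr_gt0 // mulr_gt0.
have [d d0 Hd] := differentiable_approx dg e'0.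
exists (Num.min e d / M); first by rewrite divr_gt0 // lt_min e0.
move=> t t0; rewrite ltr_pdivlMr // lt_min => /andP[tMe tMd].
have small s : 0 <= s -> s <= t -> `|s *: u + t *: v| <= t * M.
  move=> s0 st; rewrite (le_trans (ler_normD _ _)) // !normrZ.
  rewrite (ger0_norm s0) (ger0_norm (ltW t0)) /M !mulrDr mulr1.
  by rewrite -addrA lerD ?ler_wpM2r // lerDl ltW.
have small0 s : 0 <= s -> s <= t -> `|s *: u| <= t * M.
  move=> s0 st; rewrite normrZ (ger0_norm s0) /M !mulrDr mulr1 -addrA.
  by rewrite ler_wpDr ?ler_wpM2r // addr_ge0 ?mulr_ge0 // ltW.
have inball h : `|h| <= t * M -> differentiable f (h + p).
  move=> hM; apply: He; rewrite -ball_normE /= opprD addrCA subrr addr0 normrN.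
  exact: le_lt_trans hM tMe.
pose F s := f (s *: u + (t *: v + p)) - f (s *: u + p).
pose G s := 'D_u f (s *: u + (t *: v + p)) - 'D_u f (s *: u + p).
have dF s : 0 <= s -> s <= t -> is_derive s 1 F (G s).
  move=> s0 st; apply: is_deriveB; apply: is_derive_line.
    by rewrite addrA; apply/inball/small.
  exact/inball/small0.
have [||c] := @MVT R F G 0 t t0.
- by move=> x; rewrite in_itv /= => /andP[x0 xt]; apply: dF; exact: ltW.
- apply: derivable_within_continuous => x; rewrite in_itv /= => /andP[x0 xt].
  by have [] := dF _ x0 xt.
rewrite in_itv /= => /andP[/ltW c0 /ltW ct]; rewrite subr0 => FE.
have -> : f (t *: u + (t *: v + p)) - f (t *: u + p) - f (t *: v + p) + f p =
   F t - F 0 by rewrite /F scale0r !add0r; ring.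
rewrite FE /G [c *: u + (_ + _)]addrA.
(* The linear approximations of ['D_u f] at c u + t v and at c u differ by exactly t times the
   second derivative, whatever the intermediate point c is. *)
have A1 := Hd _ (le_lt_trans (small c c0 ct) tMd).
have A2 := Hd _ (le_lt_trans (small0 c c0 ct) tMd).
have eM : eps / (2 * M) * (t * M) = eps * t / 2 by field; rewrite gt_eqF.
have {}A1 := le_trans A1 (ler_wpM2l (ltW e'0) (small c c0 ct)).
have {}A2 := le_trans A2 (ler_wpM2l (ltW e'0) (small0 c c0 ct)).
move: A1 A2; rewrite eM deriveDv // (deriveZv t) //.
set z := 'D_u f p; set x := 'D_u f _; set y := 'D_u f _.
set a := 'D_(c *: u) _ p; set b := 'D_v _ p => A1 A2.
have -> : (x - y) * t - t ^+ 2 * b = t * ((x - z - (a + t * b)) - (y - z - a)).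
  by ring.
rewrite normrM (gtr0_norm t0) expr2 mulrCA; apply: (ler_wpM2l (ltW t0)).
rewrite (le_trans (ler_normB _ _)) //.
by rewrite (le_trans (lerD A1 A2)) // -splitr.
Qed.

(** The second difference is symmetric in u and v, and divided by t^2 it tends to either mixed
    derivative. *)
Lemma derive_comm f p u v : (\forall q \near p, differentiable f q) ->
  differentiable ('D_u f) p -> differentiable ('D_v f) p ->
  'D_u ('D_v f) p = 'D_v ('D_u f) p.
Proof.
move=> df du dv; apply/eqP; rewrite -subr_eq0; apply/eqP.
apply: (@eq0_small _ 2) => e e0 _.
have [d d0 Hd] := second_difference v df du e0.
have [d' d'0 Hd'] := second_difference u df dv e0.
have m0 : 0 < Num.min d d' / 2 by rewrite divr_gt0 // lt_min d0.
have : Num.min d d' / 2 < Num.min d d'.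
  by rewrite ltr_pdivrMr // ltr_pMr ?ltr1n // lt_min d0.
move: m0; set t := _ / 2 => t0; rewrite lt_min => /andP[td td'].
have := Hd _ t0 td; have := Hd' _ t0 td'.
rewrite [t *: v + (t *: u + p)]addrCA.
set a := f (_ + (_ + _)); set b := f _; set c := f _; set z := f p => H1 H2.
have t20 : 0 < t ^+ 2 by rewrite exprn_gt0.
rewrite -(ler_pM2r t20) -{1}(gtr0_norm t20) -normrM.
set x := 'D_u _ p; set y := 'D_v _ p.
have -> : (x - y) * t ^+ 2 =
  (a - c - b + z - t ^+ 2 * y) - (a - b - c + z - t ^+ 2 * x) by ring.
rewrite (le_trans (ler_normB _ _)) // (le_trans (lerD H2 H1)) //.
by have -> : e * 2 * t ^+ 2 = e * t ^+ 2 + e * t ^+ 2 by ring.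
Qed.

(* By the intermediate value theorem, [rho] vanishes at some point
   [p + t u + s w] with [s = o(t)]. *)
Lemma derive_tangent_eq0 (rho : V -> R) f p nu u :
  (\forall q \near p, {for q, continuous rho}) ->
  differentiable rho p -> differentiable f p -> rho p = 0 ->
  (\forall q \near p, rho q = 0 -> f q = 0) ->
  'D_nu rho p != 0 -> 'D_u rho p = 0 -> 'D_u f p = 0.
Proof.
move=> crho drho df rho0 fz nu0 u0.
have [w w1] : exists w, 'D_w rho p = 1.
  by exists (('D_nu rho p)^-1 *: nu); rewrite deriveZv // mulVf.
have /nbhs_ballP[r /= r0 Hr] : \forall q \near p,
    {for q, continuous rho} /\ (rho q = 0 -> f q = 0).
  by move: fz; apply: filterS2 crho => q.
apply: (@eq0_small _ (1 + `|'D_w f p|)) => eta eta0 eta1.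
set M := `|u| + `|w| + 1.
have M0 : 0 < M by rewrite ltr_wpDl // addr_ge0.
have e0 : 0 < eta / (2 * M) by rewrite divr_gt0 // mulr_gt0.
have [d1 d10 H1] := differentiable_approx drho e0.
have [d2 d20 H2] := differentiable_approx df e0.
pose m := Num.min r (Num.min d1 d2).
have m0 : 0 < m by rewrite !lt_min r0 d10.
have [t t0] : exists2 t : R, 0 < t & t * M < m.
  exists (m / (2 * M)); first by rewrite divr_gt0 // mulr_gt0.
  have -> : m / (2 * M) * M = m / 2 by field; rewrite gt_eqF.
  by rewrite ltr_pdivrMr // ltr_pMr // ltr1n.
rewrite !lt_min => /andP[tr /andP[td1 td2]].
have small s : `|s| <= eta * t -> `|t *: u + s *: w| <= t * M.
  move=> sh; have st : `|s| <= t.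
    by rewrite (le_trans sh) // ler_piMl // ltW.
  rewrite (le_trans (ler_normD _ _)) // !normrZ.
  rewrite (ger0_norm (ltW t0)) /M !mulrDr mulr1.
  by rewrite -addrA lerD // (le_trans (ler_wpM2r _ st)) // lerDl (ltW t0).
have near_p s : `|s| <= eta * t -> ball p r (t *: u + s *: w + p).
  move=> sh; rewrite -ball_normE /= opprD addrCA subrr addr0 normrN.
  exact: le_lt_trans (small _ sh) tr.
have eM : eta / (2 * M) * (t * M) = eta * t / 2 by field; rewrite gt_eqF.
have etat : 0 < eta * t by rewrite mulr_gt0.
(* Along w the function [rho] grows like s, with an error of half the range of s; so it is
   nonpositive at s = - eta t and nonnegative at s = eta t. *)
have R1 s : `|s| <= eta * t -> `|rho (t *: u + s *: w + p) - s| <= eta * t / 2.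
  move=> sh; have := H1 _ (le_lt_trans (small _ sh) td1).
  move/le_trans/(_ (ler_wpM2l (ltW e0) (small _ sh))); rewrite eM rho0 subr0.
  by rewrite deriveDv // !deriveZv // u0 w1 mulr0 add0r mulr1.
have sp : `|eta * t| <= eta * t by rewrite ger0_norm // ltW.
have sn : `|- (eta * t)| <= eta * t by rewrite normrN.
pose F (s : R) := rho (t *: u + s *: w + p).
have [|||s] := @IVT R F (- (eta * t)) (eta * t) 0.
- by rewrite ge0_cp ?ltW.
- have cF : {in `[- (eta * t), eta * t], continuous F}.
    move=> s; rewrite in_itv /= -ler_norml => sh.
    rewrite /F; apply: (@continuous_comp _ _ _ (fun s : R => t *: u + s *: w + p) rho).
      apply: continuousD; last exact: cst_continuous.
      apply: continuousD; first exact: cst_continuous.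
      exact: scalel_continuous.
    by have [] := Hr _ (near_p _ sh).
  by apply: continuous_in_subspaceT => s /set_mem; exact: cF.
- have := R1 _ sp; have := R1 _ sn; rewrite -/(F _) -/(F _).
  rewrite !ler_norml => /andP[_ A] /andP[B _].
  have Fn : F (- (eta * t)) <= 0 by lra.
  have Fp : 0 <= F (eta * t) by lra.
  by rewrite ge_min Fn le_max Fp orbT.
rewrite in_itv /= -ler_norml => sh Fs.
have [_ /(_ Fs) fs] := Hr _ (near_p _ sh).
have fp : f p = 0 by move: (nbhs_singleton fz); apply.
have := H2 _ (le_lt_trans (small _ sh) td2).
move/le_trans/(_ (ler_wpM2l (ltW e0) (small _ sh))); rewrite eM fs fp !sub0r.
rewrite oppr0 add0r normrN deriveDv // !deriveZv // => A.
rewrite -(ler_pM2l t0) -{1}(gtr0_norm t0) -normrM.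
have -> : t * 'D_u f p = (t * 'D_u f p + s * 'D_w f p) - s * 'D_w f p by ring.
rewrite (le_trans (ler_normB _ _)) // normrM.
rewrite (le_trans (lerD A (ler_wpM2r (normr_ge0 _) sh))) //.
rewrite mulrDr mulr1 mulrDr mulrA [t * eta]mulrC lerD // ler_pdivrMr //.
by rewrite ler_peMr ?ler1n // ltW.
Qed.

End RealAnalysis.



(** * Derivatives of complex-valued functions *)

Lemma Re_mul (R : realType) (x y : R[i]) :
  complex.Re (x * y) = complex.Re x * complex.Re y - complex.Im x * complex.Im y.
Proof. by case: x y => [a b] [c d]. Qed.

Lemma Im_mul (R : realType) (x y : R[i]) :
  complex.Im (x * y) = complex.Re x * complex.Im y + complex.Im x * complex.Re y.
Proof. by case: x y => [a b] [c d]. Qed.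

Lemma Re_add (R : realType) (x y : R[i]) :
  complex.Re (x + y) = complex.Re x + complex.Re y.
Proof. by case: x y => [a b] [c d]. Qed.

Lemma Im_add (R : realType) (x y : R[i]) :
  complex.Im (x + y) = complex.Im x + complex.Im y.
Proof. by case: x y => [a b] [c d]. Qed.

Lemma conjcE (R : realType) (x : R[i]) : conjc x = x^*.
Proof. by []. Qed.

Lemma Re_conjc (R : realType) (x : R[i]) : complex.Re x^* = complex.Re x.
Proof. by case: x. Qed.

Lemma Im_conjc (R : realType) (x : R[i]) : complex.Im x^* = - complex.Im x.
Proof. by case: x. Qed.

Definition cdiff (R : realType) m (f : Cn R m -> R[i]) (p : Cn R m) : Prop :=
  differentiable (fun q => complex.Re (f q)) p /\
  differentiable (fun q => complex.Im (f q)) p.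

Section DerC.
Context {R : realType} {m : nat}.
Implicit Types (f g : Cn R m -> R[i]) (p u v : Cn R m).

Lemma cdiff_cst (c : R[i]) p : cdiff (fun=> c) p.
Proof. by split; exact: differentiable_cst. Qed.

Lemma cdiffD f g p : cdiff f p -> cdiff g p -> cdiff (fun q => f q + g q) p.
Proof.
move=> [f1 f2] [g1 g2]; split.
- under eq_fun do rewrite Re_add; exact: differentiableD.
- under eq_fun do rewrite Im_add; exact: differentiableD.
Qed.

Lemma cdiffM f g p : cdiff f p -> cdiff g p -> cdiff (fun q => f q * g q) p.
Proof.
move=> [f1 f2] [g1 g2]; split.
- under eq_fun do rewrite Re_mul; apply: differentiableB; exact: differentiableM.
- under eq_fun do rewrite Im_mul; apply: differentiableD; exact: differentiableM.
Qed.

Lemma cdiff_conj f p : cdiff f p -> cdiff (fun q => (f q)^*) p.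
Proof.
move=> [f1 f2]; split.
- by under eq_fun do rewrite Re_conjc.
- under eq_fun do rewrite Im_conjc; exact: differentiableN.
Qed.

Lemma cdiffMl (c : R[i]) f p : cdiff f p -> cdiff (fun q => c * f q) p.
Proof. by move=> ?; apply: cdiffM => //; exact: cdiff_cst. Qed.

Lemma cdiffN f p : cdiff f p -> cdiff (fun q => - f q) p.
Proof.
by move=> /(cdiffMl (-1)); under eq_fun do rewrite mulN1r.
Qed.

Lemma cdiffB f g p : cdiff f p -> cdiff g p -> cdiff (fun q => f q - g q) p.
Proof. by move=> ? ?; apply: cdiffD => //; exact: cdiffN. Qed.

Lemma cdiff_sum (I : Type) (r : seq I) (P : pred I) (F : I -> Cn R m -> R[i]) p :
  (forall i, cdiff (F i) p) -> cdiff (fun q => \sum_(i <- r | P i) F i q) p.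
Proof.
move=> dF; elim: r => [|i r IH].
  by under eq_fun do rewrite big_nil; exact: cdiff_cst.
under eq_fun do rewrite big_cons; case: (P i) => //; exact: cdiffD.
Qed.

Lemma cdiff_realC (f : Cn R m -> R) p : differentiable f p -> cdiff (realC f) p.
Proof. by move=> df; split=> //; exact: differentiable_cst. Qed.

Lemma derC_cst (c : R[i]) p v : derC v (fun=> c) p = 0.
Proof. by rewrite /derC !derive_cst. Qed.

Lemma derCD f g p v : cdiff f p -> cdiff g p ->
  derC v (fun q => f q + g q) p = derC v f p + derC v g p.
Proof.
move=> [f1 f2] [g1 g2]; rewrite /derC.
have -> : (fun q => complex.Re (f q + g q)) =
    (fun q => complex.Re (f q)) + (fun q => complex.Re (g q)).
  by apply/funext => q; rewrite Re_add.
have -> : (fun q => complex.Im (f q + g q)) =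
    (fun q => complex.Im (f q)) + (fun q => complex.Im (g q)).
  by apply/funext => q; rewrite Im_add.
by rewrite !deriveD //; exact: diff_derivable.
Qed.

(** Real and imaginary part of a complex product both have this shape, the minus sign of the real
    part being absorbed into one factor. *)
Lemma derive_mul_add (a b c d : Cn R m -> R) p v :
  differentiable a p -> differentiable b p -> differentiable c p ->
  differentiable d p ->
  'D_v (fun q => a q * b q + c q * d q) p =
  a p * 'D_v b p + b p * 'D_v a p + (c p * 'D_v d p + d p * 'D_v c p).
Proof.
move=> da db dc dd.
have ha := derivableP (@diff_derivable _ _ _ _ p v da).
have hb := derivableP (@diff_derivable _ _ _ _ p v db).
have hc := derivableP (@diff_derivable _ _ _ _ p v dc).
have hd := derivableP (@diff_derivable _ _ _ _ p v dd).
by have [_ ->] := is_deriveD (is_deriveM ha hb) (is_deriveM hc hd).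
Qed.

Lemma derCM f g p v : cdiff f p -> cdiff g p ->
  derC v (fun q => f q * g q) p = derC v f p * g p + f p * derC v g p.
Proof.
move=> [f1 f2] [g1 g2].
have nf2 : differentiable (fun q => - complex.Im (f q)) p by exact: differentiableN.
have E1 := derive_mul_add v f1 g1 nf2 g2; have E2 := derive_mul_add v f1 g2 f2 g1.
have EN : 'D_v (fun q => - complex.Im (f q)) p = - 'D_v (fun q => complex.Im (f q)) p.
  by have [_ ->] := is_deriveN (derivableP (@diff_derivable _ _ _ _ p v f2)).
have ER : (fun q => complex.Re (f q * g q)) =
   (fun q => complex.Re (f q) * complex.Re (g q) + - complex.Im (f q) * complex.Im (g q)).
  by apply/funext => q; rewrite Re_mul mulNr.
have EI : (fun q => complex.Im (f q * g q)) =
   (fun q => complex.Re (f q) * complex.Im (g q) + complex.Im (f q) * complex.Re (g q)).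
  by apply/funext => q; rewrite Im_mul.
rewrite /derC ER EI E1 E2 EN.
set A := 'D_v _ p; set B := 'D_v _ p; set C := 'D_v _ p; set D := 'D_v _ p.
move: A B C D => A B C D; case: (f p) => a b; case: (g p) => c d /=.
by apply/eqP; rewrite eq_complex /=; apply/andP; split; apply/eqP; ring.
Qed.

Lemma derC_conj f p v : cdiff f p -> derC v (fun q => (f q)^*) p = (derC v f p)^*.
Proof.
move=> [f1 f2]; rewrite /derC.
have -> : (fun q => complex.Re ((f q)^*)) = (fun q => complex.Re (f q)).
  by apply/funext => q; rewrite Re_conjc.
have -> : (fun q => complex.Im ((f q)^*)) = - (fun q => complex.Im (f q)).
  by apply/funext => q; rewrite Im_conjc.
by rewrite deriveN //; exact: diff_derivable.
Qed.

Lemma derCMl (c : R[i]) f p v : cdiff f p ->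
  derC v (fun q => c * f q) p = c * derC v f p.
Proof.
by move=> df; rewrite derCM ?derC_cst ?mul0r ?add0r //; exact: cdiff_cst.
Qed.

Lemma derCN f p v : cdiff f p -> derC v (fun q => - f q) p = - derC v f p.
Proof.
by move=> df; rewrite -mulN1r -derCMl //; under [in RHS]eq_fun do rewrite mulN1r.
Qed.

Lemma derCB f g p v : cdiff f p -> cdiff g p ->
  derC v (fun q => f q - g q) p = derC v f p - derC v g p.
Proof. by move=> df dg; rewrite derCD ?derCN //; exact: cdiffN. Qed.

Lemma derC_sum (I : Type) (r : seq I) (P : pred I) (F : I -> Cn R m -> R[i]) p v :
  (forall i, cdiff (F i) p) ->
  derC v (fun q => \sum_(i <- r | P i) F i q) p = \sum_(i <- r | P i) derC v (F i) p.
Proof.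
move=> dF; elim: r => [|i r IH].
  by under eq_fun do rewrite big_nil; rewrite big_nil derC_cst.
under eq_fun do rewrite big_cons; rewrite big_cons.
by case: (P i) => //; rewrite derCD ?IH //; exact: cdiff_sum.
Qed.

Lemma derC_realC (f : Cn R m -> R) p v : derC v (realC f) p = ('D_v f p : R)%:C.
Proof. by rewrite /derC /realC /= derive_cst. Qed.

Lemma derCDv f p u v : cdiff f p -> derC (u + v) f p = derC u f p + derC v f p.
Proof. by move=> [f1 f2]; rewrite /derC !deriveDv. Qed.

Lemma derCZv f p (c : R) v : cdiff f p -> derC (c *: v) f p = c%:C * derC v f p.
Proof.
move=> [f1 f2]; rewrite /derC !deriveZv //.
by apply/eqP; rewrite eq_complex /= !mul0r subr0 addr0 !eqxx.
Qed.

Lemma derC_comm f p u v : (\forall q \near p, cdiff f q) ->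
  cdiff (derC u f) p -> cdiff (derC v f) p ->
  derC u (derC v f) p = derC v (derC u f) p.
Proof.
move=> df [u1 u2] [v1 v2].
have d1 : \forall q \near p, differentiable (fun q => complex.Re (f q)) q.
  by apply: filterS df => q [].
have d2 : \forall q \near p, differentiable (fun q => complex.Im (f q)) q.
  by apply: filterS df => q [].
exact: (f_equal2 (@Complex R) (derive_comm d1 u1 v1) (derive_comm d2 u2 v2)).
Qed.

Lemma derC_tangent_eq0 (rho : Cn R m -> R) f p nu u :
  (\forall q \near p, {for q, continuous rho}) ->
  differentiable rho p -> cdiff f p -> rho p = 0 ->
  (\forall q \near p, rho q = 0 -> f q = 0) ->
  'D_nu rho p != 0 -> 'D_u rho p = 0 -> derC u f p = 0.
Proof.
move=> c d [f1 f2] r0 fz nu0 u0; rewrite /derC.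
rewrite (@derive_tangent_eq0 _ _ rho _ p nu) //; last first.
  by apply: filterS fz => q H /H ->.
rewrite (@derive_tangent_eq0 _ _ rho _ p nu) //.
by apply: filterS fz => q H /H ->.
Qed.

End DerC.


(** * Smooth functions and real coordinates *)

Section SmoothFacts.
Context {R : realType} {m : nat}.
Implicit Types (W : set (Cn R m)) (p q u v : Cn R m).

Lemma smooth_differentiable W (f : Cn R m -> R) p :
  smooth W f -> W p -> differentiable f p.
Proof. by move=> /(_ 1%N) [df _]; exact: df. Qed.

Lemma smooth_derive W (f : Cn R m -> R) v : smooth W f -> smooth W ('D_v f).
Proof. by move=> sf k; have [_] := sf k.+1; apply. Qed.

Lemma smoothC_cdiff W (f : Cn R m -> R[i]) p : smoothC W f -> W p -> cdiff f p.
Proof. by move=> [f1 f2] Wp; split; [move: f1|move: f2] => /smooth_differentiable; exact. Qed.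

Lemma smoothC_derC W (f : Cn R m -> R[i]) v : smoothC W f -> smoothC W (derC v f).
Proof. by move=> [f1 f2]; split; exact: smooth_derive. Qed.

End SmoothFacts.

Lemma zc_lin (R : realType) m (c : R) (u v : Cn R m) j :
  zc (c *: u + v) j = c%:C * zc u j + zc v j.
Proof.
by apply/eqP; rewrite eq_complex /= !mxE /= mul0r subr0 mul0r addr0 !eqxx.
Qed.

Lemma Cn_expand (R : realType) m (v : Cn R m) :
  v = \sum_j (v.1 0 j *: ex R j + v.2 0 j *: ey R j).
Proof.
rewrite big_split /=; case: v => x y /=.
have -> : \sum_j x 0 j *: ex R j = (x, 0).
  transitivity (\sum_j (x 0 j *: delta_mx 0 j : 'rV[R]_m), 0 : 'rV[R]_m);
    last by rewrite -row_sum_delta.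
  elim/big_rec2: _ => // i a b _ ->; rewrite /ex.
  by congr pair => /=; rewrite scaler0 addr0.
have -> : \sum_j y 0 j *: ey R j = (0, y).
  transitivity (0 : 'rV[R]_m, \sum_j (y 0 j *: delta_mx 0 j : 'rV[R]_m));
    last by rewrite -row_sum_delta.
  elim/big_rec2: _ => // i a b _ ->; rewrite /ey.
  by congr pair => /=; rewrite scaler0 addr0.
by congr pair => /=; rewrite ?addr0 ?add0r.
Qed.

(** * Wirtinger derivatives *)

Section Wirtinger.
Context {R : realType} {m : nat}.
Implicit Types (f g : Cn R m -> R[i]) (p q u v : Cn R m).

Lemma derC_sumv f p (I : Type) (r : seq I) (F : I -> Cn R m) : cdiff f p ->
  derC (\sum_(i <- r) F i) f p = \sum_(i <- r) derC (F i) f p.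
Proof.
move=> df; elim: r => [|i r IH]; last by rewrite !big_cons derCDv // IH.
by rewrite !big_nil -(scale0r (0 : Cn R m)) derCZv // mul0r.
Qed.

(** The splitting of df into its (1,0) and (0,1) parts: expand v in real coordinates and rewrite x
    and y through z and its conjugate. *)
Lemma derC_wirtinger f p v : cdiff f p ->
  derC v f p = \sum_j dz j f p * zc v j + \sum_j dzb j f p * (zc v j)^*.
Proof.
move=> df; rewrite {1}[v]Cn_expand derC_sumv // -big_split /=.
apply: eq_bigr => j _; rewrite derCDv // !derCZv // /dz /dzb.
rewrite -[v.1 0 j]/(complex.Re (zc v j)) -[v.2 0 j]/(complex.Im (zc v j)).
set A := derC _ f p; set B := derC _ f p; move: A B (zc v j) => A B [x y] /=.
rewrite -conjcE -!complexiE /=; have -> : x -i* y = x%:C - 'i%C * y%:C.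
  by apply/eqP; rewrite eq_complex /=; apply/andP; split; apply/eqP; ring.
have -> : x +i* y = x%:C + 'i%C * y%:C.
  by apply/eqP; rewrite eq_complex /=; apply/andP; split; apply/eqP; ring.
have i2 : 'i%C ^+ 2 = -1 :> R[i] := sqr_i _.
transitivity (A * x%:C - 'i%C ^+ 2 * (y%:C * B)); last by field.
by rewrite i2 mulN1r opprK mulrC.
Qed.

Lemma dz_conj j f p : cdiff f p -> dz j (fun q => (f q)^*) p = (dzb j f p)^*.
Proof.
move=> df; rewrite /dz /dzb !derC_conj //.
by rewrite rmorphM rmorphD rmorphM /= fmorphV /= rmorph_nat conjCi mulNr.
Qed.

Lemma rho1bE (rho : Cn R m -> R) k p : rho1b rho k p = (rho1 rho k p)^*.
Proof.
rewrite /rho1b /rho1 /dz /dzb !derC_realC.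
rewrite rmorphM rmorphB rmorphM /= fmorphV /= rmorph_nat conjCi mulNr opprK.
by rewrite -!conjcE !conjc_real.
Qed.

End Wirtinger.


(** * The flat Hermitian form *)

Definition hform (R : realType) m (a : 'M[R[i]]_m) (x y : 'rV[R[i]]_m) : R[i] :=
  \sum_j \sum_k a j k * x 0 j * (y 0 k)^*.

Definition zrow (R : realType) m (v : Cn R m) : 'rV[R[i]]_m := \row_j zc v j.

(** The (1,0)-form d' rho; [T10 rho p x] unfolds to its vanishing on x, and the two are exchanged
    freely below. *)
Definition del (R : realType) m (rho : Cn R m -> R) (p : Cn R m)
    (x : 'rV[R[i]]_m) : R[i] := \sum_j rho1 rho j p * x 0 j.

Section Hform.
Context {R : realType} {m : nat} (a : 'M[R[i]]_m).
Implicit Types x y z : 'rV[R[i]]_m.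

Lemma hformPl c x y z : hform a (c *: x + y) z = c * hform a x z + hform a y z.
Proof.
rewrite /hform mulr_sumr -big_split; apply: eq_bigr => j _ /=.
rewrite mulr_sumr -big_split; apply: eq_bigr => k _ /=.
by rewrite !mxE; ring.
Qed.

Lemma hformPr c x y z :
  hform a x (c *: y + z) = c^* * hform a x y + hform a x z.
Proof.
rewrite /hform mulr_sumr -big_split; apply: eq_bigr => j _ /=.
rewrite mulr_sumr -big_split; apply: eq_bigr => k _ /=.
by rewrite !mxE rmorphD rmorphM /=; ring.
Qed.

Lemma hform0l x : hform a 0 x = 0.
Proof. by rewrite /hform big1 // => j _; rewrite big1 // => k _; rewrite mxE mulr0 mul0r. Qed.

Lemma hform0r x : hform a x 0 = 0.
Proof. by rewrite /hform big1 // => j _; rewrite big1 // => k _; rewrite mxE conjC0 mulr0. Qed.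

Lemma hformDl x y z : hform a (x + y) z = hform a x z + hform a y z.
Proof. by rewrite -{1}[x]scale1r hformPl mul1r. Qed.

Lemma hformZl c x z : hform a (c *: x) z = c * hform a x z.
Proof. by rewrite -[c *: x]addr0 hformPl hform0l addr0. Qed.

Lemma hformDr x y z : hform a x (y + z) = hform a x y + hform a x z.
Proof. by rewrite -{1}[y]scale1r hformPr conjC1 mul1r. Qed.

Lemma hformZr c x y : hform a x (c *: y) = c^* * hform a x y.
Proof. by rewrite -[c *: y]addr0 hformPr hform0r addr0. Qed.

Lemma hformBl x y z : hform a (x - y) z = hform a x z - hform a y z.
Proof. by rewrite hformDl -[- y]scaleN1r hformZl mulN1r. Qed.

Lemma hform_suml I (r : seq I) (F : I -> 'rV[R[i]]_m) z :
  hform a (\sum_(i <- r) F i) z = \sum_(i <- r) hform a (F i) z.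
Proof.
elim: r => [|i r IH]; first by rewrite !big_nil hform0l.
by rewrite !big_cons hformDl IH.
Qed.

Lemma hform_sumr I (r : seq I) (F : I -> 'rV[R[i]]_m) z :
  hform a z (\sum_(i <- r) F i) = \sum_(i <- r) hform a z (F i).
Proof.
elim: r => [|i r IH]; first by rewrite !big_nil hform0r.
by rewrite !big_cons hformDr IH.
Qed.

Context (pa : posdef_hermitian a).

Lemma herm_entry j k : (a j k)^* = a k j.
Proof. by case: pa => H _; rewrite -conjcE -H. Qed.

Lemma hform_conj x y : (hform a x y)^* = hform a y x.
Proof.
rewrite /hform rmorph_sum /= exchange_big /=; apply: eq_bigr => j _.
rewrite rmorph_sum /=; apply: eq_bigr => k _.
by rewrite !rmorphM /= conjCK herm_entry mulrAC.
Qed.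

Lemma hform_gt0 x : x != 0 -> 0 < hform a x x.
Proof. by case: pa => _; apply. Qed.

Lemma hform_eq0 x : hform a x x = 0 -> x = 0.
Proof. by move=> H; apply/eqP; apply: contraT => /hform_gt0; rewrite H ltxx. Qed.

(** A vector v with v a = 0 has [hform a v v = 0]. *)
Lemma posdef_unitmx : a \in unitmx.
Proof.
rewrite -row_free_unit -kermx_eq0; apply/rowV0P => v /sub_kermxP va.
apply: hform_eq0; transitivity (\sum_k (v *m a) 0 k * (v 0 k)^*).
  rewrite /hform exchange_big /=; apply: eq_bigr => k _.
  rewrite mxE mulr_suml; apply: eq_bigr => j _.
  by rewrite [v 0 j * _]mulrC.
by rewrite va big1 // => k _; rewrite mxE mul0r.
Qed.

Definition grad (rho : Cn R m -> R) (p : Cn R m) : 'rV[R[i]]_m :=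
  \row_j \sum_k invmx a k j * rho1b rho k p.

Lemma invmx_herm j k : (invmx a j k)^* = invmx a k j.
Proof.
have ua := posdef_unitmx.
have aT : a^T = map_mx Num.conj a.
  by apply/matrixP => r s; rewrite !mxE herm_entry.
have : (map_mx Num.conj (invmx a))^T = invmx a.
  apply: (can_inj (mulKmx ua)); rewrite mulmxV //.
  apply: trmx_inj; rewrite trmx_mul trmxK trmx1 aT -map_mxM mulVmx //.
  by rewrite map_mx1.
by move=> /matrixP/(_ k j); rewrite !mxE.
Qed.

(** Conjugating the second argument turns the entries of the inverse into their transposes, so a
    meets its own inverse. *)
Lemma hform_grad rho p x : hform a x (grad rho p) = del rho p x.
Proof.
rewrite /hform /del; apply: eq_bigr => j _.
transitivity (\sum_l (\sum_k a j k * invmx a k l) * rho1 rho l p * x 0 j).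
  under [RHS]eq_bigr do rewrite !mulr_suml.
  rewrite [RHS]exchange_big /=; apply: eq_bigr => k _.
  rewrite !mxE rmorph_sum /= mulr_sumr; apply: eq_bigr => l _.
  by rewrite rmorphM /= invmx_herm rho1bE conjCK; ring.
rewrite (bigD1 j) //= [X in _ + X]big1 => [|l lj].
  have := congr1 (fun M : 'M[R[i]]_m => M j j) (mulmxV posdef_unitmx).
  by rewrite !mxE eqxx addr0 => ->; rewrite mul1r.
have := congr1 (fun M : 'M[R[i]]_m => M j l) (mulmxV posdef_unitmx).
by rewrite !mxE eq_sym (negPf lj) => ->; rewrite !mul0r.
Qed.

Lemma dual_normsqE rho p : dual_normsq a rho p = del rho p (grad rho p).
Proof.
rewrite /dual_normsq /del; apply: eq_bigr => j _.
rewrite mxE mulr_sumr; apply: eq_bigr => k _.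
by rewrite mxE; ring.
Qed.

(** The dual norm is the norm of the gradient, and a zero gradient would make every rho_j, its
    product with a basis vector, vanish. *)
Lemma dual_normsq_gt0 rho p : (exists j, rho1 rho j p != 0) ->
  0 < dual_normsq a rho p.
Proof.
move=> [j hj]; rewrite dual_normsqE -hform_grad; apply: hform_gt0.
apply: contraNneq hj => g0; have := hform_grad rho p (delta_mx 0 j).
rewrite g0 hform0r /del (bigD1 j) //= big1 => [|k kj].
  by rewrite mxE !eqxx mulr1 addr0 => <-.
by rewrite mxE (negPf kj) andbF mulr0.
Qed.

End Hform.

(** * Real vectors as complex rows, and the forms d' rho and theta *)

Section Rows.
Context {R : realType} {m : nat}.
Implicit Types (x y : 'rV[R[i]]_m) (u v : Cn R m).

Lemma toCnK x : zrow (toCn x) = x.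
Proof.
apply/rowP => j; rewrite !mxE /zc /= !mxE.
by case: (x 0 j).
Qed.

Lemma zrowK v : toCn (zrow v) = v.
Proof.
case: v => v1 v2; rewrite /toCn /zrow; congr pair;
  by apply/rowP => j; rewrite !mxE /zc.
Qed.

Lemma zrowP (c : R) u v : zrow (c *: u + v) = c%:C *: zrow u + zrow v.
Proof. by apply/rowP => j; rewrite !mxE zc_lin. Qed.

Lemma zrow0 : zrow (0 : Cn R m) = 0.
Proof. by apply/rowP => j; rewrite !mxE /zc /= !mxE. Qed.

Lemma zrowD u v : zrow (u + v) = zrow u + zrow v.
Proof. by rewrite -[u]scale1r zrowP !scale1r. Qed.

Lemma zrowZ (c : R) u : zrow (c *: u) = c%:C *: zrow u.
Proof. by rewrite -[c *: u]addr0 zrowP zrow0 addr0. Qed.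

Lemma zrow_inj u v : zrow u = zrow v -> u = v.
Proof. by move=> E; rewrite -[u]zrowK E zrowK. Qed.

Lemma zcE v j : zc v j = zrow v 0 j.
Proof. by rewrite mxE. Qed.

Lemma delP (rho : Cn R m -> R) p c x y : del rho p (c *: x + y) = c * del rho p x + del rho p y.
Proof.
rewrite /del mulr_sumr -big_split; apply: eq_bigr => j _ /=.
by rewrite !mxE; ring.
Qed.

Lemma del0 (rho : Cn R m -> R) p : del rho p 0 = 0.
Proof. by rewrite /del big1 // => j _; rewrite mxE mulr0. Qed.

Lemma delD (rho : Cn R m -> R) p x y : del rho p (x + y) = del rho p x + del rho p y.
Proof. by rewrite -{1}[x]scale1r delP mul1r. Qed.

Lemma delZ (rho : Cn R m -> R) p c x : del rho p (c *: x) = c * del rho p x.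
Proof. by rewrite -[c *: x]addr0 delP del0 addr0. Qed.

Lemma del_sum (rho : Cn R m -> R) p I (r : seq I) (F : I -> 'rV[R[i]]_m) :
  del rho p (\sum_(i <- r) F i) = \sum_(i <- r) del rho p (F i).
Proof.
elim: r => [|i r IH]; first by rewrite !big_nil del0.
by rewrite !big_cons delD IH.
Qed.

Lemma derive_del (rho : Cn R m -> R) p v : differentiable rho p ->
  ('D_v rho p : R)%:C = del rho p (zrow v) + (del rho p (zrow v))^*.
Proof.
move=> dr; rewrite -derC_realC derC_wirtinger; last exact: cdiff_realC.
rewrite /del rmorph_sum /=; congr (_ + _); apply: eq_bigr => j _.
  by rewrite mxE.
by rewrite -/(rho1b rho j p) rho1bE [in RHS]rmorphM /= mxE.
Qed.

Lemma theta_del (rho : Cn R m -> R) p v :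
  theta rho p v = 'i * (del rho p (zrow v))^*.
Proof.
rewrite /theta /del rmorph_sum /=; congr (_ * _); apply: eq_bigr => j _.
by rewrite rho1bE [in RHS]rmorphM /= mxE.
Qed.

(* On T(M), [theta = -i d' rho] is real. *)
Lemma del_tangent (rho : Cn R m -> R) p v : differentiable rho p ->
  tangent rho p v -> del rho p (zrow v) = 'i * theta rho p v.
Proof.
move=> dr tv; have := derive_del v dr; rewrite tv => /esym/eqP.
rewrite theta_del addr_eq0 => /eqP E.
by rewrite mulrA -expr2 sqrCi mulN1r -E.
Qed.

Lemma theta_real (rho : Cn R m -> R) p v : differentiable rho p ->
  tangent rho p v -> (theta rho p v)^* = theta rho p v.
Proof.
move=> dr tv; have := derive_del v dr; rewrite tv => /esym/eqP.
rewrite theta_del addr_eq0 => /eqP E.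
by rewrite rmorphM /= conjCK conjCi {1}E mulrNN.
Qed.

Lemma tangent_toCn (rho : Cn R m -> R) p x : differentiable rho p ->
  del rho p x = 0 -> tangent rho p (toCn x).
Proof.
move=> dr dx; have := derive_del (toCn x) dr.
by rewrite toCnK dx conjC0 addr0 => /complexI.
Qed.

Lemma theta_toCn (rho : Cn R m -> R) p x :
  del rho p x = 0 -> theta rho p (toCn x) = 0.
Proof. by move=> dx; rewrite theta_del toCnK dx conjC0 mulr0. Qed.

Lemma theta_lin (rho : Cn R m -> R) p (c : R) u v :
  theta rho p (c *: u + v) = c%:C * theta rho p u + theta rho p v.
Proof.
rewrite !theta_del zrowP delP rmorphD rmorphM /= -[(c%:C)^*]conjcE conjc_real.
by ring.
Qed.

End Rows.


(** * Restriction of forms to a hypersurface *)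

(** The pointwise conditions on a defining function under which functions and forms are restricted
    to its zero set: enough for symmetric second derivatives and a transversal direction. *)
Definition regular_at (R : realType) m (rho : Cn R m -> R) (p : Cn R m) : Prop :=
  [/\ \forall q \near p, differentiable rho q,
      forall v, differentiable ('D_v rho) p,
      rho p = 0 & exists v, 'D_v rho p != 0].

(** The complex bilinear Hessian, written rho_(X Y) in the overview. *)
Definition q2 (R : realType) m (rho : Cn R m -> R) (p : Cn R m)
    (x y : 'rV[R[i]]_m) : R[i] :=
  \sum_j \sum_k rho2 rho j k p * x 0 j * y 0 k.

Section Regular.
Context {R : realType} {m : nat} (rho : Cn R m -> R) (p : Cn R m).
Context (reg : regular_at rho p).
Implicit Types (u v : Cn R m) (phi : form1 R m) (f : Cn R m -> R[i]).

Lemma regular_diff : differentiable rho p.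
Proof. by case: reg => H _ _ _; exact: (nbhs_singleton H). Qed.

Lemma regular_derC_eq0 f u : cdiff f p ->
  (\forall q \near p, rho q = 0 -> f q = 0) -> tangent rho p u -> derC u f p = 0.
Proof.
case: reg => dr _ r0 [nu nu0] df fz tu.
apply: (@derC_tangent_eq0 _ _ rho f p nu) => //; last exact: nbhs_singleton dr.
by apply: filterS dr => q /differentiable_continuous.
Qed.

(* The restriction of forms to M commutes with the exterior derivative: with
   ['D_nu rho p != 0], the function [phi w' * 'D_nu rho - 'D_w' rho * phi nu]
   vanishes on M, hence so do its tangential derivatives. *)
Lemma ext_d_tangent_eq0 phi u v : (forall w, cdiff (phi^~ w) p) ->
  (\forall q \near p, forall (c : R) w w',
     phi q (c *: w + w') = c%:C * phi q w + phi q w') ->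
  (\forall q \near p, rho q = 0 -> forall w, tangent rho q w -> phi q w = 0) ->
  tangent rho p u -> tangent rho p v -> ext_d phi p u v = 0.
Proof.
case: reg => dr ddr r0 [nu nu0] dphi phil phi0 tu tv.
have phip w : tangent rho p w -> phi p w = 0 by apply: (nbhs_singleton phi0).
have key w w' : tangent rho p w -> tangent rho p w' ->
    derC w (phi^~ w') p * ('D_nu rho p : R)%:C = ('D_w ('D_w' rho) p : R)%:C * phi p nu.
  move=> tw tw'.
  pose f q := phi q w' * realC ('D_nu rho) q - realC ('D_w' rho) q * phi q nu.
  have d1 : cdiff (realC ('D_nu rho)) p by exact: cdiff_realC.
  have d2 : cdiff (realC ('D_w' rho)) p by exact: cdiff_realC.
  have df : cdiff f p by apply: cdiffB; apply: cdiffM.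
  have : derC w f p = 0.
    apply: regular_derC_eq0 => //.
    apply: filterS3 dr phil phi0 => q drq linq zq rq.
    (* Tangent at every nearby q, although w' itself is tangent only at p. *)
    have tq : tangent rho q ('D_nu rho q *: w' + - 'D_w' rho q *: nu).
      by rewrite /tangent deriveDv // !deriveZv // mulNr mulrC subrr.
    have := zq rq _ tq; rewrite linq -[_ *: nu]addr0 linq.
    have -> : phi q 0 = 0.
      have := linq (-1) 0 0; rewrite scaler0 add0r => ->.
      by rewrite rmorphN1 mulN1r addNr.
    rewrite addr0 rmorphN /= mulNr => E.
    by rewrite /f /realC [phi q w' * _]mulrC.
  rewrite /f derCB; [|exact: cdiffM|exact: cdiffM].
  rewrite (derCM _ (dphi _) d1) (derCM _ d2 (dphi _)) !derC_realC /realC.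
  rewrite (phip _ tw') mul0r addr0 tw' mul0r addr0.
  by move/eqP; rewrite subr_eq0 => /eqP.
have nuC : ('D_nu rho p : R)%:C != 0 by rewrite (inj_eq (@complexI _)).
(* By [key] both terms of the exterior derivative are [phi p nu] times a mixed second derivative of
   [rho], and these agree. *)
apply: (mulIf nuC); rewrite mul0r /ext_d mulrBl (key _ _ tu tv) (key _ _ tv tu).
by rewrite (derive_comm dr (ddr u) (ddr v)) subrr.
Qed.

Lemma rho1E k : rho1 rho k =
  (fun q => 2^-1 * (realC ('D_(ex R k) rho) q - 'i * realC ('D_(ey R k) rho) q)).
Proof. by apply/funext => q; rewrite /rho1 /dz !derC_realC. Qed.

Lemma cdiff_rho1 k : cdiff (rho1 rho k) p.
Proof.
rewrite rho1E; case: reg => _ ddr _ _.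
by apply/cdiffMl/cdiffB; [|apply/cdiffMl]; exact: cdiff_realC.
Qed.

Lemma derC_rho1E k v : derC v (rho1 rho k) p =
  2^-1 * (('D_v ('D_(ex R k) rho) p : R)%:C - 'i * ('D_v ('D_(ey R k) rho) p : R)%:C).
Proof.
case: reg => _ ddr _ _.
have d w : cdiff (realC ('D_w rho)) p by exact: cdiff_realC.
rewrite rho1E derCMl; last by apply: cdiffB; [exact: d|exact/cdiffMl/d].
rewrite derCB; [|exact: d|exact/cdiffMl/d].
by rewrite (derCMl _ _ (d _)) (derC_realC _ _ v) (derC_realC ('D_(ey R k) rho)).
Qed.

(** Both sides expand into the real Hessian of [rho], which is symmetric by [derive_comm]. *)
Lemma rho2_sym j k : rho2 rho j k p = rho2 rho k j p.
Proof.
case: reg => dr ddr _ _.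
have E r s : rho2 rho r s p = 2^-1 *
   (derC (ex R r) (rho1 rho s) p - 'i * derC (ey R r) (rho1 rho s) p) by [].
pose D (u v : Cn R m) : R := 'D_u ('D_v rho) p.
have Dsym u v : D u v = D v u := derive_comm dr (ddr u) (ddr v).
have E1 s v : derC v (rho1 rho s) p =
  2^-1 * ((D v (ex R s))%:C - 'i * (D v (ey R s))%:C) := derC_rho1E s v.
clearbody D; rewrite !E !E1.
generalize (ex R j) (ey R j) (ex R k) (ey R k) => x1 y1 x2 y2.
by rewrite (Dsym x1 x2) (Dsym x1 y2) (Dsym y1 x2) (Dsym y1 y2); ring.
Qed.

Lemma q2_sym x y : q2 rho p x y = q2 rho p y x.
Proof.
rewrite /q2 exchange_big /=; apply: eq_bigr => j _; apply: eq_bigr => k _.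
by rewrite rho2_sym mulrAC.
Qed.

Context (a : 'M[R[i]]_m) (pa : posdef_hermitian a).
Context (ra : forall j k, rho11 rho j k p = a j k).

Lemma derC_rho1 k v : derC v (rho1 rho k) p =
  \sum_j rho2 rho j k p * zc v j + \sum_j a k j * (zc v j)^*.
Proof.
rewrite derC_wirtinger; last exact: cdiff_rho1.
congr (_ + _); apply: eq_bigr => j _; congr (_ * _).
(* The derivative of rho_k by conj z_j is the conjugate of rho_(j kbar), hence the entry [a k j]. *)
rewrite -(herm_entry pa) -ra /rho11.
have -> : dzb k (realC rho) = (fun q => (rho1 rho k q)^*).
  by apply/funext => q; rewrite -rho1bE.
by rewrite dz_conj ?conjCK //; exact: cdiff_rho1.
Qed.

Lemma sum_derC_rho1 (x : 'rV[R[i]]_m) v :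
  \sum_k x 0 k * derC v (rho1 rho k) p = q2 rho p (zrow v) x + hform a x (zrow v).
Proof.
rewrite /q2 /hform exchange_big -big_split /=; apply: eq_bigr => k _.
rewrite derC_rho1 mulrDr !mulr_sumr; congr (_ + _); apply: eq_bigr => j _.
  by rewrite mxE; ring.
by rewrite mxE; ring.
Qed.

Lemma cdiff_theta v : cdiff ((theta rho)^~ v) p.
Proof.
rewrite /theta; apply: cdiffMl; apply: cdiff_sum => k; apply: cdiffM.
  have -> : rho1b rho k = (fun q => (rho1 rho k q)^*).
    by apply/funext => q; rewrite rho1bE.
  by apply: cdiff_conj; exact: cdiff_rho1.
exact: cdiff_cst.
Qed.

Lemma derC_theta u v : derC u ((theta rho)^~ v) p =
  'i * (q2 rho p (zrow u) (zrow v) + hform a (zrow v) (zrow u))^*.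
Proof.
have -> : (theta rho)^~ v =
    (fun q => 'i * (\sum_k (zrow v) 0 k * rho1 rho k q)^*).
  apply/funext => q; rewrite theta_del /del; congr (_ * (_)^*).
  by apply: eq_bigr => k _; rewrite mulrC.
have d k : cdiff (fun q => (zrow v) 0 k * rho1 rho k q) p.
  by apply/cdiffMl/cdiff_rho1.
have d' := cdiff_sum (index_enum 'I_m) xpredT d.
rewrite derCMl; last exact: cdiff_conj.
rewrite derC_conj // derC_sum // -sum_derC_rho1; congr (_ * (_)^*).
by apply: eq_bigr => k _; rewrite derCMl //; exact: cdiff_rho1.
Qed.

(** The symmetric part [q2] cancels, so d theta is i a_(j kbar) dz_j ^ conj dz_k: at points of M it
    only sees the constant metric. *)
Lemma ext_d_theta u v : ext_d (theta rho) p u v =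
  'i * (hform a (zrow u) (zrow v) - hform a (zrow v) (zrow u)).
Proof.
rewrite /ext_d !derC_theta !rmorphD /= !(hform_conj pa).
by rewrite (q2_sym (zrow u)); ring.
Qed.

End Regular.


Local Opaque theta rho1 rho1b rho2 rho11 dual_normsq.

(** * Real-linear forms and their types *)

Section RealLinear.
Context {R : realType} {m : nat}.
Implicit Types (x y : 'rV[R[i]]_m) (phi : Cn R m -> R[i]).

Definition rlinear phi :=
  forall (c : R) (u v : Cn R m), phi (c *: u + v) = c%:C * phi u + phi v.

Context (phi : Cn R m -> R[i]) (lphi : rlinear phi).

Lemma rlinear0 : phi 0 = 0.
Proof.
by have := lphi (-1) 0 0; rewrite scaler0 add0r => ->; rewrite rmorphN1 mulN1r addNr.
Qed.

Lemma rlinearD u v : phi (u + v) = phi u + phi v.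
Proof. by have := lphi 1 u v; rewrite scale1r mul1r. Qed.

Lemma rlinearZ (c : R) u : phi (c *: u) = c%:C * phi u.
Proof. by have := lphi c u 0; rewrite !addr0 rlinear0 addr0. Qed.

Lemma rlinearN u : phi (- u) = - phi u.
Proof. by rewrite -scaleN1r rlinearZ rmorphN1 mulN1r. Qed.

Lemma rlinear_sum I (r : seq I) (F : I -> Cn R m) :
  phi (\sum_(i <- r) F i) = \sum_(i <- r) phi (F i).
Proof.
elim: r => [|i r IH]; first by rewrite !big_nil rlinear0.
by rewrite !big_cons rlinearD IH.
Qed.

Lemma toCnD x y : toCn (x + y) = toCn x + toCn y.
Proof. by apply: zrow_inj; rewrite zrowD !toCnK. Qed.

Lemma toCnZ (c : R) x : toCn (c%:C *: x) = c *: toCn x.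
Proof. by apply: zrow_inj; rewrite zrowZ !toCnK. Qed.

Lemma toCn0 : toCn (0 : 'rV[R[i]]_m) = 0.
Proof. by apply: zrow_inj; rewrite zrow0 toCnK. Qed.

Lemma toCn_sum I (r : seq I) (F : I -> 'rV[R[i]]_m) :
  toCn (\sum_(i <- r) F i) = \sum_(i <- r) toCn (F i).
Proof.
elim: r => [|i r IH]; first by rewrite !big_nil toCn0.
by rewrite !big_cons toCnD IH.
Qed.

Lemma rlinear_toCn (c : R[i]) x : phi (toCn (c *: x)) =
  (complex.Re c)%:C * phi (toCn x) + (complex.Im c)%:C * phi (toCn ('i *: x)).
Proof.
rewrite {1}[c]complexE complexiE scalerDl toCnD toCnZ mulrC -scalerA toCnZ.
by rewrite rlinearD !rlinearZ.
Qed.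

(** The right-hand side is the complex linear part of [phi] at x; with the opposite sign, in
    [ev1_vec01], it is the antilinear part. *)
Lemma ev1_vec10 x :
  ev1 phi (vec10 x) = 2^-1 * (phi (toCn x) - 'i * phi (toCn ('i *: x))).
Proof.
rewrite /ev1 /vec10 /= rlinearN !rlinearZ.
have -> : (2^-1 : R)%:C = 2^-1 :> R[i] by rewrite fmorphV rmorph_nat.
by ring.
Qed.

Lemma ev1_vec01 x :
  ev1 phi (vec01 x) = 2^-1 * (phi (toCn x) + 'i * phi (toCn ('i *: x))).
Proof.
rewrite /ev1 /vec01 /= !rlinearZ.
have -> : (2^-1 : R)%:C = 2^-1 :> R[i] by rewrite fmorphV rmorph_nat.
by ring.
Qed.

End RealLinear.

Lemma sum_delta (K : pzRingType) (I : finType) (F : I -> K) (i : I) :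
  \sum_j F j * (j == i)%:R = F i.
Proof.
rewrite (bigD1 i) //= big1 => [|j /negPf ->]; last by rewrite mulr0.
by rewrite eqxx mulr1 addr0.
Qed.

(** * Pseudohermitian geometry along the hypersurface *)

(** The neighbourhood W is fixed once and for all. Convexity is left out, so that connection,
    torsion and curvature are computed before it enters, and the tube is treated by the same
    record. *)
Record ph_setting (R : realType) n (U : set (Cn R n.+1)) (rho : Cn R n.+1 -> R)
    (a : 'M[R[i]]_n.+1) (D : ph_data R n) (W : set (Cn R n.+1)) : Prop :=
  PhSetting {
    phs_def : defining_function U rho;
    phs_pos : posdef_hermitian a;
    phs_lev : levi_constant_along U rho a;
    phs_open : open W;
    phs_sub : W `<=` U;
    phs_smooth : ph_smooth W D;
    phs_frame : is_frame (W `&` hypersurface U rho) rho D;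
    phs_reeb : is_reeb (W `&` hypersurface U rho) rho D;
    phs_coframe : is_coframe (W `&` hypersurface U rho) D;
    phs_levi : is_levi (W `&` hypersurface U rho) rho D;
    phs_tw : is_tanaka_webster (W `&` hypersurface U rho) rho D }.

Section Structure.
Context {R : realType} {n : nat} (U : set (Cn R n.+1)) (rho : Cn R n.+1 -> R).
Context (a : 'M[R[i]]_n.+1) (D : ph_data R n) (W : set (Cn R n.+1)).
Context (H : ph_setting U rho a D W).
Local Notation S := (W `&` hypersurface U rho).
Local Notation pa := (phs_pos H).

Implicit Types (p q u v : Cn R n.+1) (x y : 'rV[R[i]]_n.+1) (b c : 'I_n).

Lemma phs_regular q : S q -> regular_at rho q.
Proof.
case: (phs_def H) => oU sm nz [Wq [Uq rq]]; split => //.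
- have := open_nbhs_nbhs (conj oU Uq); apply: filterS => r Ur.
  exact: smooth_differentiable sm Ur.
- move=> v; exact: smooth_differentiable (smooth_derive v sm) Uq.
- exact: nz.
Qed.

Lemma phs_differentiable q : S q -> differentiable rho q.
Proof. by move=> /phs_regular/regular_diff. Qed.

(** S is open in M, so identities valid on S may be differentiated along tangent vectors. *)
Lemma phs_near q : S q -> \forall r \near q, rho r = 0 -> S r.
Proof.
move=> [Wq _]; have := open_nbhs_nbhs (conj (phs_open H) Wq); apply: filterS => r Wr r0.
by split => //; split => //; exact: (phs_sub H).
Qed.

Lemma phs_rho11 q j k : S q -> rho11 rho j k q = a j k.
Proof.
move=> [_ hq]; have := phs_lev H hq j k ltr01 => /nbhs_singleton.
case: hq => _ ->; rewrite normr0 mulr0 normr_le0 subr_eq0.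
by move/eqP.
Qed.

Lemma phs_rho1_neq0 q : S q -> exists j, rho1 rho j q != 0.
Proof.
move=> Sq; case: (phs_regular Sq) => _ _ _ [v].
apply: contraPP => /forallNP nz; apply/negP; rewrite negbK; apply/eqP.
apply: (@complexI R); rewrite derive_del; last exact: phs_differentiable.
rewrite /del big1 ?conjC0 ?addr0 // => j _.
by have /negP := nz j; rewrite negbK => /eqP ->; rewrite mul0r.
Qed.

Lemma phs_normsq_gt0 q : S q -> 0 < dual_normsq a rho q.
Proof. by move=> /phs_rho1_neq0; exact: (dual_normsq_gt0 pa). Qed.

Local Notation N q := (dual_normsq a rho q).
Local Notation Z b q := (frame D b q).
Local Notation G q := (grad a rho q).
Local Notation th b q := (coframe D b q).

Lemma frame_del q b : S q -> del rho q (Z b q) = 0.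
Proof. by move=> /(phs_frame H)[+ _]; exact. Qed.

(** A dimension count: the kernel of d' rho has rank n, and the frame consists of n independent
    vectors in it. *)
Lemma T10_span q x : S q -> del rho q x = 0 ->
  exists c : 'I_n -> R[i], x = \sum_b c b *: Z b q.
Proof.
move=> Sq dx; have fz b := frame_del b Sq; have [_ ff] := phs_frame H Sq.
set F := (\matrix_(_, _) _) in ff; pose r : 'cV[R[i]]_n.+1 := \col_j rho1 rho j q.
have delE y : (y *m r) = (del rho q y)%:M.
  apply/matrixP => i k; rewrite !ord1 !mxE eqxx /del mulr1n.
  by apply: eq_bigr => j _; rewrite mxE mulrC.
have Fk : (F <= kermx r)%MS.
  apply/row_subP => b; apply/sub_kermxP; rewrite delE.
  have -> : row b F = Z b q by apply/rowP => j; rewrite !mxE.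
  by rewrite fz; apply/matrixP => i k; rewrite !mxE mul0rn.
have rk : \rank (kermx r) = n.
  rewrite mxrank_ker; suff -> : \rank r = 1%N by rewrite subn1.
  apply/eqP; rewrite eqn_leq rank_leq_col lt0n mxrank_eq0.
  have [j hj] := phs_rho1_neq0 Sq; apply: contraNneq hj => r0.
  by have := congr1 (fun M : 'cV[R[i]]_n.+1 => M j 0) r0; rewrite !mxE => ->.
have : (kermx r <= F)%MS.
  by rewrite -(geq_leqif (mxrank_leqif_sup Fk)) rk; move: ff; rewrite /row_free => /eqP ->.
have xk : (x <= kermx r)%MS.
  by apply/sub_kermxP; rewrite delE dx; apply/matrixP => i k; rewrite !mxE mul0rn.
move=> /(submx_trans xk) /submxP[c ->]; exists (fun b => c 0 b).
apply/rowP => j; rewrite mxE summxE; apply: eq_bigr => b _.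
by rewrite !mxE.
Qed.

Lemma coframe_lin q b : W q -> rlinear (th b q).
Proof. by case: (phs_smooth H) => _ _ /(_ b) [lf _] _ Wq c u v; exact: lf. Qed.

Lemma conn_lin q b c : W q -> rlinear (conn D b c q).
Proof. by case: (phs_smooth H) => _ _ _ [_ /(_ b c) [lf _] _] Wq k u v; exact: lf. Qed.

(** Duality prescribes theta^b on Z_c and on its conjugate, that is the linear and the antilinear
    part; together they give the value on real vectors. *)
Lemma coframe_toCn q b c (k : R[i]) : S q ->
  th b q (toCn (k *: Z c q)) = k * (b == c)%:R.
Proof.
move=> Sq; have lt := coframe_lin b Sq.1.
rewrite rlinear_toCn //.
have []   := phs_coframe H b c Sq; rewrite ev1_vec10 // ev1_vec01 //.
set A := th b q _; set B := 'i * _ => e1 e2 _.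
have EA : A = (b == c)%:R.
  transitivity (2^-1 * (A - B) + 2^-1 * (A + B)); first by field.
  by rewrite e1 e2 addr0.
have EB : B = - (b == c)%:R.
  transitivity (2^-1 * (A + B) - 2^-1 * (A - B)); first by field.
  by rewrite e1 e2 sub0r.
have -> : th b q (toCn ('i *: frame D c q)) = 'i * (b == c)%:R.
  transitivity (- 'i * B); last by rewrite EB mulrNN.
  by rewrite /B mulrA mulNr -expr2 sqrCi opprK mul1r.
by rewrite EA {3}[k]complexE complexiE; ring.
Qed.

Lemma hform_grad_l q y : hform a (G q) y = (del rho q y)^*.
Proof. by rewrite -(hform_grad pa) (hform_conj pa). Qed.

Lemma phs_dtheta q u v : S q -> ext_d (theta rho) q u v =
  'i * (hform a (zrow u) (zrow v) - hform a (zrow v) (zrow u)).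
Proof.
move=> Sq; apply: ext_d_theta; [exact: phs_regular|exact: pa|].
by move=> j k; exact: phs_rho11.
Qed.

Lemma tangent_T10 q x : S q -> del rho q x = 0 -> tangent rho q (toCn x).
Proof. by move=> Sq; apply: tangent_toCn; exact: phs_differentiable. Qed.

Lemma frame_tangent q b (k : R[i]) : S q -> tangent rho q (toCn (k *: Z b q)).
Proof. by move=> Sq; apply: tangent_T10 => //; rewrite delZ frame_del // mulr0. Qed.

Lemma frame_theta q b (k : R[i]) : S q -> theta rho q (toCn (k *: Z b q)) = 0.
Proof. by move=> Sq; apply: theta_toCn => //; rewrite delZ frame_del // mulr0. Qed.

(** Testing T against d theta on y and on i y makes it a-orthogonal to every y of type (1,0) tangent
    to M, hence a multiple of the gradient; theta(T) = 1 fixes the multiple. *)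
Lemma reeb_grad q : S q -> zrow (reeb D q) = ('i / N q) *: G q.
Proof.
move=> Sq; have [tT T1 Td] := phs_reeb H Sq.
have N0 : N q != 0 by rewrite gt_eqF // phs_normsq_gt0.
apply/eqP; rewrite -subr_eq0; apply/eqP.
have perp y : del rho q y = 0 -> hform a (zrow (reeb D q)) y = 0.
  move=> dy; have t1 := Td _ (tangent_T10 Sq dy).
  have t2 : ext_d (theta rho) q (reeb D q) (toCn ('i *: y)) = 0.
    by apply/Td/tangent_T10 => //; rewrite delZ dy mulr0.
  move: t1 t2; rewrite !phs_dtheta // !toCnK hformZr hformZl conjCi.
  have i0 : 'i != 0 :> R[i] by rewrite neq0Ci.
  have i0eq z : 'i * z = 0 -> z = 0 :> R[i].
    by move/eqP; rewrite mulf_eq0 (negPf i0) /= => /eqP.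
  move=> /i0eq e1 /i0eq e2.
  set A := hform _ _ _ in e1 e2 *; set B := hform _ _ _ in e1 e2.
  apply: (mulfI i0); rewrite mulr0.
  transitivity (2^-1 * ('i * (A - B) - (- 'i * A - 'i * B))); first by field.
  by rewrite e1 e2 mulr0 subr0 mulr0.
set x := _ - _.
have dx : del rho q x = 0.
  rewrite /x -scaleNr delD delZ -dual_normsqE del_tangent // ?T1; last exact: phs_differentiable.
  by field.
apply: (hform_eq0 pa); rewrite /x hformBl hformZl hform_grad_l // -/x.
by rewrite perp // dx conjC0 mulr0 subr0.
Qed.

Lemma tangent_zrow q u : S q -> tangent rho q u ->
  zrow u = \sum_b th b q u *: Z b q + ('i * theta rho q u / N q) *: G q.
Proof.
move=> Sq tu; have N0 : N q != 0 by rewrite gt_eqF // phs_normsq_gt0.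
have [] := @T10_span q (zrow u - ('i * theta rho q u / N q) *: G q) Sq.
  rewrite -scaleNr delD delZ -dual_normsqE del_tangent //; last exact: phs_differentiable.
  by field.
move=> k E; have {}E : zrow u = \sum_b k b *: Z b q + ('i * theta rho q u / N q) *: G q.
  by rewrite -E subrK.
rewrite {1}E; congr (_ + _); apply: eq_bigr => b _; congr (_ *: _).
have lt := coframe_lin b Sq.1.
have tr := theta_real (phs_differentiable Sq) tu.
have trE : theta rho q u = (complex.Re (theta rho q u))%:C.
  move: tr; case: (theta rho q u) => s t; rewrite -conjcE => -[] /eqP.
  by rewrite -subr_eq0 -opprD oppr_eq0 -mulr2n mulrn_eq0 /= => /eqP ->.
(* The coframe is only real linear, so u is rebuilt from real vectors; the coefficient of T may be
   taken real because theta is real on tangent vectors. *)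
have uE : u = \sum_c toCn (k c *: Z c q) + complex.Re (theta rho q u) *: reeb D q.
  apply: zrow_inj; rewrite zrowD zrowZ reeb_grad // -toCn_sum toCnK -trE E.
  by rewrite scalerA; congr (_ + _ *: _); ring.
have [_ _ th0]   := phs_coframe H b b Sq.
rewrite {1}uE rlinearD // rlinear_sum // rlinearZ // th0 mulr0 addr0.
under eq_bigr do rewrite coframe_toCn // eq_sym.
by rewrite sum_delta.
Qed.

End Structure.



(** The flat derivative of the vector field X along u. *)
Definition dvec (R : realType) m (X : Cn R m -> 'rV[R[i]]_m) (q u : Cn R m) :
  'rV[R[i]]_m := \row_j derC u (fun r => X r 0 j) q.

(** Constant entries make the metric parallel: no derivative of a appears. *)
Lemma derC_hform (R : realType) m (a : 'M[R[i]]_m)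
    (X Y : Cn R m -> 'rV[R[i]]_m) q u :
  (forall j, cdiff (fun r => X r 0 j) q) ->
  (forall j, cdiff (fun r => Y r 0 j) q) ->
  cdiff (fun r => hform a (X r) (Y r)) q /\
  derC u (fun r => hform a (X r) (Y r)) q =
    hform a (dvec X q u) (Y q) + hform a (X q) (dvec Y q u).
Proof.
move=> dX dY.
have dC k : cdiff (fun r => (Y r 0 k)^*) q := cdiff_conj (dY k).
have dXa j k : cdiff (fun r => a j k * X r 0 j) q := cdiffMl (a j k) (dX j).
have d1 j k : cdiff (fun r => a j k * X r 0 j * (Y r 0 k)^*) q.
  exact: cdiffM (dXa j k) (dC k).
have d2 j : cdiff (fun r => \sum_k a j k * X r 0 j * (Y r 0 k)^*) q.
  exact: cdiff_sum (d1 j).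
split; first exact: cdiff_sum d2.
rewrite /hform derC_sum // -big_split /=; apply: eq_bigr => j _.
rewrite derC_sum // -big_split /=; apply: eq_bigr => k _.
by rewrite (derCM _ (dXa j k) (dC k)) (derCMl _ _ (dX j)) (derC_conj _ (dY k)) !mxE.
Qed.

Lemma dvec_cst (R : realType) m (x : 'rV[R[i]]_m) (q u : Cn R m) :
  dvec (fun=> x) q u = 0.
Proof. by apply/rowP => j; rewrite !mxE derC_cst. Qed.

Lemma sum_delta2 (K : pzRingType) (I J : finType) (F : I -> J -> K) i j :
  \sum_r \sum_s F r s * ((r == i)%:R * (s == j)%:R) = F i j.
Proof.
rewrite (bigD1 i) //= [X in _ + X]big1 => [|r /negPf ri].
  by rewrite addr0; under eq_bigr do rewrite eqxx mul1r; rewrite sum_delta.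
by rewrite big1 // => s _; rewrite ri mul0r mulr0.
Qed.

(** * The flat connection against the Tanaka-Webster connection *)

Section Connection.
Context {R : realType} {n : nat} (U : set (Cn R n.+1)) (rho : Cn R n.+1 -> R).
Context (a : 'M[R[i]]_n.+1) (D : ph_data R n) (W : set (Cn R n.+1)).
Context (H : ph_setting U rho a D W).
Local Notation S := (W `&` hypersurface U rho).
Local Notation pa := (phs_pos H).
Local Notation N q := (dual_normsq a rho q).
Local Notation Z b q := (frame D b q).
Local Notation G q := (grad a rho q).
Local Notation th b q := (coframe D b q).
Implicit Types (p q u v : Cn R n.+1) (x y : 'rV[R[i]]_n.+1) (b c d : 'I_n).

(** Both expressions of d theta are evaluated on k Z_b and Z_c; k = 1 and k = i isolate the
    coefficient of k. *)
Lemma levi_hform q b c : S q -> levi D b c q = hform a (Z b q) (Z c q).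
Proof.
move=> Sq.
have key (k : R[i]) : 'i * (k * hform a (Z b q) (Z c q) - k^* * hform a (Z c q) (Z b q)) =
    'i * (k * levi D b c q - k^* * levi D c b q).
  have := phs_levi H Sq (frame_tangent H b k Sq) (frame_tangent H c 1 Sq).
  rewrite (phs_dtheta H) // !toCnK scale1r hformZl hformZr => ->; congr (_ * _).
  transitivity (\sum_d \sum_e (levi D d e q * k) * ((d == b)%:R * (e == c)%:R)
    - \sum_d \sum_e (levi D d e q * k^*) * ((d == c)%:R * (e == b)%:R)).
    rewrite -sumrB; apply: eq_bigr => d _; rewrite -sumrB; apply: eq_bigr => e _.
    rewrite /wedge /conj_form !conjcE -{1 2}[Z c q]scale1r !(coframe_toCn H) //.
    by rewrite !mul1r rmorphM !rmorph_nat /=; ring.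
  by rewrite !sum_delta2; ring.
have k1 := key 1; have ki := key 'i; move: k1 ki.
rewrite conjC1 conjCi !mul1r.
set h1 := hform _ _ _; set h2 := hform _ _ _; set l1 := levi _ _ _ _.
set l2 := levi _ _ _ _ => k1 ki.
have i0 : 'i != 0 :> R[i] := neq0Ci _.
move: (mulfI i0 k1) (mulfI i0 ki) => {}k1; rewrite !mulNr !opprK -!mulrDr.
move=> /(mulfI i0) {}ki.
transitivity (2^-1 * ((l1 - l2) + (l1 + l2))); first by field.
by rewrite -k1 -ki; field.
Qed.

Definition tw_conn_low b c q u : R[i] := \sum_d conn D b d q u * levi D d c q.
Local Notation om := tw_conn_low.

Lemma tw_conn_lowE b c q u : om b c q u = \sum_d conn D b d q u * levi D d c q.
Proof. by []. Qed.

(** The defect between the tangential part of the flat connection and the Tanaka-Webster connection;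
    [tw_eps_formula] will show that it is a multiple of theta. *)
Definition tw_eps b c q u : R[i] :=
  hform a (dvec (frame D b) q u) (Z c q) - om b c q u.
Local Notation eps := tw_eps.

Lemma tw_epsE b c q u :
  eps b c q u = hform a (dvec (frame D b) q u) (Z c q) - om b c q u.
Proof. by []. Qed.

(** The normal component of the flat derivative of Z_b, up to the factor N: the second fundamental
    form. *)
Definition frame_deriv_del b q u : R[i] := del rho q (dvec (frame D b) q u).
Local Notation Bf := frame_deriv_del.

Lemma cdiff_frame q b j : W q -> cdiff (fun r => Z b r 0 j) q.
Proof. by case: (phs_smooth H) => sf _ _ _; exact: smoothC_cdiff. Qed.

Lemma cdiff_coframe q b v : W q -> cdiff ((coframe D b)^~ v) q.
Proof. by case: (phs_smooth H) => _ _ sf _; apply: smoothC_cdiff; case: (sf b). Qed.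

Lemma cdiff_levi q b c : W q -> cdiff (levi D b c) q.
Proof. by case: (phs_smooth H) => _ _ _ [sf _ _]; exact: smoothC_cdiff. Qed.

Lemma cdiff_conn q b c v : W q -> cdiff ((conn D b c)^~ v) q.
Proof. by case: (phs_smooth H) => _ _ _ [_ sf _]; apply: smoothC_cdiff; case: (sf b c). Qed.

Lemma levi_conj q b c : S q -> (levi D b c q)^* = levi D c b q.
Proof. by move=> Sq; rewrite !levi_hform // (hform_conj pa). Qed.

(** [levi_hform] is an identity on M only, so its two sides share just their tangential
    derivatives. *)
Lemma derC_levi q b c u : S q -> tangent rho q u ->
  derC u (levi D b c) q = hform a (dvec (frame D b) q u) (Z c q)
                        + hform a (Z b q) (dvec (frame D c) q u).
Proof.
move=> Sq tu; have Wq := Sq.1.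
have [d1 <-] := derC_hform a u (fun j => cdiff_frame b j Wq) (fun j => cdiff_frame c j Wq).
have d2 := cdiff_levi b c Wq.
apply/eqP; rewrite -subr_eq0 -derCB //; apply/eqP.
apply: (regular_derC_eq0 (phs_regular H Sq)) => //; first exact: cdiffB.
by apply: filterS (phs_near H Sq) => r /[apply] Sr; rewrite levi_hform // subrr.
Qed.

Lemma derC_levi_om q b c u : S q -> tangent rho q u ->
  derC u (levi D b c) q = om b c q u + (om c b q u)^*.
Proof.
move=> Sq tu; have [_ /(_ b c q u Sq tu) ->] := phs_tw H.
congr (_ + _); rewrite /tw_conn_low rmorph_sum /=; apply: eq_bigr => d _.
by rewrite rmorphM /= levi_conj // mulrC.
Qed.

(** Both connections are compatible with h, so their difference is skew-Hermitian. *)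
Lemma eps_skew q b c u : S q -> tangent rho q u ->
  (eps b c q u)^* = - eps c b q u.
Proof.
move=> Sq tu; apply/eqP; rewrite -addr_eq0 /tw_eps rmorphB /= (hform_conj pa).
have E := derC_levi c b Sq tu; rewrite derC_levi_om // in E.
apply/eqP; rewrite -[RHS](subrr (om c b q u + (om b c q u)^*)) {1}E; ring.
Qed.

(** Differentiate d' rho (Z_b) = 0 along M. *)
Lemma frame_deriv_delE q b u : S q -> tangent rho q u ->
  Bf b q u = - (q2 rho q (zrow u) (Z b q) + hform a (Z b q) (zrow u)).
Proof.
move=> Sq tu; have Wq := Sq.1; have rq := phs_regular H Sq.
apply/eqP; rewrite -addr_eq0; apply/eqP.
have dr j : cdiff (rho1 rho j) q by exact: cdiff_rho1.
have df j := cdiff_frame b j Wq.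
rewrite -(sum_derC_rho1 rq pa (fun j k => phs_rho11 H j k Sq)).
have dp j : cdiff (fun r => rho1 rho j r * Z b r 0 j) q := cdiffM (dr j) (df j).
transitivity (derC u (fun r => \sum_j rho1 rho j r * Z b r 0 j) q).
  rewrite derC_sum // /frame_deriv_del /del -big_split /=; apply: eq_bigr => j _.
  by rewrite (derCM _ (dr j) (df j)) mxE addrC [derC u (rho1 _ _) _ * _]mulrC.
apply: (regular_derC_eq0 rq) => //; first exact: cdiff_sum.
by apply: filterS (phs_near H Sq) => r /[apply] /(frame_del H b).
Qed.

(** The lowered torsion with both indices barred, before the conjugation in [tors_low]. *)
Definition tw_tors_low b c q : R[i] := \sum_d tors D d c q * levi D d b q.
Local Notation tors_A := tw_tors_low.

(* The exterior derivative of [hform (dz, Z_c) = theta^b h_(b cbar)] on M. *)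
Lemma structure_identity q c u v : S q -> tangent rho q u -> tangent rho q v ->
  \sum_b (th b q v * (eps c b q u)^* - th b q u * (eps c b q v)^*)
  + 'i / N q * (theta rho q v * (Bf c q u)^* - theta rho q u * (Bf c q v)^*)
  = \sum_b tors_A c b q * (theta rho q u * (th b q v)^* - theta rho q v * (th b q u)^*).
Proof.
move=> Sq tu tv; have Wq := Sq.1.
(* By [tangent_zrow] and [levi_hform] this form vanishes on vectors tangent to M, hence so does its
   exterior derivative. *)
pose phi : form1 R n.+1 := fun r w =>
  hform a (zrow w) (Z c r) - \sum_b th b r w * levi D b c r.
have dcst (w : Cn R n.+1) j : cdiff (fun r : Cn R n.+1 => zrow w 0 j) q.
  exact: cdiff_cst.
have dh w := derC_hform (X := fun=> zrow w) a u (dcst w) (fun j => cdiff_frame c j Wq).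
have dtl w b : cdiff (fun r => th b r w * levi D b c r) q.
  by apply: cdiffM; [exact: cdiff_coframe|exact: cdiff_levi].
have dphi w : cdiff (phi^~ w) q.
  by apply: cdiffB; [exact: (dh w).1|exact: cdiff_sum].
have E0 : ext_d phi q u v = 0.
  apply: (ext_d_tangent_eq0 (phs_regular H Sq)) => //.
    have := open_nbhs_nbhs (conj (phs_open H) Wq); apply: filterS => r Wr k w w'.
    rewrite /phi zrowP hformPl mulrBr addrACA -opprD; congr (_ - _).
    rewrite mulr_sumr -big_split; apply: eq_bigr => b _ /=.
    by rewrite (coframe_lin H b Wr) mulrDl mulrA.
  apply: filterS (phs_near H Sq) => r /[apply] Sr w tw; rewrite /phi.
  rewrite (tangent_zrow H Sr tw) hformDl hform_suml hformZl (hform_grad_l H) //.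
  rewrite (frame_del H) // conjC0 mulr0 addr0 -sumrB big1 // => b _.
  by rewrite hformZl levi_hform // subrr.
have derphi w w' : derC w (phi^~ w') q = hform a (zrow w') (dvec (frame D c) q w)
    - \sum_b (derC w ((coframe D b)^~ w') q * levi D b c q + th b q w' * derC w (levi D b c) q).
  have [d1 e1] := derC_hform (X := fun=> zrow w') a w (dcst w') (fun j => cdiff_frame c j Wq).
  rewrite /phi (derCB _ d1 (cdiff_sum _ _ (dtl w'))) e1 dvec_cst hform0l add0r.
  rewrite (derC_sum _ _ _ (dtl w')); congr (_ - _); apply: eq_bigr => b _.
  by rewrite (derCM _ (cdiff_coframe b w' Wq) (cdiff_levi b c Wq)).
have hz w w' : tangent rho q w' -> hform a (zrow w') (dvec (frame D c) q w) =
    \sum_b th b q w' * (eps c b q w)^* + \sum_b th b q w' * (om c b q w)^*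
    + 'i / N q * (theta rho q w' * (Bf c q w)^*).
  move=> tw'; rewrite {1}(tangent_zrow H Sq tw') hformDl hform_suml hformZl.
  rewrite (hform_grad_l H) // -/(frame_deriv_del c q w) -big_split; congr (_ + _); last by ring.
  apply: eq_bigr => b _ /=; rewrite hformZl -mulrDr -rmorphD /= /tw_eps subrK.
  by rewrite (hform_conj pa).
have hl w w' : tangent rho q w -> \sum_b th b q w' * derC w (levi D b c) q =
    \sum_b th b q w' * om b c q w + \sum_b th b q w' * (om c b q w)^*.
  move=> tw; rewrite -big_split; apply: eq_bigr => b _.
  by rewrite derC_levi_om //= mulrDr.
have hd : \sum_b ext_d (coframe D b) q u v * levi D b c q =
    \sum_b th b q u * om b c q v - \sum_b th b q v * om b c q u
    + \sum_b tors_A c b q * (theta rho q u * (th b q v)^* - theta rho q v * (th b q u)^*).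
  transitivity (\sum_b (\sum_d (th d q u * (conn D d b q v * levi D b c q)
     - th d q v * (conn D d b q u * levi D b c q)) + \sum_d tors D b d q * levi D b c q *
     (theta rho q u * (th d q v)^* - theta rho q v * (th d q u)^*))).
    apply: eq_bigr => b _; rewrite ((phs_tw H).1 b q u v Sq tu tv) mulrDl !mulr_suml.
    congr (_ + _); apply: eq_bigr => d _; rewrite /wedge; first by ring.
    by rewrite /conj_form !conjcE; ring.
  rewrite big_split; congr (_ + _).
    rewrite exchange_big -sumrB; apply: eq_bigr => d _.
    by rewrite sumrB /tw_conn_low !mulr_sumr.
  rewrite exchange_big; apply: eq_bigr => d _ /=.
  by rewrite /tw_tors_low mulr_suml.
have hd' : \sum_b derC u ((coframe D b)^~ v) q * levi D b c q
    - \sum_b derC v ((coframe D b)^~ u) q * levi D b c q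
    - \sum_b ext_d (coframe D b) q u v * levi D b c q = 0.
  rewrite -!sumrB big1 // => b _; rewrite /ext_d.
  set x := derC _ _ _; set y := derC _ _ _; set z := levi _ _ _ _.
  by move: x y z => x y z; ring.
move: hd'; rewrite hd => hd'.
(* The connection terms [om] of [hz], [hl] and [hd] cancel; only the defect, the normal components
   and the torsion remain. *)
move: E0; rewrite /ext_d !derphi !big_split /= (hz _ _ tu) (hz _ _ tv).
rewrite (hl _ _ tu) (hl _ _ tv) => E.
rewrite sumrN; apply/eqP; rewrite -subr_eq0; apply/eqP.
rewrite -[RHS]addr0 -[X in _ = X + _]E -[X in _ = _ + X]hd'.
move: (\sum_b tors_A _ _ _ * _) (\sum_b th b q v * (eps c b q u)^*)
  (\sum_b th b q u * (eps c b q v)^*) (\sum_b th b q v * (om c b q u)^*)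
  (\sum_b th b q u * (om c b q v)^*) (\sum_b th b q v * om b c q u)
  (\sum_b th b q u * om b c q v)
  (\sum_b derC u ((coframe D b)^~ v) q * levi D b c q)
  (\sum_b derC v ((coframe D b)^~ u) q * levi D b c q).
move: ('i / N q) (theta rho q u) (theta rho q v) (Bf c q u)^* (Bf c q v)^*.
clear; move=> *; ring.
Qed.

End Connection.



Section CdiffInv.
Context {R : realType} {m : nat}.

(** Write 1 / f as the conjugate of f divided by the real function |f|^2, here [g]. *)
Lemma cdiffV (f : Cn R m -> R[i]) p : cdiff f p -> f p != 0 ->
  cdiff (fun q => (f q)^-1) p.
Proof.
move=> df fp; have [f1 f2] := df.
pose g q := complex.Re (f q) * complex.Re (f q) + complex.Im (f q) * complex.Im (f q).
have dg : differentiable g p.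
  by apply: differentiableD; apply: differentiableM.
have gE q : (g q)%:C = f q * (f q)^*.
  rewrite /g; case: (f q) => x y; rewrite -conjcE; apply/eqP.
  by rewrite eq_complex /=; apply/andP; split; apply/eqP; ring.
have gp : g p != 0.
  by rewrite -(inj_eq (@complexI R)) gE mul_conjC_eq0.
have dV : differentiable (fun q => (g q)^-1) p by exact: differentiableV.
have -> : (fun q => (f q)^-1) = (fun q => (f q)^* * realC (fun q => (g q)^-1) q).
  apply/funext => q; rewrite /realC fmorphV /= gE.
  have [->|fq] := eqVneq (f q) 0; first by rewrite invr0 conjC0 mul0r.
  by rewrite invfM mulrCA divff ?mulr1 // conjC_eq0.
by apply: cdiffM; [exact: cdiff_conj|exact: cdiff_realC].
Qed.

End CdiffInv.

(** * Connection and torsion *)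

Section Curvature.
Context {R : realType} {n : nat} (U : set (Cn R n.+1)) (rho : Cn R n.+1 -> R).
Context (a : 'M[R[i]]_n.+1) (D : ph_data R n) (W : set (Cn R n.+1)).
Context (H : ph_setting U rho a D W).
Local Notation S := (W `&` hypersurface U rho).
Local Notation pa := (phs_pos H).
Local Notation N q := (dual_normsq a rho q).
Local Notation Z b q := (frame D b q).
Local Notation G q := (grad a rho q).
Local Notation th b q := (coframe D b q).
Local Notation eps := (tw_eps a D).
Local Notation om := (tw_conn_low D).
Local Notation Bf := (frame_deriv_del rho D).
Local Notation tors_A := (tw_tors_low D).
Implicit Types (p q u v : Cn R n.+1) (x y : 'rV[R[i]]_n.+1) (b c d : 'I_n).

Lemma normsq_conj q : S q -> (N q)^* = N q.
Proof. by move=> /(phs_normsq_gt0 H)/gtr0_real/CrealP. Qed.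

Lemma normsq_neq0 q : S q -> N q != 0.
Proof. by move=> /(phs_normsq_gt0 H); rewrite lt0r => /andP[]. Qed.

Lemma q2Pl q (k : R[i]) x y z :
  q2 rho q (k *: x + y) z = k * q2 rho q x z + q2 rho q y z.
Proof.
rewrite /q2 mulr_sumr -big_split; apply: eq_bigr => j _ /=.
rewrite mulr_sumr -big_split; apply: eq_bigr => l _ /=.
by rewrite !mxE; ring.
Qed.

Lemma q20l q x : q2 rho q 0 x = 0.
Proof. by rewrite /q2 big1 // => j _; rewrite big1 // => k _; rewrite mxE mulr0 mul0r. Qed.

Lemma q2Zl q (k : R[i]) x y : q2 rho q (k *: x) y = k * q2 rho q x y.
Proof. by rewrite -[k *: x]addr0 q2Pl q20l addr0. Qed.

Lemma q2_suml q I (r : seq I) (F : I -> 'rV[R[i]]_n.+1) y :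
  q2 rho q (\sum_(i <- r) F i) y = \sum_(i <- r) q2 rho q (F i) y.
Proof.
elim: r => [|i r IH]; first by rewrite !big_nil q20l.
by rewrite !big_cons -IH -{1}[F i]scale1r q2Pl mul1r.
Qed.

Lemma eps_lin q b c : W q -> rlinear (eps b c q).
Proof.
move=> Wq k u v; rewrite /tw_eps.
have -> : dvec (frame D b) q (k *: u + v) =
    k%:C *: dvec (frame D b) q u + dvec (frame D b) q v.
  apply/rowP => j; have df := cdiff_frame H b j Wq.
  by rewrite !mxE (derCDv _ _ df) (derCZv _ _ df).
rewrite hformPl /tw_conn_low mulrBr addrACA -opprD; congr (_ - _).
rewrite mulr_sumr -big_split; apply: eq_bigr => d _ /=.
by rewrite (conn_lin H b d Wq) mulrDl mulrA.
Qed.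

(** Uniqueness of the connection on H(M). The structure identity makes [eps] antilinear in the frame
    vector ([ant]); skew-Hermitian symmetry makes it linear as well, so it vanishes. *)
Lemma eps_frame q b c d (k : R[i]) : S q -> eps b c q (toCn (k *: Z d q)) = 0.
Proof.
move=> Sq.
have gen c' b' d' (mu la : R[i]) u v : tangent rho q u -> tangent rho q v ->
    theta rho q u = 0 -> theta rho q v = 0 ->
    (forall e, th e q u = mu * (e == d')%:R) ->
    (forall e, th e q v = la * (e == b')%:R) ->
    la^* * eps c' b' q u = mu^* * eps c' d' q v.
  move=> tu tv u0 v0 hu hv; have := structure_identity H c' Sq tu tv.
  have z0 (x y z : R[i]) : x * (0 * y - 0 * z) = 0 by ring.
  rewrite u0 v0 z0 addr0.
  rewrite [RHS]big1 => [|e _]; last exact: z0.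
  rewrite (eq_bigr (fun e => la * (eps c' e q u)^* * (e == b')%:R
     - mu * (eps c' e q v)^* * (e == d')%:R)); last first.
    by move=> e _; rewrite hu hv; ring.
  rewrite sumrB !sum_delta => /eqP; rewrite subr_eq0 => /eqP/(congr1 Num.conj).
  by rewrite !rmorphM /= !conjCK.
have key c' b' d' (mu la : R[i]) : la^* * eps c' b' q (toCn (mu *: Z d' q)) =
    mu^* * eps c' d' q (toCn (la *: Z b' q)).
  exact: gen (frame_tangent H d' mu Sq) (frame_tangent H b' la Sq)
    (frame_theta H d' mu Sq) (frame_theta H b' la Sq)
    (fun e => coframe_toCn H e d' mu Sq) (fun e => coframe_toCn H e b' la Sq).
have ant c' b' d' : eps c' b' q (toCn ('i *: Z d' q)) = - 'i * eps c' b' q (toCn (1 *: Z d' q)).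
  have e1 := key c' d' b' 1 1; have e2 := key c' d' b' 1 'i.
  have c1 : (1 : R[i])^* != 0 by rewrite conjC1 oner_neq0.
  move: e1 e2 => /(mulfI c1) e1; rewrite conjC1 conjCi e1 => e2.
  exact: etrans (esym (mul1r _)) (esym e2).
have z1 b' c' d' : eps b' c' q (toCn (1 *: Z d' q)) = 0.
  have s1 := eps_skew H c' b' Sq (frame_tangent H d' 1 Sq).
  have si := eps_skew H c' b' Sq (frame_tangent H d' 'i Sq).
  move: si; rewrite !ant rmorphM /= s1 rmorphN /= conjCi opprK.
  move=> /eqP; rewrite -subr_eq0 mulrN mulNr opprK -opprD oppr_eq0 -mulr2n.
  by rewrite mulrn_eq0 /= mulf_eq0 (negPf (neq0Ci _)) /= => /eqP.
have el : rlinear (eps b c q) by exact: eps_lin Sq.1.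
have z1' : eps b c q (toCn (Z d q)) = 0 by rewrite -[Z d q]scale1r z1.
by rewrite (rlinear_toCn el) ant z1 z1' !mulr0 addr0.
Qed.

(** The tangent space of M is H(M) plus the line of T, and theta is the coordinate along T. *)
Lemma rlinear_tangent (phi : Cn R n.+1 -> R[i]) q u : rlinear phi -> S q ->
  tangent rho q u -> (forall d k, phi (toCn (k *: Z d q)) = 0) ->
  phi u = theta rho q u * phi (reeb D q).
Proof.
move=> lphi Sq tu phi0; have tr := theta_real (phs_differentiable H Sq) tu.
have trE : theta rho q u = (complex.Re (theta rho q u))%:C.
  by rewrite RRe_real //; apply/CrealP.
have uE : u = \sum_c toCn (th c q u *: Z c q) + complex.Re (theta rho q u) *: reeb D q.
  apply: zrow_inj; rewrite zrowD zrowZ (reeb_grad H Sq) -toCn_sum toCnK -trE.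
  by rewrite {1}(tangent_zrow H Sq tu) scalerA; congr (_ + _ *: _); ring.
rewrite {1}uE (rlinearD lphi) (rlinear_sum lphi) (rlinearZ lphi) -trE.
by rewrite big1 ?add0r // => c _; exact: phi0.
Qed.

Lemma frame_deriv_del_toCn q b x : S q -> del rho q x = 0 ->
  Bf b q (toCn x) = - (q2 rho q x (Z b q) + hform a (Z b q) x).
Proof.
by move=> Sq dx; rewrite (frame_deriv_delE H b Sq (tangent_T10 H Sq dx)) toCnK.
Qed.

(** The structure identity on T and la Z_b: its part linear in la determines the defect on T, its
    antilinear part the torsion. *)
Lemma reeb_identities q b c : S q ->
  eps c b q (reeb D q) = 'i / N q * hform a (Z c q) (Z b q) /\
  tors_A c b q = 'i / N q * (q2 rho q (Z b q) (Z c q))^*.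
Proof.
move=> Sq; have [tT T1 _] := phs_reeb H Sq.
have thT e : th e q (reeb D q) = 0 by have [] := phs_coframe H e e Sq.
have gen (la : R[i]) v : tangent rho q v -> theta rho q v = 0 ->
    (forall e, th e q v = la * (e == b)%:R) ->
    la * (eps c b q (reeb D q))^* - 'i / N q * (Bf c q v)^* = la^* * tors_A c b q.
  move=> tv v0 hv; have := structure_identity H c Sq tT tv.
  have z1 (x y z : R[i]) : x * (0 * y - 1 * z) = - (x * z) by ring.
  rewrite v0 T1 z1.
  rewrite (eq_bigr (fun e => la * (eps c e q (reeb D q))^* * (e == b)%:R)); last first.
    by move=> e _; rewrite hv thT; ring.
  rewrite [in RHS](eq_bigr (fun e => la^* * tors_A c e q * (e == b)%:R)); last first.
    by move=> e _; rewrite hv thT rmorphM rmorph_nat /=; ring.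
  by rewrite !sum_delta.
have key la : la * (eps c b q (reeb D q))^* + 'i / N q *
    (la^* * (q2 rho q (Z b q) (Z c q))^* + la * hform a (Z b q) (Z c q))
    = la^* * tors_A c b q.
  rewrite -(gen la _ (frame_tangent H b la Sq) (frame_theta H b la Sq)
    (fun e => coframe_toCn H e b la Sq)).
  have -> : (Bf c q (toCn (la *: Z b q)))^* =
      - (la^* * (q2 rho q (Z b q) (Z c q))^* + la * hform a (Z b q) (Z c q)).
    rewrite frame_deriv_del_toCn //; last by rewrite delZ (frame_del H b Sq) mulr0.
    by rewrite q2Zl hformZr rmorphN rmorphD !rmorphM /= conjCK (hform_conj pa).
  by rewrite mulrN opprK.
have := key 'i; have := key 1; rewrite conjC1 conjCi -!(hform_conj pa (Z c q) (Z b q)).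
have Nc := normsq_conj Sq.
move: (tors_A c b q) (q2 rho q (Z b q) (Z c q))^* (hform a (Z c q) (Z b q)) => t Q h.
set e := (eps c b q _)^*; move=> k1 ki.
have ee : e = - ('i / N q) * h^*.
  apply: (mulfI (neq0Ci _)); transitivity (2^-1 * ('i * (1 * e + 'i / N q * (1 * Q + 1 * h^*)) +
     ('i * e + 'i / N q * (- 'i * Q + 'i * h^*)) - 'i * ('i / N q * h^*) *+ 2)).
    by field; exact: normsq_neq0.
  by rewrite k1 ki; field; exact: normsq_neq0.
split.
  rewrite -[LHS]conjCK -/e ee rmorphM rmorphN rmorphM fmorphV /= conjCK conjCi Nc.
  by ring.
rewrite -[LHS]mul1r -k1 ee; ring.
Qed.

Lemma tw_eps_formula q b c u : S q -> tangent rho q u ->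
  eps b c q u = 'i / N q * theta rho q u * hform a (Z b q) (Z c q).
Proof.
move=> Sq tu; have el := eps_lin b c Sq.1.
rewrite (rlinear_tangent el Sq tu); last by move=> d k; exact: eps_frame.
by rewrite (reeb_identities c b Sq).1; ring.
Qed.

Lemma tors_low_formula q b c : S q ->
  tors_low D q b c = - ('i / N q) * q2 rho q (Z b q) (Z c q).
Proof.
move=> Sq; have Nc := normsq_conj Sq.
have -> : tors_low D q b c = (tors_A c b q)^*.
  rewrite /tors_low conjcE; congr (_^*); apply: eq_bigr => d _.
  by rewrite mulrC.
rewrite (reeb_identities b c Sq).2 rmorphM rmorphM fmorphV /= conjCK conjCi Nc.
by ring.
Qed.

End Curvature.


Local Opaque tw_eps tw_conn_low frame_deriv_del tw_tors_low.

(** * Curvature *)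

Lemma dvec_dvec (R : realType) m (X : Cn R m -> 'rV[R[i]]_m) q u v :
  (forall j, \forall r \near q, cdiff (fun r => X r 0 j) r) ->
  (forall j w, cdiff (derC w (fun r => X r 0 j)) q) ->
  dvec (fun r => dvec X r v) q u = dvec (fun r => dvec X r u) q v.
Proof.
move=> dX ddX; apply/rowP => j; rewrite [LHS]mxE [RHS]mxE.
have E w : (fun r => dvec X r w 0 j) = derC w (fun r => X r 0 j).
  by apply/funext => r; rewrite mxE.
rewrite (E u) (E v); exact: derC_comm (dX j) (ddX j u) (ddX j v).
Qed.

Section CurvatureForm.
Context {R : realType} {n : nat} (U : set (Cn R n.+1)) (rho : Cn R n.+1 -> R).
Context (a : 'M[R[i]]_n.+1) (D : ph_data R n) (W : set (Cn R n.+1)).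
Context (H : ph_setting U rho a D W).
Local Notation S := (W `&` hypersurface U rho).
Local Notation pa := (phs_pos H).
Local Notation N q := (dual_normsq a rho q).
Local Notation Z b q := (frame D b q).
Local Notation G q := (grad a rho q).
Local Notation th b q := (coframe D b q).
Local Notation eps := (tw_eps a D).
Local Notation om := (tw_conn_low D).
Local Notation Bf := (frame_deriv_del rho D).
Implicit Types (p q u v : Cn R n.+1) (x y : 'rV[R[i]]_n.+1) (b c d : 'I_n).

Lemma cdiff_normsq q : S q -> cdiff (fun r => N r) q.
Proof.
move=> Sq; have dr j : cdiff (rho1 rho j) q := cdiff_rho1 (phs_regular H Sq) j.
have drb j : cdiff (rho1b rho j) q.
  have -> : rho1b rho j = (fun r => (rho1 rho j r)^*).
    by apply/funext => r; rewrite rho1bE.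
  exact: cdiff_conj.
apply: cdiff_sum => j; apply: cdiff_sum => k; apply: cdiffM => //.
exact: cdiffMl.
Qed.

(** The Gauss formula. For v in H(M) the defect vanishes, so the difference of the two sides is
    tangent and orthogonal to the frame. *)
Lemma dvec_frame q b v : S q -> tangent rho q v -> theta rho q v = 0 ->
  dvec (frame D b) q v =
    \sum_d conn D b d q v *: Z d q + (Bf b q v / N q) *: G q.
Proof.
move=> Sq tv v0; apply/eqP; rewrite -subr_eq0; apply/eqP.
set x := _ - _; have dx : del rho q x = 0.
  rewrite /x -scaleN1r delD delZ delD del_sum delZ -dual_normsqE.
  rewrite divfK; last exact: (normsq_neq0 H Sq).
  rewrite big1 => [|d _]; last by rewrite delZ (frame_del H d Sq) mulr0.
  by rewrite add0r mulN1r subrr.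
have hx c : hform a x (Z c q) = 0.
  rewrite /x hformBl hformDl hform_suml hformZl (hform_grad_l H).
  rewrite (frame_del H c Sq) conjC0 mulr0 addr0.
  transitivity (eps b c q v); last first.
    by rewrite (tw_eps_formula H b c Sq tv) v0 mulr0 mul0r.
  rewrite tw_epsE tw_conn_lowE; congr (_ - _); apply: eq_bigr => d _.
  by rewrite hformZl (levi_hform H d c Sq).
have [k xk] := T10_span H Sq dx.
apply: (hform_eq0 pa); rewrite {2}xk hform_sumr big1 // => d _.
by rewrite hformZr hx mulr0.
Qed.

(* The exterior derivative of [tw_eps_formula]; the second derivatives of [Z_b]
   cancel because the metric [a] is constant. *)
Lemma curvature_form p b c u v : S p -> tangent rho p u -> tangent rho p v ->
  theta rho p u = 0 -> theta rho p v = 0 ->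
  \sum_d levi D d c p * (ext_d (conn D b d) p u v
                - \sum_g wedge (conn D b g) (conn D g d) p u v) =
  (Bf b p v * (Bf c p u)^* - Bf b p u * (Bf c p v)^*) / N p
  - 'i / N p * levi D b c p * ext_d (theta rho) p u v.
Proof.
move=> Sp tu tv u0 v0; have Wp := Sp.1.
(* On M this is the coefficient of theta in [tw_eps_formula], so the form [phi] vanishes on tangent
   vectors. *)
pose f r := 'i * (N r)^-1 * levi D b c r.
pose phi : form1 R n.+1 := fun r w =>
  om b c r w - hform a (dvec (frame D b) r w) (Z c r) + f r * theta rho r w.
have df : cdiff f p.
  apply: cdiffM; last exact: (cdiff_levi H).
  by apply: cdiffMl; apply: cdiffV; [exact: cdiff_normsq|exact: (normsq_neq0 H)].
have ddX d j w : cdiff (derC w (fun r => Z d r 0 j)) p.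
  case: (phs_smooth H) => sf _ _ _.
  exact: smoothC_cdiff (smoothC_derC w (sf d j)) Wp.
have ddv w j : cdiff (fun r => dvec (frame D b) r w 0 j) p.
  have -> : (fun r => dvec (frame D b) r w 0 j) = derC w (fun r => Z b r 0 j).
    by apply/funext => r; rewrite mxE.
  exact: ddX.
have dfc j := cdiff_frame H c j Wp.
have dcl w d : cdiff (fun r => conn D b d r w * levi D d c r) p.
  by apply: cdiffM; [exact: (cdiff_conn H)|exact: (cdiff_levi H)].
have dom w : cdiff ((om b c)^~ w) p.
  under eq_fun do rewrite tw_conn_lowE; exact: cdiff_sum (dcl w).
have dth w : cdiff ((theta rho)^~ w) p := cdiff_theta (phs_regular H Sp) w.
have dhf w := derC_hform (X := fun r => dvec (frame D b) r w) a u (ddv w) dfc.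
have dfth w : cdiff (fun r => f r * theta rho r w) p := cdiffM df (dth w).
have dphi w : cdiff (phi^~ w) p.
  by apply: cdiffD (dfth w); apply: cdiffB (dom w) (dhf w).1.
have nW : \forall r \near p, W r := open_nbhs_nbhs (conj (phs_open H) Wp).
have phiE r w : W r -> phi r w = f r * theta rho r w - eps b c r w.
  by move=> Wr; rewrite /phi tw_epsE opprB addrC.
have E0 : ext_d phi p u v = 0.
  apply: (ext_d_tangent_eq0 (phs_regular H Sp)) => //.
    apply: filterS nW => r Wr k w w'; rewrite !phiE //.
    by rewrite theta_lin (eps_lin H b c Wr); ring.
  apply: filterS (phs_near H Sp) => r /[apply] Sr w tw.
  rewrite phiE ?(tw_eps_formula H b c Sr tw) /f ?(levi_hform H b c Sr); last exact: Sr.1.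
  by rewrite mulrAC subrr.
have dd : dvec (fun r => dvec (frame D b) r v) p u = dvec (fun r => dvec (frame D b) r u) p v.
  apply: dvec_dvec => j; last exact: ddX.
  by apply: filterS nW => r Wr; exact: (cdiff_frame H).
(* Tangential and normal parts are orthogonal. The tangential product will cancel against the
   derivative of h in [om]; the normal product is the Gauss term. *)
have hh w w' : tangent rho p w -> tangent rho p w' -> theta rho p w = 0 ->
    theta rho p w' = 0 ->
    hform a (dvec (frame D b) p w') (dvec (frame D c) p w) =
    \sum_d conn D b d p w' * (om c d p w)^* + Bf b p w' / N p * (Bf c p w)^*.
  move=> tw tw' w0 w0'; rewrite (dvec_frame b Sp tw' w0').
  rewrite hformDl hform_suml hformZl (hform_grad_l H); congr (_ + _).
  apply: eq_bigr => d _; rewrite hformZl -(hform_conj pa); congr (_ * (_)^*).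
  have := tw_eps_formula H c d Sp tw; rewrite w0 mulr0 mul0r tw_epsE => /eqP.
  by rewrite subr_eq0 => /eqP.
have hl w w' : tangent rho p w ->
   \sum_d conn D b d p w' * derC w (levi D d c) p =
   \sum_d conn D b d p w' * om d c p w + \sum_d conn D b d p w' * (om c d p w)^*.
  move=> tw; rewrite -big_split; apply: eq_bigr => d _ /=.
  by rewrite (derC_levi_om H d c Sp tw) mulrDr.
have derphi w w' : tangent rho p w -> tangent rho p w' -> theta rho p w = 0 ->
    theta rho p w' = 0 -> derC w (phi^~ w') p =
   \sum_d derC w ((conn D b d)^~ w') p * levi D d c p
   + (\sum_d conn D b d p w' * om d c p w + \sum_d conn D b d p w' * (om c d p w)^*)
   - (hform a (dvec (fun r => dvec (frame D b) r w') p w) (Z c p)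
      + (\sum_d conn D b d p w' * (om c d p w)^* + Bf b p w' / N p * (Bf c p w)^*))
   + f p * derC w ((theta rho)^~ w') p.
  move=> tw tw' w0 w0'; rewrite -(hl _ _ tw) -(hh _ _ tw tw' w0 w0').
  have [d1 e1] := derC_hform (X := fun r => dvec (frame D b) r w') a w (ddv w') dfc.
  rewrite /phi (derCD _ (cdiffB (dom w') d1) (dfth w')) (derCB _ (dom w') d1).
  (* The derivative of [f] comes multiplied by theta(w') = 0. *)
  rewrite e1 (derCM _ df (dth w')) w0' mulr0 add0r; congr (_ - _ + _).
  under eq_fun do rewrite tw_conn_lowE.
  rewrite (derC_sum _ _ _ (dcl w')) -big_split; apply: eq_bigr => d _ /=.
  by rewrite (derCM _ (cdiff_conn H b d w' Wp) (cdiff_levi H d c Wp)).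
have hw : \sum_d levi D d c p * \sum_g wedge (conn D b g) (conn D g d) p u v =
   \sum_d conn D b d p u * om d c p v - \sum_d conn D b d p v * om d c p u.
  transitivity (\sum_d \sum_g (conn D b g p u * (conn D g d p v * levi D d c p)
      - conn D b g p v * (conn D g d p u * levi D d c p))).
    apply: eq_bigr => d _; rewrite mulr_sumr; apply: eq_bigr => g _.
    by rewrite /wedge; ring.
  rewrite exchange_big -sumrB; apply: eq_bigr => g _ /=.
  by rewrite sumrB -!mulr_sumr -!tw_conn_lowE.
have he : \sum_d levi D d c p * ext_d (conn D b d) p u v =
   \sum_d derC u ((conn D b d)^~ v) p * levi D d c p
   - \sum_d derC v ((conn D b d)^~ u) p * levi D d c p.
  rewrite -sumrB; apply: eq_bigr => d _; rewrite /ext_d.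
  set x := derC _ _ _; set y := derC _ _ _; set z := levi _ _ _ _.
  by move: x y z => x y z; ring.
have hth : ext_d (theta rho) p u v =
  derC u ((theta rho)^~ v) p - derC v ((theta rho)^~ u) p by [].
have -> : \sum_d levi D d c p * (ext_d (conn D b d) p u v
      - \sum_g wedge (conn D b g) (conn D g d) p u v) =
    \sum_d levi D d c p * ext_d (conn D b d) p u v
    - \sum_d levi D d c p * \sum_g wedge (conn D b g) (conn D g d) p u v.
  by rewrite -sumrB; apply: eq_bigr => d _; rewrite mulrBr.
rewrite hw he hth.
move: E0; rewrite /ext_d (derphi u v tu tv u0 v0) (derphi v u tv tu v0 u0) dd.
have -> : f p = 'i * (N p)^-1 * levi D b c p by [].
clear f phi df dfth dphi phiE derphi.
move: (\sum_d derC u ((conn D b d)^~ v) p * levi D d c p)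
  (\sum_d derC v ((conn D b d)^~ u) p * levi D d c p)
  (\sum_d conn D b d p u * om d c p v) (\sum_d conn D b d p v * om d c p u)
  (\sum_d conn D b d p v * (om c d p u)^*) (\sum_d conn D b d p u * (om c d p v)^*).
move: (hform a (dvec _ p v) (Z c p)).
move: (derC u ((theta rho)^~ v) p) (derC v ((theta rho)^~ u) p).
generalize (Bf b p v) (Bf b p u) (Bf c p v)^* (Bf c p u)^*.
generalize (levi D b c p) (N p)^-1; clear.
move=> l N b1 b2 c1 c2 t1 t2 h s1 s2 s3 s4 s5 s6 E.
apply/eqP; rewrite -subr_eq0; apply/eqP; rewrite -[RHS]E; ring.
Qed.

End CurvatureForm.


(** * Extracting the (1,1) part of a bilinear form *)

Section EvalBilinear.
Context {R : realType} {m : nat}.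

Lemma ev2_sum (I : finType) (l : I -> R[i]) (F : I -> Cn R m -> Cn R m -> R[i])
    (X Y : cvec R m) :
  \sum_e l e * ev2 (F e) X Y = ev2 (fun u v => \sum_e l e * F e u v) X Y.
Proof.
rewrite /ev2 /ev1 !mulr_sumr -!big_split mulr_sumr -big_split.
by apply: eq_bigr => e _ /=; ring.
Qed.

(* [vec10 x] is of type (1,0) and [vec01 y] of type (0,1): only the part of [F]
   that is linear in [x] and antilinear in [y] survives. *)
Lemma ev2_vec10_vec01 (F : Cn R m -> Cn R m -> R[i]) (x y : 'rV[R[i]]_m)
    (A B C E : R[i]) :
  (forall k l : R[i], F (toCn (k *: x)) (toCn (l *: y)) =
    k * l * A + k * l^* * B + k^* * l * C + k^* * l^* * E) ->
  ev2 F (vec10 x) (vec01 y) = B.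
Proof.
move=> FE.
have h2 : (2^-1 : R)%:C = 2^-1 :> R[i] by rewrite fmorphV rmorph_nat.
(* Both components become complex multiples of x, so that the expansion of [F] applies to them. *)
have -> : vec10 x = (toCn (2^-1 *: x), toCn ((- 'i / 2) *: x)).
  rewrite /vec10 -!toCnZ h2 -scaleN1r -[-1 *: _]toCnZ !scalerA.
  by congr (_, toCn (_ *: _)); rewrite rmorphN1; ring.
have -> : vec01 y = (toCn (2^-1 *: y), toCn (('i / 2) *: y)).
  by rewrite /vec01 -!toCnZ h2 !scalerA; congr (_, toCn (_ *: _)); ring.
have c2 : (2^-1 : R[i])^* = 2^-1 by rewrite fmorphV rmorph_nat.
have c3 : ('i / 2 : R[i])^* = - 'i / 2 by rewrite rmorphM /= conjCi c2.
have c4 : (- 'i / 2 : R[i])^* = 'i / 2 by rewrite mulNr rmorphN /= c3 mulNr opprK.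
rewrite /ev2 /ev1 /= (FE 2^-1 2^-1) (FE 2^-1 ('i / 2)) (FE (- 'i / 2) 2^-1).
rewrite (FE (- 'i / 2) ('i / 2)) c2 c3 c4.
have i2 : 'i * 'i = -1 :> R[i] by rewrite -expr2 sqrCi.
by move: 'i i2 => i i2; field: i2.
Qed.

End EvalBilinear.


(** Contracts one index of the curvature, a combination of three products, with a component of Z. *)
Lemma sum_lin3 (K : comPzRingType) (I : finType) (A B C k : K) (f g h z : I -> K) :
  \sum_s k * (A * f s + B * g s - C * h s) * z s =
  k * (A * (\sum_s f s * z s) + B * (\sum_s g s * z s) - C * (\sum_s h s * z s)).
Proof.
rewrite (eq_bigr (fun s => k * A * (f s * z s) + k * B * (g s * z s)
  - k * C * (h s * z s))) => [|s _]; last by ring.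
by rewrite sumrB big_split /= -!mulr_sumr; ring.
Qed.

(** * Holomorphic sectional curvature and torsion *)

Section HolomorphicSectional.
Context {R : realType} {n : nat} (U : set (Cn R n.+1)) (rho : Cn R n.+1 -> R).
Context (a : 'M[R[i]]_n.+1) (D : ph_data R n) (W : set (Cn R n.+1)).
Context (H : ph_setting U rho a D W).
Local Notation S := (W `&` hypersurface U rho).
Local Notation pa := (phs_pos H).
Local Notation N q := (dual_normsq a rho q).
Local Notation Z b q := (frame D b q).
Local Notation Q x y q := (q2 rho q x y).
Implicit Types (p q u v : Cn R n.+1) (x y : 'rV[R[i]]_n.+1) (b c d s : 'I_n).

Lemma curv_low_formula p b c d s : S p -> curv_low D p b c d s =
  (hform a (Z b p) (Z c p) * hform a (Z d p) (Z s p)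
   + hform a (Z b p) (Z s p) * hform a (Z d p) (Z c p)
   - Q (Z d p) (Z b p) p * (Q (Z s p) (Z c p) p)^*) / N p.
Proof.
move=> Sp; rewrite /curv_low /curv ev2_sum.
pose h x y := hform a (x : 'rV[R[i]]_n.+1) y; pose P x y := Q x y p.
(* The values are the coefficients of [k l], [k l^*], [k^* l] and [k^* l^*] in the Gauss equation on
   k Z_d and l Z_s; the second is the curvature and is read off the goal. *)
apply: (@ev2_vec10_vec01 _ _ _ (Z d p) (Z s p)
  ((P (Z s p) (Z b p) * h (Z d p) (Z c p) - P (Z d p) (Z b p) * h (Z s p) (Z c p)) / N p)
  _
  ((P (Z s p) (Z b p) * (P (Z d p) (Z c p))^* - h (Z b p) (Z d p) * h (Z s p) (Z c p)
    - h (Z b p) (Z c p) * h (Z s p) (Z d p)) / N p)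
  ((h (Z b p) (Z s p) * (P (Z d p) (Z c p))^* - h (Z b p) (Z d p) * (P (Z s p) (Z c p))^*) / N p)).
move=> k l.
have gen e x (r : R[i]) : del rho p x = 0 ->
    frame_deriv_del rho D e p (toCn (r *: x)) =
    - (r * P x (Z e p) + r^* * h (Z e p) x).
  by move=> dx; rewrite (frame_deriv_del_toCn H) ?delZ ?dx ?mulr0 // q2Zl hformZr.
have genC e x (r : R[i]) : del rho p x = 0 ->
    (frame_deriv_del rho D e p (toCn (r *: x)))^* =
    - (r^* * (P x (Z e p))^* + r * h x (Z e p)).
  move=> dx; rewrite gen // rmorphN rmorphD !rmorphM /= conjCK.
  by rewrite /h (hform_conj pa).
have dd := frame_del H d Sp; have ds := frame_del H s Sp.
have core u v (bu bv cu cv t : R[i]) : tangent rho p u -> tangent rho p v ->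
    theta rho p u = 0 -> theta rho p v = 0 ->
    frame_deriv_del rho D b p u = bu -> frame_deriv_del rho D b p v = bv ->
    (frame_deriv_del rho D c p u)^* = cu -> (frame_deriv_del rho D c p v)^* = cv ->
    ext_d (theta rho) p u v = t ->
    \sum_d levi D d c p * (ext_d (conn D b d) p u v
      - \sum_g wedge (conn D b g) (conn D g d) p u v) =
    (bv * cu - bu * cv) / N p - 'i / N p * h (Z b p) (Z c p) * t.
  move=> tu tv u0 v0 <- <- <- <- <-.
  by rewrite (curvature_form H b c Sp tu tv u0 v0) (levi_hform H b c Sp).
apply: etrans (core _ _ _ _ _ _ _ (frame_tangent H d k Sp) (frame_tangent H s l Sp)
  (frame_theta H d k Sp) (frame_theta H s l Sp) (gen b _ k dd) (gen b _ l ds)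
  (genC c _ k dd) (genC c _ l ds) (phs_dtheta H _ _ Sp)) _.
rewrite !toCnK !hformZl !hformZr.
have i2 : 'i * 'i = -1 :> R[i] by rewrite -expr2 sqrCi.
have N0 := normsq_neq0 H Sp.
rewrite -!/(h _ _) -!/(P _ _).
move: 'i i2 (N p) N0 => i i2 M M0.
generalize (P (Z s p) (Z b p)) (P (Z d p) (Z b p)) (P (Z s p) (Z c p))^* (P (Z d p) (Z c p))^*.
generalize (h (Z d p) (Z c p)) (h (Z s p) (Z c p)) (h (Z b p) (Z d p)) (h (Z b p) (Z s p)).
generalize (h (Z b p) (Z c p)) (h (Z d p) (Z s p)) (h (Z s p) (Z d p)) (k^*) (l^*).
by move=> *; field: i2.
Qed.

Lemma zeta_sum p (k : 'I_n -> R[i]) b : S p ->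
  zeta D p (\sum_c k c *: Z c p) b = k b.
Proof.
move=> Sp; have lt := coframe_lin H b Sp.1.
have E (l : R[i]) : coframe D b p (toCn (l *: \sum_c k c *: Z c p)) = l * k b.
  rewrite scaler_sumr toCn_sum (rlinear_sum lt).
  under eq_bigr => c _ do rewrite scalerA (coframe_toCn H b c _ Sp) eq_sym -mulrA.
  by rewrite -mulr_sumr sum_delta.
rewrite /zeta (ev1_vec10 lt) E -[X in toCn X]scale1r E.
have i2 : 'i * 'i = -1 :> R[i] by rewrite -expr2 sqrCi.
by move: 'i i2 => i i2; field: i2.
Qed.

Lemma hol_sec_sums p (k : 'I_n -> R[i]) : S p ->
  let X := \sum_c k c *: Z c p in
  [/\ normsq D p X = hform a X X,
      \sum_b \sum_c \sum_d \sum_s curv_low D p b c d s * zeta D p X b *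
        (zeta D p X c)^* * zeta D p X d * (zeta D p X s)^*
      = (2 * hform a X X ^+ 2 - Q X X p * (Q X X p)^*) / N p &
      \sum_b \sum_c tors_low D p b c * zeta D p X b * zeta D p X c
      = - ('i / N p) * Q X X p].
Proof.
move=> Sp X; have zE b : zeta D p X b = k b by exact: zeta_sum.
have hl x : \sum_c hform a (Z c p) x * k c = hform a X x.
  by rewrite /X hform_suml; apply: eq_bigr => c _; rewrite hformZl mulrC.
have hr x : \sum_c hform a x (Z c p) * (k c)^* = hform a x X.
  by rewrite /X hform_sumr; apply: eq_bigr => c _; rewrite hformZr mulrC.
have ql x : \sum_c Q (Z c p) x p * k c = Q X x p.
  by rewrite /X q2_suml; apply: eq_bigr => c _; rewrite q2Zl mulrC.
have qs x y : Q x y p = Q y x p by exact: (q2_sym (phs_regular H Sp)).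
have qc x : \sum_c (Q (Z c p) x p)^* * (k c)^* = (Q X x p)^*.
  by rewrite -ql rmorph_sum; apply: eq_bigr => c _; rewrite rmorphM.
have qr x : \sum_c Q x (Z c p) p * k c = Q x X p.
  by rewrite qs -ql; apply: eq_bigr => c _; rewrite qs.
have qcr x : \sum_c (Q x (Z c p) p)^* * (k c)^* = (Q x X p)^*.
  by rewrite (qs x X) -qc; apply: eq_bigr => c _; rewrite qs.
split.
- rewrite /normsq -hl; apply: eq_bigr => b _; rewrite -hr mulr_suml.
  by apply: eq_bigr => c _; rewrite !zE (levi_hform H b c Sp) mulrAC.
- under eq_bigr => b _ do under eq_bigr => c _ do under eq_bigr => d _ do
    under eq_bigr => s _ do rewrite !zE (curv_low_formula _ _ _ _ Sp).
  transitivity (\sum_b (N p)^-1 * (hform a X X * hform a (Z b p) X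
      + hform a X X * hform a (Z b p) X - (Q X X p)^* * Q X (Z b p) p) * k b);
    last by rewrite sum_lin3 hl qr; ring.
  apply: eq_bigr => b _.
  transitivity ((\sum_c (N p)^-1 * (hform a X X * hform a (Z b p) (Z c p)
      + hform a (Z b p) X * hform a X (Z c p)
      - Q X (Z b p) p * (Q X (Z c p) p)^*) * (k c)^*) * k b); last first.
    by rewrite sum_lin3 !hr qcr; ring.
  rewrite mulr_suml; apply: eq_bigr => c _.
  transitivity ((\sum_d (N p)^-1 * (hform a (Z b p) (Z c p) * hform a (Z d p) X
      + hform a (Z b p) X * hform a (Z d p) (Z c p)
      - (Q X (Z c p) p)^* * Q (Z d p) (Z b p) p) * k d) * (k c)^* * k b); last first.
    by rewrite sum_lin3 !hl ql; ring.
  rewrite !mulr_suml; apply: eq_bigr => d _.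
  transitivity ((\sum_s (N p)^-1 * (hform a (Z b p) (Z c p) * hform a (Z d p) (Z s p)
      + hform a (Z d p) (Z c p) * hform a (Z b p) (Z s p)
      - Q (Z d p) (Z b p) p * (Q (Z s p) (Z c p) p)^*) * (k s)^*) * k d * (k c)^* * k b);
    last by rewrite sum_lin3 !hr qc; ring.
  by rewrite !mulr_suml; apply: eq_bigr => s _; ring.
- rewrite -ql mulr_sumr; apply: eq_bigr => b _; rewrite -qr mulr_suml mulr_sumr.
  by apply: eq_bigr => c _; rewrite !zE (tors_low_formula H b c Sp); ring.
Qed.

Lemma hol_sec_formulas p X : S p -> T10 rho p X -> X != 0 ->
  [/\ hol_sec_curv D p X = 2^-1 * (2 * hform a X X ^+ 2 - `|Q X X p| ^+ 2)
        / (N p * hform a X X ^+ 2) &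
      `|hol_sec_tors D p X| = `|Q X X p| / (N p * hform a X X)].
Proof.
move=> Sp TX X0; have [k XE] := T10_span H Sp TX.
have [n1 c1 t1] := hol_sec_sums k Sp; move: n1 c1 t1; rewrite -XE => n1 c1 t1.
have h0 := hform_gt0 pa X0; have N0 := phs_normsq_gt0 H Sp.
split.
  by rewrite /hol_sec_curv c1 n1 normCK; field; rewrite !gt_eqF.
rewrite /hol_sec_tors t1 n1.
have -> : 'i * (- ('i / N p) * Q X X p) / hform a X X = Q X X p / (N p * hform a X X).
  have i2 : 'i * 'i = -1 :> R[i] by rewrite -expr2 sqrCi.
  move: 'i i2 => i i2; field: i2; rewrite !gt_eqF //.
by rewrite normrM normfV (gtr0_norm (mulr_gt0 N0 h0)).
Qed.

End HolomorphicSectional.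


(** * Consequences of C-convexity *)

Section Convexity.
Context {R : realType} {n : nat} (U : set (Cn R n.+1)) (rho : Cn R n.+1 -> R).
Context (a : 'M[R[i]]_n.+1) (D : ph_data R n) (W : set (Cn R n.+1)).
Context (H : ph_setting U rho a D W).
Local Notation S := (W `&` hypersurface U rho).
Local Notation pa := (phs_pos H).
Local Notation N q := (dual_normsq a rho q).
Local Notation Q x y q := (q2 rho q x y).
Implicit Types (p q : Cn R n.+1) (x y : 'rV[R[i]]_n.+1).

Lemma hess_q2 p x : S p ->
  hess rho p x = (complex.Re (Q x x p))%:C + hform a x x.
Proof.
move=> Sp; rewrite /hess; congr (_ + _).
  have ReS (I : finType) (F : I -> R[i]) :
      \sum_j (complex.Re (F j))%:C = (complex.Re (\sum_j F j))%:C.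
    by elim/big_rec2: _ => // j y1 y2 _ ->; rewrite Re_add rmorphD.
  rewrite /q2 -ReS; apply: eq_bigr => j _; exact: ReS.
by apply: eq_bigr => j _; apply: eq_bigr => k _; rewrite (phs_rho11 H).
Qed.

(* Rotating [x] by a square root of the phase of [- Q x x] turns the Hessian
   into [hform x x - |Q x x|]. *)
Lemma hess_rotate p x : S p -> T10 rho p x ->
  exists2 w : R[i], w != 0 & T10 rho p (w *: x) /\
    hess rho p (w *: x) = hform a x x - `|Q x x p|.
Proof.
move=> Sp Tx.
have [w w1 wQ] : exists2 w : R[i], `|w| = 1 & w ^+ 2 * Q x x p = - `|Q x x p|.
  have [->|q0] := eqVneq (Q x x p) 0.
    by exists 1; rewrite ?normr1 // mulr0 normr0 oppr0.
  (* The Hessian form is quadratic in the rotation, so w^2 has to be the phase that sends [Q x x] to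
     - |Q x x|. *)
  exists (sqrtC (- (Q x x p)^* / `|Q x x p|)).
    apply/eqP; rewrite -(@eqrXn2 _ 2) // -normrX sqrtCK expr1n.
    by rewrite normrM normfV normr_id normrN norm_conjC divff // normr_eq0.
  by rewrite sqrtCK mulrAC mulNr -normCKC expr2 mulNr -mulrA divff ?mulr1 // normr_eq0.
have w0 : w != 0 by rewrite -normr_eq0 w1 oner_eq0.
exists w => //; split.
  by have := delZ rho p w x; rewrite /del Tx mulr0.
rewrite hess_q2 // hformZl hformZr mulrA -normCK w1 expr1n mul1r addrC.
congr (_ + _); rewrite q2Zl (q2_sym (phs_regular H Sp)) q2Zl mulrA -expr2 wQ.
by rewrite RRe_real // rpredN normr_real.
Qed.

Lemma C_convex_q2 p x : C_convex U rho -> S p -> T10 rho p x ->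
  `|Q x x p| <= hform a x x.
Proof.
move=> cv Sp Tx; have [w _ [Tw hw]] := hess_rotate Sp Tx.
by rewrite -subr_ge0 -hw; apply: cv => //; case: Sp.
Qed.

Lemma strictly_C_convex_q2 p x : strictly_C_convex U rho -> S p ->
  T10 rho p x -> x != 0 -> `|Q x x p| < hform a x x.
Proof.
move=> cv Sp Tx x0; have [w w0 [Tw hw]] := hess_rotate Sp Tx.
rewrite -subr_gt0 -hw; apply: cv => //; first by case: Sp.
by rewrite scaler_eq0 negb_or w0.
Qed.

(** With the closed formulas, either inequality amounts to r <= h. *)
Lemma hol_sec_bounds p x : C_convex U rho -> S p -> T10 rho p x -> x != 0 ->
  2^-1 * (N p)^-1 <= hol_sec_curv D p x /\
  2^-1 * `|hol_sec_tors D p x| <= 2^-1 * (N p)^-1.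
Proof.
move=> cv Sp Tx x0; have [-> ->] := hol_sec_formulas H Sp Tx x0.
have h0 := hform_gt0 pa x0; have N0 := phs_normsq_gt0 H Sp.
have := C_convex_q2 cv Sp Tx; have := normr_ge0 (Q x x p).
move: `|Q x x p| (hform a x x) h0 (N p) N0 => r h h0 M M0 r0 rh.
have h20 : 0 < h ^+ 2 by rewrite exprn_gt0.
split.
  rewrite -subr_ge0.
  have -> : 2^-1 * (2 * h ^+ 2 - r ^+ 2) / (M * h ^+ 2) - 2^-1 / M =
      2^-1 * (h - r) * (h + r) / (M * h ^+ 2) by field; rewrite !gt_eqF.
  apply: divr_ge0; last exact: ltW (mulr_gt0 M0 h20).
  apply: mulr_ge0; last exact: addr_ge0 (ltW h0) r0.
  by apply: mulr_ge0; rewrite ?invr_ge0 ?ler0n // subr_ge0.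
rewrite ler_pM2l ?invr_gt0 ?ltr0n // ler_pdivrMr ?mulr_gt0 // mulrA.
by rewrite mulVf ?mul1r // gt_eqF.
Qed.

Lemma hol_sec_lt p x (C0 : R) : C_convex U rho -> S p -> T10 rho p x -> x != 0 ->
  C0 < 2^-1 -> 0 < hol_sec_curv D p x - C0%:C * `|hol_sec_tors D p x|.
Proof.
move=> cv Sp Tx x0 C0h; have [Kb Ab] := hol_sec_bounds cv Sp Tx x0.
have N0 := phs_normsq_gt0 H Sp; rewrite subr_gt0.
have C0h' : C0%:C < 2^-1 :> R[i].
  have <- : (2^-1 : R)%:C = 2^-1 :> R[i] by rewrite fmorphV rmorph_nat.
  by rewrite ltcR.
have N1 : 0 < 2^-1 * (N p)^-1 by rewrite mulr_gt0 ?invr_gt0 ?ltr0n.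
(* Where the torsion vanishes strictness comes from K > 0, elsewhere from C0 < 1/2. *)
have [A0|A0] := eqVneq `|hol_sec_tors D p x| 0.
  by rewrite A0 mulr0 (lt_le_trans N1).
have A1 : 0 < `|hol_sec_tors D p x| by rewrite lt0r A0 normr_ge0.
by apply: lt_le_trans Kb; apply: lt_le_trans Ab; rewrite ltr_pM2r.
Qed.

(** The difference has the factor h - r, which strict C-convexity makes positive. *)
Lemma hol_sec_half p x : strictly_C_convex U rho -> S p -> T10 rho p x ->
  x != 0 -> 0 < hol_sec_curv D p x - (2^-1 : R)%:C * `|hol_sec_tors D p x|.
Proof.
move=> cv Sp Tx x0; have [-> ->] := hol_sec_formulas H Sp Tx x0.
have h0 := hform_gt0 pa x0; have N0 := phs_normsq_gt0 H Sp.
have := strictly_C_convex_q2 cv Sp Tx x0; have := normr_ge0 (Q x x p).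
have -> : (2^-1 : R)%:C = 2^-1 :> R[i] by rewrite fmorphV rmorph_nat.
move: `|Q x x p| (hform a x x) h0 (N p) N0 => r h h0 M M0 r0 rh.
have h20 : 0 < h ^+ 2 by rewrite exprn_gt0.
have -> : 2^-1 * (2 * h ^+ 2 - r ^+ 2) / (M * h ^+ 2) - 2^-1 * (r / (M * h)) =
    2^-1 * (h - r) * (2 * h + r) / (M * h ^+ 2) by field; rewrite !gt_eqF.
have h2 : 0 < 2 * h by rewrite mulr_gt0 // ltr0n.
by rewrite divr_gt0 ?mulr_gt0 ?subr_gt0 ?invr_gt0 ?ltr0n ?ltr_wpDr.
Qed.

End Convexity.


(** * Smooth functions *)

Section SmoothClosure.
Context {R : realType}.

Lemma near_eq_differentiable (V : normedModType R) (f g : V -> R) (p : V) :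
  (\forall q \near p, f q = g q) -> differentiable f p -> differentiable g p.
Proof.
move=> fg df; have fgp : f p = g p := nbhs_singleton fg.
(* The differential of g is a chosen value, so it suffices to exhibit one that works: that of f. *)
apply/diffP; apply: (@getPex _ (fun (d : {linear V -> R}) => continuous d /\
  forall x, g x = g (lim (nbhs p)) + d (x - lim (nbhs p))
                  +o_(x \near p) (x - lim (nbhs p)))).
exists ('d f p); split; first exact: diff_continuous.
move: (diffE df) => /funext/eqaddoP H.
suff : (g = (fun x => g (lim (nbhs p)) + 'd f p (x - lim (nbhs p)))
    +o_ (nbhs p) (fun x => x - lim (nbhs p))) by move=> {1}->.
apply/eqaddoP => e e0; have := H e e0; rewrite lim_id //.
apply: filterS2 fg => q fgq; by rewrite !fctE fgq fgp.
Qed.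

Context {m : nat} (W : set (Cn R m)) (oW : open W).
Implicit Types (f g : Cn R m -> R).

Lemma near_open p : W p -> \forall q \near p, W q.
Proof. by move=> Wp; exact: open_nbhs_nbhs (conj oW Wp). Qed.

(** Derivatives at a point of W depend on values around it; openness turns equality on W into
    equality near each point. *)
Lemma Ck_ext k f g : (forall q, W q -> f q = g q) -> Ck k W f -> Ck k W g.
Proof.
have nfg h1 h2 p : (forall q, W q -> h1 q = h2 q) -> W p ->
    \forall q \near p, h1 q = h2 q.
  by move=> E Wp; apply: filterS (near_open Wp) => q; exact: E.
elim: k f g => [|k IH] f g fg /=.
  move=> cf p Wp; have := cf p Wp; rewrite /continuous_at /prop_for /= -(fg p Wp).
  by apply: cvg_trans; apply: near_eq_cvg; exact: nfg.
move=> [df ddf]; split=> [p Wp|v].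
  by apply: (@near_eq_differentiable _ f g p); [exact: nfg|exact: df].
apply: IH (ddf v) => q Wq; apply: near_eq_derive; exact: nfg.
Qed.

Lemma smooth_cst (c : R) : smooth W (fun=> c).
Proof.
move=> k; elim: k c => [|k IH] c /=; first by move=> p _; exact: cst_continuous.
split=> [p _|v]; first exact: differentiable_cst.
by apply: Ck_ext (IH 0) => q _; rewrite derive_cst.
Qed.

Lemma Ck_pred k f : Ck k.+1 W f -> Ck k W f.
Proof.
elim: k f => [|k IH] f [df ddf] /=.
  by move=> p Wp; exact: differentiable_continuous (df _ Wp).
by split=> // v; exact: IH.
Qed.

Lemma Ck_add k f g : Ck k W f -> Ck k W g -> Ck k W (fun q => f q + g q).
Proof.
elim: k f g => [|k IH] f g cf cg.
  by move=> p Wp; apply: continuousD; [exact: cf|exact: cg].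
case: cf cg => df ddf [dg ddg].
split=> [p Wp|v]; first exact: differentiableD (df _ Wp) (dg _ Wp).
apply: Ck_ext (IH _ _ (ddf v) (ddg v)) => q Wq.
by have [_ ->] := is_deriveD (derivableP (@diff_derivable _ _ _ _ q v (df _ Wq)))
  (derivableP (@diff_derivable _ _ _ _ q v (dg _ Wq))).
Qed.

Lemma Ck_mul k f g : Ck k W f -> Ck k W g -> Ck k W (fun q => f q * g q).
Proof.
elim: k f g => [|k IH] f g cf cg.
  by move=> p Wp; apply: continuousM; [exact: cf|exact: cg].
have cf' := Ck_pred cf; have cg' := Ck_pred cg.
case: cf cg => df ddf [dg ddg].
split=> [p Wp|v]; first exact: differentiableM (df _ Wp) (dg _ Wp).
apply: Ck_ext (Ck_add (IH _ _ cf' (ddg v)) (IH _ _ cg' (ddf v))) => q Wq.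
by have [_ ->] := is_deriveM (derivableP (@diff_derivable _ _ _ _ q v (df _ Wq)))
  (derivableP (@diff_derivable _ _ _ _ q v (dg _ Wq))).
Qed.

(** By induction on k: the derivative - f' / f^2 is a product of f' and two copies of 1 / f, which
    are of class C^k already. *)
Lemma smoothV f : smooth W f -> (forall q, W q -> f q != 0) ->
  smooth W (fun q => (f q)^-1).
Proof.
move=> sf f0 k; elim: k => [|k IH] /=.
  move=> p Wp; apply: differentiable_continuous; apply: differentiableV (f0 _ Wp).
  exact: smooth_differentiable sf Wp.
have df p := smooth_differentiable (p := p) sf.
split=> [p Wp|v]; first exact: differentiableV (df _ Wp) (f0 _ Wp).
apply: Ck_ext (Ck_mul (smooth_derive v sf k)
  (Ck_mul (Ck_mul IH IH) (smooth_cst (-1) k))) => q Wq.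
rewrite (deriveV (f0 _ Wq) (@diff_derivable _ _ _ _ q v (df _ Wq))).
by rewrite expr2 invfM /GRing.scale /=; ring.
Qed.

End SmoothClosure.

Section SmoothComplex.
Context {R : realType} {m : nat} (W : set (Cn R m)) (oW : open W).
Implicit Types (f g : Cn R m -> R[i]).

Lemma smoothC_cst (c : R[i]) : smoothC W (fun=> c).
Proof. by split; exact: smooth_cst. Qed.

Lemma smoothC_ext f g : (forall q, f q = g q) -> smoothC W f -> smoothC W g.
Proof. by move=> /funext ->. Qed.

Lemma smooth_eq (f g : Cn R m -> R) : (forall q, f q = g q) -> smooth W f -> smooth W g.
Proof. by move=> /funext ->. Qed.

Lemma smoothCD f g : smoothC W f -> smoothC W g -> smoothC W (fun q => f q + g q).
Proof.
move=> [f1 f2] [g1 g2]; split.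
- apply: (smooth_eq (fun q => esym (Re_add (f q) (g q)))) => l; exact: Ck_add.
- apply: (smooth_eq (fun q => esym (Im_add (f q) (g q)))) => l; exact: Ck_add.
Qed.

Lemma smoothCM f g : smoothC W f -> smoothC W g -> smoothC W (fun q => f q * g q).
Proof.
move=> [f1 f2] [g1 g2]; split.
- apply: (@smooth_eq (fun q => complex.Re (f q) * complex.Re (g q)
      - complex.Im (f q) * complex.Im (g q))) => [q|l]; first by rewrite /= Re_mul.
  apply: Ck_add => //; first exact: Ck_mul.
  apply: (Ck_ext oW (f := fun q => -1 * (complex.Im (f q) * complex.Im (g q)))).
    by move=> q _; rewrite mulN1r.
  by apply: Ck_mul => //; [exact: smooth_cst|exact: Ck_mul].
- apply: (@smooth_eq (fun q => complex.Re (f q) * complex.Im (g q)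
      + complex.Im (f q) * complex.Re (g q))) => [q|l]; first by rewrite /= Im_mul.
  by apply: Ck_add => //; exact: Ck_mul.
Qed.

Lemma smoothCN f : smoothC W f -> smoothC W (fun q => - f q).
Proof.
move=> sf; apply: (smoothC_ext (fun q => mulN1r (f q))).
exact: smoothCM (smoothC_cst _) sf.
Qed.

Lemma smoothCB f g : smoothC W f -> smoothC W g -> smoothC W (fun q => f q - g q).
Proof. by move=> sf sg; exact: smoothCD sf (smoothCN sg). Qed.

Lemma smoothC_sum (I : Type) (r : seq I) (F : I -> Cn R m -> R[i]) :
  (forall i, smoothC W (F i)) -> smoothC W (fun q => \sum_(i <- r) F i q).
Proof.
move=> sF; elim: r => [|i r IH].
  apply: (smoothC_ext (f := fun=> 0)); last exact: smoothC_cst.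
  by move=> q; rewrite big_nil.
apply: (smoothC_ext (f := fun q => F i q + \sum_(j <- r) F j q)).
  by move=> q; rewrite big_cons.
exact: smoothCD.
Qed.

Lemma smoothC_realC (f : Cn R m -> R) : smooth W f -> smoothC W (realC f).
Proof. by move=> sf; split=> //; exact: smooth_cst. Qed.

Definition xcoord (j : 'I_m) (q : Cn R m) : R := q.1 0 j.

(** A continuous linear map is its own differential. *)
Lemma derive_xcoord j q v : differentiable (xcoord j) q /\ 'D_v (xcoord j) q = xcoord j v.
Proof.
have lin : linear (xcoord j : Cn R m -> R^o).
  by move=> c u w; rewrite /xcoord /= !mxE.
pose XM := GRing.isLinear.Build _ _ _ _ _ lin.
pose XL : {linear Cn R m -> R^o} := HB.pack (xcoord j : Cn R m -> R^o) XM.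
have cX : continuous XL.
  move=> r; apply: (@continuous_comp _ _ _ (fun r : Cn R m => r.1)
    (fun N : 'rV[R]_m => N 0 j)); first exact: cvg_fst.
  exact: coord_continuous.
have dX : differentiable (xcoord j) q by exact: (linear_differentiable q cX).
by split=> //; rewrite deriveE // (diff_lin q cX).
Qed.

End SmoothComplex.


(** * The tube *)

Local Transparent theta rho1 rho1b rho2 rho11 dual_normsq.

Section Tube.
Context {R : realType} {n : nat}.
Local Notation m := n.+1.
Implicit Types (q u v : Cn R m) (j k : 'I_m) (b c d : 'I_n).

(* A rescaling of the tube of [strictly_C_convex], for which
   [sum_j (Re z_j)^2 = 1] and [|d rho|^2 = 4] on M. *)
Definition tube q : R := 2 * \sum_j xcoord j q * xcoord j q - 2.

Local Notation C j q := (realC (xcoord j) q).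
Local Notation L b := (lift ord0 b).

Lemma smooth_xcoord (W : set (Cn R m)) j : open W -> smooth W (xcoord j).
Proof.
move=> oW [|k] /=.
  by move=> p _; apply: differentiable_continuous; exact: (derive_xcoord j p 0).1.
split=> [p _|v]; first exact: (derive_xcoord j p 0).1.
apply: (Ck_ext oW (f := fun=> xcoord j v)) (smooth_cst oW _ k) => q _.
by rewrite (derive_xcoord j q v).2.
Qed.

Lemma cdiff_xcoord j q : cdiff (realC (xcoord j)) q.
Proof. by apply: cdiff_realC; exact: (derive_xcoord j q 0).1. Qed.

Lemma derC_xcoord j q v : derC v (realC (xcoord j)) q = C j v.
Proof. by rewrite derC_realC (derive_xcoord j q v).2. Qed.

Lemma xcoord_ex j k : C k (ex R j) = (j == k)%:R.
Proof. by rewrite /realC /xcoord /ex /= mxE eqxx eq_sym rmorph_nat. Qed.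

Lemma xcoord_ey j k : C k (ey R j) = 0.
Proof. by rewrite /realC /xcoord /ey /= mxE. Qed.

Lemma xcoord_conj j q : (C j q)^* = C j q.
Proof. by rewrite -conjcE conjc_real. Qed.

Lemma realC_tube : realC tube = (fun q => 2 * \sum_j C j q * C j q - 2).
Proof.
apply/funext => q; rewrite /realC /tube rmorphB rmorphM rmorph_sum /=.
by rewrite rmorph_nat; congr (_ * _ - _); apply: eq_bigr => j _; rewrite rmorphM.
Qed.

Lemma tube_eq0 q : tube q = 0 -> \sum_j C j q * C j q = 1.
Proof.
move=> t0; have := congr1 (fun f => f q) realC_tube; rewrite /= /realC t0 => E.
have /eqP := esym E; rewrite subr_eq0 => /eqP {}E.
by apply: (@mulfI _ (2 : R[i])); rewrite ?pnatr_eq0 // E mulr1.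
Qed.

Lemma derC_tube q v : derC v (realC tube) q = 4 * \sum_j C j q * C j v.
Proof.
have d2 j : cdiff (fun r => C j r * C j r) q := cdiffM (cdiff_xcoord j q) (cdiff_xcoord j q).
have ds := cdiff_sum (index_enum 'I_m) xpredT d2.
rewrite realC_tube (derCB _ (cdiffMl 2 ds) (cdiff_cst 2 q)) derC_cst subr0.
rewrite (derCMl _ _ ds) (derC_sum _ _ _ d2) !mulr_sumr; apply: eq_bigr => j _.
by rewrite (derCM _ (cdiff_xcoord j q) (cdiff_xcoord j q)) derC_xcoord; ring.
Qed.

Lemma derive_tube q v : ('D_v tube q : R)%:C = 4 * \sum_j C j q * C j v.
Proof. by rewrite -derC_realC derC_tube. Qed.

Lemma smooth_tube (W : set (Cn R m)) : open W -> smooth W tube.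
Proof.
move=> oW; rewrite /tube.
have sx j := smooth_xcoord j oW.
have ss (r : seq 'I_m) : smooth W (fun q => \sum_(j <- r) xcoord j q * xcoord j q).
  elim: r => [|j r IH].
    apply: (smooth_eq (f := fun=> 0)); last exact: smooth_cst.
    by move=> q; rewrite big_nil.
  apply: (smooth_eq (f := fun q => xcoord j q * xcoord j q
      + \sum_(i <- r) xcoord i q * xcoord i q)).
    by move=> q; rewrite big_cons.
  by move=> k; exact: (Ck_add oW (Ck_mul oW (sx j k) (sx j k)) (IH k)).
move=> k; exact (Ck_add oW (Ck_mul oW (smooth_cst oW 2 k) (ss (index_enum 'I_m) k))
  (smooth_cst oW (- 2) k)).
Qed.

Lemma tube_rho1 j q : rho1 tube j q = 2 * C j q.
Proof.
have e1 : \sum_k C k q * C k (ex R j) = C j q.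
  by rewrite -[RHS](sum_delta (fun k => C k q)); apply: eq_bigr => k _; rewrite xcoord_ex eq_sym.
have e2 : \sum_k C k q * C k (ey R j) = 0.
  by apply: big1 => k _; rewrite xcoord_ey mulr0.
by rewrite /rho1 /dz !derC_tube e1 e2; field.
Qed.

Lemma tube_rho1b j q : rho1b tube j q = 2 * C j q.
Proof. by rewrite rho1bE tube_rho1 rmorphM rmorph_nat /= xcoord_conj. Qed.

Lemma dz_xcoord j k q : dz j (fun r => 2 * C k r) q = (j == k)%:R.
Proof.
rewrite /dz !(derCMl _ _ (cdiff_xcoord _ _)) !derC_xcoord xcoord_ex xcoord_ey.
by field.
Qed.

(** The factor 2 in [tube] is chosen to make rho_jk and rho_(j kbar) both the identity matrix. *)
Lemma tube_rho2 j k q : rho2 tube j k q = (j == k)%:R.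
Proof.
rewrite -(dz_xcoord j k q) /rho2; congr (dz j _ q); apply/funext => r.
exact: tube_rho1.
Qed.

Lemma tube_rho11 j k q : rho11 tube j k q = (j == k)%:R.
Proof.
rewrite -(dz_xcoord j k q) /rho11; congr (dz j _ q); apply/funext => r.
exact: tube_rho1b.
Qed.

Lemma tube_defining : defining_function setT tube.
Proof.
split; [exact: openT|exact: smooth_tube openT|move=> p [_ tp]].
(* The radial direction: the derivative of [tube] at p along p is 4. *)
exists p; rewrite -(inj_eq (@complexI R)) derive_tube tube_eq0 // mulr1.
by rewrite pnatr_eq0.
Qed.

Lemma hform1 (x y : 'rV[R[i]]_m) : hform 1%:M x y = \sum_j x 0 j * (y 0 j)^*.
Proof.
apply: eq_bigr => j _; rewrite (bigD1 j) //= big1 => [|k kj].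
  by rewrite mxE eqxx mul1r addr0.
by rewrite mxE eq_sym (negPf kj) !mul0r.
Qed.

Lemma posdef_1 : posdef_hermitian (1%:M : 'M[R[i]]_m).
Proof.
split=> [j k|v v0]; first by rewrite conjcE !mxE eq_sym rmorph_nat.
have := hform1 v v; rewrite /hform => ->.
have [j vj] : exists j, v 0 j != 0 by apply/rV0Pn.
rewrite (bigD1 j) //= ltr_pwDl //; first by rewrite -normCK exprn_gt0 // normr_gt0.
by apply: sumr_ge0 => k _; rewrite -normCK exprn_ge0.
Qed.

Lemma tube_levi_constant : levi_constant_along setT tube (1%:M : 'M[R[i]]_m).
Proof.
move=> p _ j k eps e0; apply: filterE => q.
by rewrite tube_rho11 mxE subrr normr0 ler0c mulr_ge0 // ltW.
Qed.

(** The Hessian is twice the sum of the squares of Re eta_j. *)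
Lemma tube_C_convex : C_convex setT tube.
Proof.
move=> p x _ _; rewrite /hess -big_split /=; apply: sumr_ge0 => j _.
rewrite (bigD1 j) //= big1 => [|k kj]; last first.
  by rewrite tube_rho2 eq_sym (negPf kj) !mul0r.
rewrite [X in _ + X](bigD1 j) //= [X in _ + (_ + X)]big1 => [|k kj]; last first.
  by rewrite tube_rho11 eq_sym (negPf kj) !mul0r.
rewrite tube_rho2 tube_rho11 eqxx !mul1r !addr0.
case: (x 0 j) => s t; rewrite -conjcE lecE /=; apply/andP; split.
  by apply/eqP; ring.
have -> : s * s - t * t + (s * s - t * - t) = 2 * s ^+ 2 by ring.
by rewrite mulr_ge0 // sqr_ge0.
Qed.

End Tube.


(** * An explicit pseudohermitian structure on the tube *)

Section TubeStructure.
Context {R : realType} {n : nat}.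
Local Notation m := n.+1.
Local Notation C j q := (realC (xcoord j) q).
Local Notation L b := (lift ord0 b).
Local Notation tube := (@tube R n).
Implicit Types (q u v : Cn R m) (j k : 'I_m) (b c d : 'I_n).

Definition tube_dom : set (Cn R m) := [set q | 0 < xcoord ord0 q].

Definition inv0 q : R[i] := realC (fun r => (xcoord ord0 r)^-1) q.

(* The frame [Z_b = d/dz_b - (x_b / x_0) d/dz_0] is that of the graph over
   [x_0 > 0]; the other data are the restrictions to M of the general formulas,
   simplified by [sum_j x_j^2 = 1]. *)
Definition tube_data : ph_data R n := {|
  frame b q := \row_j ((j == L b)%:R - (j == ord0)%:R * (C (L b) q * inv0 q));
  reeb q := (0, 2^-1 *: q.1);
  coframe b q v := zc v (L b) - 'i / 2 * C (L b) q * theta tube q v;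
  levi b c q := (b == c)%:R + C (L b) q * C (L c) q * (inv0 q * inv0 q);
  conn b c q v := C (L c) q * (C (L b) v - C (L b) q * inv0 q * C ord0 v)
                  - 'i / 4 * theta tube q v * (b == c)%:R;
  tors b c q := 'i / 4 * (b == c)%:R |}.

Lemma open_tube_dom : open tube_dom.
Proof.
have -> : tube_dom = xcoord ord0 @^-1` [set x : R | 0 < x] by [].
apply: open_comp; last exact: open_gt.
by move=> q _; apply: differentiable_continuous; exact: (derive_xcoord ord0 q 0).1.
Qed.

Lemma smoothC_xcoord j : smoothC tube_dom (realC (xcoord j)).
Proof. by apply: (smoothC_realC open_tube_dom); exact: smooth_xcoord _ open_tube_dom. Qed.

Lemma smooth_inv0 : smoothC tube_dom inv0.
Proof.
apply: (smoothC_realC open_tube_dom); apply: (smoothV open_tube_dom).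
  exact: smooth_xcoord _ open_tube_dom.
by move=> q q0; rewrite gt_eqF.
Qed.

Lemma tube_theta q v : theta tube q v = 'i * (2 * \sum_k C k q * (zc v k)^*).
Proof.
rewrite theta_del /del rmorph_sum mulr_sumr; congr (_ * _); apply: eq_bigr => k _.
by rewrite tube_rho1 !rmorphM /= xcoord_conj rmorph_nat mxE mulrA.
Qed.

Lemma smooth_theta v : smoothC tube_dom (fun q => theta tube q v).
Proof.
apply: (smoothC_ext (fun q => esym (tube_theta q v))).
have o := open_tube_dom.
have sF k : smoothC tube_dom (fun q => C k q * (zc v k)^*).
  exact (smoothCM o (smoothC_xcoord k) (smoothC_cst o (zc v k)^*)).
exact (smoothCM o (smoothC_cst o 'i) (smoothCM o (smoothC_cst o 2)
  (smoothC_sum o (index_enum 'I_m) sF))).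
Qed.

Lemma realC_xcoord_lin j : rlinear (realC (@xcoord R m j)).
Proof.
by move=> c u v; rewrite /realC /xcoord /= !mxE rmorphD rmorphM.
Qed.

Lemma tube_zc_reeb q k : zc (reeb tube_data q) k = 'i / 2 * C k q.
Proof.
apply: esym; rewrite /zc /= !mxE -complexiE /realC /xcoord.
have -> : (2 : R[i])^-1 = (2^-1)%:C by rewrite fmorphV rmorph_nat.
by apply/eqP; rewrite eq_complex /=; apply/andP; split; apply/eqP; ring.
Qed.

Lemma tube_smooth : ph_smooth tube_dom tube_data.
Proof.
have o := open_tube_dom.
have cs (z : R[i]) := smoothC_cst o z.
have sCV j : smoothC tube_dom (fun q => C j q * inv0 q).
  exact (smoothCM o (smoothC_xcoord j) smooth_inv0).
split=> [b j|j|b|].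
- apply: (smoothC_ext (f := fun q => (j == L b)%:R
      - (j == ord0)%:R * (C (L b) q * inv0 q))); first by move=> q; rewrite mxE.
  exact (smoothCB o (cs _) (smoothCM o (cs _) (sCV _))).
- apply: (smoothC_ext (f := fun q => 'i / 2 * C j q)); last first.
    exact (smoothCM o (cs _) (smoothC_xcoord j)).
  by move=> q; rewrite tube_zc_reeb.
- split=> [q c u v _|v] /=.
    by rewrite zc_lin theta_lin; ring.
  exact (smoothCB o (cs _) (smoothCM o (smoothCM o (cs _) (smoothC_xcoord _)) (smooth_theta v))).
split=> [b c|b c|b c] /=.
- exact (smoothCD o (cs _) (smoothCM o (smoothCM o (smoothC_xcoord _) (smoothC_xcoord _))
    (smoothCM o smooth_inv0 smooth_inv0))).
- split=> [q r u v _|v].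
    by rewrite !(realC_xcoord_lin _ r u v) theta_lin; ring.
  exact (smoothCB o (smoothCM o (smoothC_xcoord _) (smoothCB o (cs _) (smoothCM o (sCV _) (cs _))))
    (smoothCM o (smoothCM o (cs _) (smooth_theta v)) (cs _))).
- exact: cs.
Qed.

End TubeStructure.



(** * Coframe and flat metric on the tube *)

Section TubeEquations.
Context {R : realType} {n : nat}.
Local Notation m := n.+1.
Local Notation C j q := (realC (xcoord j) q).
Local Notation L b := (lift ord0 b).
Local Notation tube := (@tube R n).
Local Notation D := (@tube_data R n).
Local Notation S := (@tube_dom R n `&` hypersurface setT tube).
Local Notation th b q v := (coframe D b q v).
Implicit Types (q u v : Cn R m) (j k : 'I_m) (b c d : 'I_n).

Lemma xcoord0_inv0 q : S q -> C ord0 q * inv0 q = 1.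
Proof.
move=> [q0 _]; rewrite /inv0 /realC -rmorphM /= mulfV ?rmorph1 //.
by rewrite gt_eqF.
Qed.

Lemma tube_sum_sqr q : S q -> \sum_j C j q * C j q = 1.
Proof. by move=> [_ [_]]; exact: tube_eq0. Qed.

Lemma tube_tail_sum_sqr q : S q -> \sum_b C (L b) q * C (L b) q = 1 - C ord0 q * C ord0 q.
Proof. by move=> Sq; rewrite -(tube_sum_sqr Sq) big_ord_recl addrAC subrr add0r. Qed.

Lemma tube_regular q : S q -> regular_at tube q.
Proof.
move=> [_ [_ tq]]; have st := smooth_tube (@openT (Cn R m)).
have dt r : differentiable tube r by exact: smooth_differentiable st I.
split => //.
- by apply: filterE.
- by move=> v; exact: smooth_differentiable (smooth_derive v st) I.
- by have [_ _ nz] := @tube_defining R n; exact: nz (conj I tq).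
Qed.

Lemma tube_diff q : differentiable tube q.
Proof. exact: smooth_differentiable (smooth_tube (@openT (Cn R m))) I. Qed.

Lemma tangent_tube q v : tangent tube q v <-> \sum_j C j q * C j v = 0.
Proof.
have E := derive_tube q v; split => [tv|s0].
  have f0 : (4 : R[i]) != 0 by rewrite pnatr_eq0.
  by apply: (mulfI f0); rewrite -E tv mulr0.
by apply: (@complexI R); rewrite E s0 mulr0.
Qed.

Lemma zc_add_conj v k : zc v k + (zc v k)^* = 2 * C k v.
Proof.
rewrite /realC /xcoord /zc -conjcE; apply/eqP; rewrite eq_complex /=.
by apply/andP; split; apply/eqP; ring.
Qed.

Lemma tube_zsum q v : tangent tube q v ->
  \sum_k C k q * zc v k = 'i / 2 * theta tube q v.
Proof.
move=> tv; have := del_tangent (tube_diff q) tv => E.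
have f0 : (2 : R[i]) != 0 by rewrite pnatr_eq0.
apply: (mulfI f0); transitivity ('i * theta tube q v); last by field.
rewrite -E /del mulr_sumr; apply: eq_bigr => k _.
by rewrite tube_rho1 mxE mulrA.
Qed.

Lemma tube_coframeE b q v :
  th b q v = zc v (L b) - 'i / 2 * C (L b) q * theta tube q v.
Proof. by []. Qed.

(** On tangent vectors sum_k x_k dz_k = (i/2) theta; dividing by x_0 recovers dz_0 from theta and
    the coframe. *)
Lemma coframe_head q u : S q -> tangent tube q u ->
  inv0 q * (\sum_b th b q u * C (L b) q) = - zc u ord0 + 'i / 2 * C ord0 q * theta tube q u.
Proof.
move=> Sq tu; have cv := xcoord0_inv0 Sq; have st := tube_tail_sum_sqr Sq.
have zs := tube_zsum tu; rewrite big_ord_recl in zs.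
have -> : \sum_b th b q u * C (L b) q =
    \sum_b C (L b) q * zc u (L b)
    - 'i / 2 * theta tube q u * \sum_b C (L b) q * C (L b) q.
  by rewrite mulr_sumr -sumrB; apply: eq_bigr => b _; rewrite tube_coframeE; ring.
have -> : \sum_b C (L b) q * zc u (L b) =
    'i / 2 * theta tube q u - C ord0 q * zc u ord0.
  by rewrite -zs addrAC subrr add0r.
rewrite st.
move: ('i / 2) (theta tube q u) (zc u ord0) => i t z.
transitivity ((C ord0 q * inv0 q) * (- z + i * C ord0 q * t)); first by ring.
by rewrite cv mul1r.
Qed.

(** The flat metric in the coframe, with 1/4 = 1/N. The last term is symmetric in u and v, so
    antisymmetrizing leaves the Levi form. *)
Lemma tube_hform q u v : S q -> tangent tube q u -> tangent tube q v ->
  \sum_k zc u k * (zc v k)^* =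
  \sum_b \sum_c levi D b c q * (th b q u * (th c q v)^*)
  + 4^-1 * theta tube q u * theta tube q v.
Proof.
have i2 : 'i * 'i = -1 :> R[i] by rewrite -expr2 sqrCi.
move=> Sq tu tv; have cv := xcoord0_inv0 Sq; have st := tube_tail_sum_sqr Sq.
have hu := coframe_head Sq tu; have hv := coframe_head Sq tv.
have tru := theta_real (tube_diff q) tu; have trv := theta_real (tube_diff q) tv.
set su := \sum_b th b q u * C (L b) q in hu.
set sv := \sum_b th b q v * C (L b) q in hv.
have c2 : ('i / 2 : R[i])^* = - ('i / 2).
  by rewrite rmorphM fmorphV rmorph_nat /= conjCi mulNr.
have cm (x y : R[i]) : ('i / 2 * x * y)^* = - ('i / 2) * x^* * y^*.
  by rewrite (rmorphM _ ('i / 2 * x)) (rmorphM _ ('i / 2)) /= c2.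
have cinv : (inv0 q)^* = inv0 q by rewrite /inv0 -conjcE conjc_real.
have zu : zc u ord0 = 'i / 2 * C ord0 q * theta tube q u - inv0 q * su.
  by rewrite hu; ring.
have zv : (zc v ord0)^* = - ('i / 2) * C ord0 q * theta tube q v - inv0 q * sv^*.
  have -> : zc v ord0 = 'i / 2 * C ord0 q * theta tube q v - inv0 q * sv.
    by rewrite hv; ring.
  by rewrite rmorphB /= cm trv xcoord_conj rmorphM /= cinv.
have svc : sv^* = \sum_b (th b q v)^* * C (L b) q.
  by rewrite rmorph_sum; apply: eq_bigr => b _; rewrite rmorphM /= xcoord_conj.
have e1 : \sum_b zc u (L b) * (zc v (L b))^* =
   \sum_b th b q u * (th b q v)^* - 'i / 2 * theta tube q v * su
   + 'i / 2 * theta tube q u * sv^*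
   - ('i / 2) * ('i / 2) * theta tube q u * theta tube q v * (1 - C ord0 q * C ord0 q).
  rewrite -st svc /su !mulr_sumr -sumrB -big_split -sumrB; apply: eq_bigr => b _ /=.
  have -> : zc u (L b) = th b q u + 'i / 2 * C (L b) q * theta tube q u.
    by rewrite tube_coframeE subrK.
  have -> : zc v (L b) = th b q v + 'i / 2 * C (L b) q * theta tube q v.
    by rewrite tube_coframeE subrK.
  rewrite rmorphD /= cm trv xcoord_conj.
  move: ('i / 2) (th b q u) (th b q v)^* (theta tube q u) (theta tube q v) => *; ring.
have e2 : \sum_b \sum_c levi D b c q * (th b q u * (th c q v)^*) =
   \sum_b th b q u * (th b q v)^* + inv0 q * inv0 q * su * sv^*.
  transitivity (\sum_b (\sum_c th b q u * (th c q v)^* * (c == b)%:R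
     + \sum_c inv0 q * inv0 q * (th b q u * C (L b) q) * ((th c q v)^* * C (L c) q))).
    apply: eq_bigr => b _; rewrite -big_split; apply: eq_bigr => c _ /=.
    rewrite [b == c]eq_sym; move: (th b q u) (th c q v)^* ((c == b)%:R) => x y z.
    by ring.
  rewrite big_split /=; congr (_ + _).
    by apply: eq_bigr => b _; rewrite sum_delta.
  rewrite svc /su; under eq_bigr do rewrite -mulr_sumr.
  by rewrite -mulr_suml -mulr_sumr.
rewrite big_ord_recl e1 e2 zu zv.
move: (\sum_b th b q u * (th b q v)^*) (su) (sv^*) (theta tube q u) (theta tube q v) => X x y t s.
move: (inv0 q) (C ord0 q) cv 'i i2; clear => V c cv i i2.
by field: i2 cv.
Qed.

End TubeEquations.



(** * Frame, Reeb field and first structure equation on the tube *)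

Section TubeStructureEquations.
Context {R : realType} {n : nat}.
Local Notation m := n.+1.
Local Notation C j q := (realC (xcoord j) q).
Local Notation L b := (lift ord0 b).
Local Notation tube := (@tube R n).
Local Notation D := (@tube_data R n).
Local Notation S := (@tube_dom R n `&` hypersurface setT tube).
Local Notation th b q v := (coframe D b q v).
Implicit Types (q u v : Cn R m) (j k : 'I_m) (b c d : 'I_n).

Lemma tube_dtheta q u v : S q -> ext_d (theta tube) q u v =
  'i * (\sum_k zc u k * (zc v k)^* - \sum_k zc v k * (zc u k)^*).
Proof.
move=> Sq; rewrite (@ext_d_theta _ _ _ _ (tube_regular Sq) 1%:M posdef_1); last first.
  by move=> j k; rewrite tube_rho11 mxE.
rewrite !hform1; congr (_ * (_ - _)); apply: eq_bigr => k _; by rewrite !mxE.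
Qed.

Lemma tube_is_frame : is_frame S tube D.
Proof.
move=> q Sq; have cv := xcoord0_inv0 Sq; split.
  move=> b; rewrite /T10 big_ord_recl.
  have -> : \sum_c rho1 tube (L c) q * frame D b q 0 (L c) = 2 * C (L b) q.
    rewrite -[RHS](sum_delta (fun c => 2 * C (L c) q)); apply: eq_bigr => c _.
    by rewrite tube_rho1 mxE (inj_eq (@lift_inj _ _)) /= mul0r subr0.
  rewrite tube_rho1 mxE eqxx mul1r /= sub0r.
  transitivity (2 * C (L b) q * (1 - C ord0 q * inv0 q)); first by ring.
  by rewrite cv subrr mulr0.
(* Forgetting z_0 sends the frame to the standard basis, which gives the right inverse. *)
apply/row_freeP; exists (\matrix_(j < n.+1, c < n) (j == L c)%:R).
apply/matrixP => b c; rewrite !mxE big_ord_recl !mxE /= mulr0 add0r.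
rewrite -[RHS](sum_delta (fun d => (b == d)%:R)).
apply: eq_bigr => d _; rewrite !mxE !(inj_eq (@lift_inj _ _)) /= mul0r subr0.
by rewrite [d == b]eq_sym.
Qed.

Lemma conj_imaginary_div2 : ('i / 2 : R[i])^* = - ('i / 2).
Proof. by rewrite rmorphM fmorphV rmorph_nat /= conjCi mulNr. Qed.

Lemma tube_theta_reeb q : S q -> theta tube q (reeb D q) = 1.
Proof.
move=> Sq; rewrite tube_theta.
have -> : \sum_k C k q * (zc (reeb D q) k)^* = - ('i / 2).
  transitivity (- ('i / 2) * \sum_k C k q * C k q); last by rewrite tube_sum_sqr ?mulr1.
  rewrite mulr_sumr; apply: eq_bigr => k _.
  by rewrite tube_zc_reeb (rmorphM _ ('i / 2)) /= conj_imaginary_div2 xcoord_conj; ring.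
have i2 : 'i * 'i = -1 :> R[i] by rewrite -expr2 sqrCi.
by move: 'i i2 => i i2; field: i2.
Qed.

Lemma tube_is_reeb : is_reeb S tube D.
Proof.
move=> q Sq; split; [|exact: tube_theta_reeb|].
  apply/tangent_tube; apply: big1 => k _.
  by rewrite {2}/realC /xcoord /= mxE mulr0.
move=> v /tangent_tube tv; rewrite tube_dtheta //.
have -> : \sum_k zc (reeb D q) k * (zc v k)^* - \sum_k zc v k * (zc (reeb D q) k)^*
    = 'i * \sum_k C k q * C k v.
  rewrite -sumrB mulr_sumr; apply: eq_bigr => k _.
  rewrite tube_zc_reeb (rmorphM _ ('i / 2)) /= conj_imaginary_div2 xcoord_conj.
  transitivity ('i / 2 * C k q * (zc v k + (zc v k)^*)); first by ring.
  by rewrite zc_add_conj; field.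
by rewrite tv !mulr0.
Qed.

Lemma tube_coframe_toCn q b c (k : R[i]) : S q ->
  th b q (toCn (k *: frame D c q)) = k * (b == c)%:R.
Proof.
move=> Sq; have [fz _] := tube_is_frame Sq.
rewrite tube_coframeE theta_toCn; last by rewrite delZ /del fz mulr0.
by rewrite zcE toCnK !mxE (inj_eq (@lift_inj _ _)) /=; ring.
Qed.

Lemma tube_coframe_lin q b : rlinear (coframe D b q).
Proof. by move=> r u v; rewrite !tube_coframeE zc_lin theta_lin; ring. Qed.

Lemma tube_is_coframe : is_coframe S D.
Proof.
move=> q b c Sq; have lt := tube_coframe_lin q b.
have i2 : 'i * 'i = -1 :> R[i] by rewrite -expr2 sqrCi.
rewrite (ev1_vec10 lt) (ev1_vec01 lt) -{1 3}[frame D c q]scale1r !tube_coframe_toCn //.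
split; [by move: 'i i2 => i i2; field: i2|by move: 'i i2 => i i2; field: i2|].
by rewrite tube_coframeE tube_zc_reeb tube_theta_reeb // mulr1 subrr.
Qed.

Lemma tube_is_levi : is_levi S tube D.
Proof.
move=> q u v Sq tu tv.
rewrite (tube_dtheta _ _ Sq) (tube_hform Sq tu tv) (tube_hform Sq tv tu).
congr (_ * _); rewrite [4^-1 * _ * theta tube q u]mulrAC opprD addrACA subrr addr0.
rewrite -sumrB; apply: eq_bigr => b _; rewrite -sumrB; apply: eq_bigr => c _.
by rewrite /wedge /conj_form !conjcE mulrBr.
Qed.

Lemma conj_imaginary_div4 : ('i / 4 : R[i])^* = - ('i / 4).
Proof. by rewrite rmorphM fmorphV rmorph_nat /= conjCi mulNr. Qed.

Lemma tube_connE b c q v : conn D b c q v =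
  C (L c) q * (C (L b) v - C (L b) q * inv0 q * C ord0 v)
  - 'i / 4 * theta tube q v * (b == c)%:R.
Proof. by []. Qed.

Lemma tube_leviE b c q : levi D b c q =
  (b == c)%:R + C (L b) q * C (L c) q * (inv0 q * inv0 q).
Proof. by []. Qed.

(** By [coframe_head] and the tangency of v, the graph terms in x_0 recombine into a sum over all
    coordinates. *)
Lemma sum_coframe_conn c q u v : S q -> tangent tube q u -> tangent tube q v ->
  \sum_b th b q u * conn D b c q v =
  C (L c) q * (\sum_k zc u k * C k v) - 'i / 4 * theta tube q v * th c q u.
Proof.
move=> Sq tu /tangent_tube tv; have hu := coframe_head Sq tu.
transitivity (C (L c) q * (\sum_b th b q u * C (L b) v
    - (inv0 q * \sum_b th b q u * C (L b) q) * C ord0 v)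
    - 'i / 4 * theta tube q v * \sum_b th b q u * (b == c)%:R).
  rewrite !mulr_sumr mulr_suml -sumrB mulr_sumr -sumrB; apply: eq_bigr => b _.
  by rewrite tube_connE; move: (th b q u) (theta tube q v) => x y; ring.
rewrite sum_delta hu; congr (_ * _ - _).
have -> : \sum_b th b q u * C (L b) v = \sum_b zc u (L b) * C (L b) v
    - 'i / 2 * theta tube q u * \sum_b C (L b) q * C (L b) v.
  by rewrite mulr_sumr -sumrB; apply: eq_bigr => b _; rewrite tube_coframeE; ring.
have -> : \sum_b C (L b) q * C (L b) v = - (C ord0 q * C ord0 v).
  by move/eqP: tv; rewrite big_ord_recl addrC addr_eq0 => /eqP.
rewrite [in RHS]big_ord_recl; move: (\sum_b zc u (L b) * _) (theta tube q u) (zc u ord0) => X t z.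
by ring.
Qed.

Lemma tube_ext_d_coframe b q u v : S q -> ext_d (coframe D b) q u v =
  - ('i / 2) * (C (L b) u * theta tube q v - C (L b) v * theta tube q u
                + C (L b) q * ext_d (theta tube) q u v).
Proof.
move=> Sq; have dt w : cdiff ((theta tube)^~ w) q := cdiff_theta (tube_regular Sq) w.
have d w w' : derC w ((coframe D b)^~ w') q =
   - ('i / 2) * (C (L b) w * theta tube q w' + C (L b) q * derC w ((theta tube)^~ w') q).
  have dC2 := cdiffMl ('i / 2) (cdiff_xcoord (L b) q).
  rewrite (derCB _ (cdiff_cst _ _) (cdiffM dC2 (dt w'))) derC_cst sub0r.
  rewrite (derCM _ dC2 (dt w')) (derCMl _ _ (cdiff_xcoord _ _)) derC_xcoord.
  by move: (derC w _ q) (theta tube q w') => x y; ring.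
rewrite /ext_d !d; move: (derC u _ q) (derC v _ q) (theta tube q u) (theta tube q v) => *.
by ring.
Qed.

Lemma tube_structure b : eq2_on S tube (ext_d (coframe D b))
  (fun p u v => \sum_a wedge (coframe D a) (conn D a b) p u v
     + \sum_a tors D b a p * wedge (theta tube) (conj_form (coframe D a)) p u v).
Proof.
move=> q u v Sq tu tv; rewrite (tube_ext_d_coframe b u v Sq) (tube_dtheta _ _ Sq).
have -> : \sum_a wedge (coframe D a) (conn D a b) q u v =
    \sum_a th a q u * conn D a b q v - \sum_a th a q v * conn D a b q u.
  by rewrite -sumrB; apply: eq_bigr.
rewrite (sum_coframe_conn b Sq tu tv) (sum_coframe_conn b Sq tv tu).
have -> : \sum_a tors D b a q * wedge (theta tube) (conj_form (coframe D a)) q u v =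
    'i / 4 * (theta tube q u * (th b q v)^* - theta tube q v * (th b q u)^*).
  rewrite -[RHS](sum_delta (fun a => 'i / 4 * (theta tube q u * (th a q v)^*
     - theta tube q v * (th a q u)^*))); apply: eq_bigr => a _.
  rewrite /wedge /conj_form !conjcE eq_sym /=.
  by move: (theta tube q u) (theta tube q v) (th a q u)^* (th a q v)^* => *; ring.
(* Since theta is real, the imaginary corrections of theta^b and its conjugate cancel and leave dz_b
   + conj dz_b. Every conjugate can now be eliminated in favour of dx. *)
have thc w : tangent tube q w -> (th b q w)^* = 2 * C (L b) w - th b q w.
  move=> tw; have tr := theta_real (tube_diff q) tw.
  rewrite tube_coframeE -zc_add_conj rmorphB /= (rmorphM _ ('i / 2 * C (L b) q)).
  rewrite /= (rmorphM _ ('i / 2)) /= conj_imaginary_div2 xcoord_conj tr.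
  by move: (theta tube q w) => *; ring.
rewrite (thc u tu) (thc v tv).
have e (w w' : Cn R m) : \sum_k zc w k * (zc w' k)^* =
   2 * (\sum_k zc w k * C k w') - \sum_k zc w k * zc w' k.
  rewrite mulr_sumr -sumrB; apply: eq_bigr => k _.
  have -> : (zc w' k)^* = 2 * C k w' - zc w' k by rewrite -zc_add_conj addrAC subrr add0r.
  by ring.
have s0 : \sum_k zc u k * zc v k = \sum_k zc v k * zc u k.
  by apply: eq_bigr => k _; rewrite mulrC.
rewrite !e s0.
have i2 : 'i * 'i = -1 :> R[i] by rewrite -expr2 sqrCi.
move: (\sum_k zc u k * C k v) (\sum_k zc v k * C k u) (\sum_k zc v k * zc u k).
move: (theta tube q u) (theta tube q v) (th b q u) (th b q v) 'i i2 => t s x y i i2 X Y Z'.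
by field: i2.
Qed.

End TubeStructureEquations.


(** * Metric compatibility and sharpness on the tube *)

Section TubeExample.
Context {R : realType} {n : nat}.
Local Notation m := n.+1.
Local Notation C j q := (realC (xcoord j) q).
Local Notation L b := (lift ord0 b).
Local Notation tube := (@tube R n).
Local Notation D := (@tube_data R n).
Local Notation S := (@tube_dom R n `&` hypersurface setT tube).
Implicit Types (q u v : Cn R m) (j k : 'I_m) (b c d : 'I_n).

Lemma inv0_conj q : (inv0 q)^* = inv0 q.
Proof. by rewrite /inv0 -conjcE conjc_real. Qed.

Lemma levi_tube_conj b c q : (levi D b c q)^* = levi D c b q.
Proof.
rewrite !tube_leviE rmorphD !rmorphM /= rmorph_nat !xcoord_conj inv0_conj eq_sym.
by rewrite [C (L b) q * _]mulrC.
Qed.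

(** The lowered connection of the tube. The tail sum 1 - x_0^2 turns 1 + (1 - x_0^2) / x_0^2 into 1
    / x_0^2, and the last term is the - (i/N) theta h of the general formula. *)
Lemma sum_conn_levi b c q u : S q ->
  \sum_d conn D b d q u * levi D d c q =
  (C (L b) u - C (L b) q * inv0 q * C ord0 u) * C (L c) q * (inv0 q * inv0 q)
  - 'i / 4 * theta tube q u * levi D b c q.
Proof.
move=> Sq; have cv := xcoord0_inv0 Sq.
set E := C (L b) u - _.
transitivity (E * (\sum_d C (L d) q * (d == c)%:R) + E * C (L c) q * (inv0 q * inv0 q)
    * (\sum_d C (L d) q * C (L d) q)
    - 'i / 4 * theta tube q u * (\sum_d levi D d c q * (d == b)%:R)).
  rewrite !mulr_sumr -big_split -sumrB; apply: eq_bigr => d _.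
  rewrite tube_connE -/E !tube_leviE [b == d]eq_sym /=.
  by move: E (theta tube q u) => E t; ring.
rewrite !sum_delta tube_tail_sum_sqr //; move: E (theta tube q u) (levi D b c q) => E t l.
by move: (C ord0 q) (inv0 q) cv => c0 V cv; ring: cv.
Qed.

Lemma derC_inv0 q u : S q -> derC u (@inv0 R n) q = - (inv0 q * inv0 q * C ord0 u).
Proof.
move=> [q0 _]; have x0 : xcoord ord0 q != 0 by rewrite gt_eqF.
have [dx ex] := derive_xcoord (@ord0 n) q u.
rewrite derC_realC (deriveV x0 (@diff_derivable _ _ _ _ q u dx)) ex.
rewrite /inv0 /realC -!rmorphM -rmorphN /=; congr (_%:C).
by rewrite expr2 invfM /GRing.scale /= mulNr.
Qed.

Lemma cdiff_inv0 q : S q -> cdiff (@inv0 R n) q.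
Proof. by move=> [q0 _]; exact: smoothC_cdiff smooth_inv0 q0. Qed.

Lemma derC_levi_tube b c q u : S q -> derC u (levi D b c) q =
  (C (L b) u * C (L c) q + C (L b) q * C (L c) u) * (inv0 q * inv0 q)
  - 2 * C (L b) q * C (L c) q * (inv0 q * (inv0 q * inv0 q)) * C ord0 u.
Proof.
move=> Sq; have dv := cdiff_inv0 Sq; have dvv := cdiffM dv dv.
have dcc := cdiffM (cdiff_xcoord (L b) q) (cdiff_xcoord (L c) q).
rewrite (derCD _ (cdiff_cst _ _) (cdiffM dcc dvv)) derC_cst add0r.
rewrite (derCM _ dcc dvv) (derCM _ dv dv) (derCM _ (cdiff_xcoord (L b) q) (cdiff_xcoord (L c) q)).
rewrite !derC_xcoord (derC_inv0 _ Sq); ring.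
Qed.

(** In the metric equation the imaginary theta terms cancel against their conjugates, and the real
    parts add up to the derivative of x_b x_c / x_0^2. *)
Lemma tube_is_tanaka_webster : is_tanaka_webster S tube D.
Proof.
split; first exact: tube_structure.
move=> b c q u Sq tu; rewrite (derC_levi_tube _ _ _ Sq) (sum_conn_levi _ _ _ Sq).
have -> : \sum_d levi D b d q * (conn D c d q u)^* =
    (\sum_d conn D c d q u * levi D d b q)^*.
  rewrite rmorph_sum; apply: eq_bigr => d _.
  by rewrite rmorphM /= levi_tube_conj mulrC.
have cm (t l : R[i]) : t^* = t -> ('i / 4 * t * l)^* = - ('i / 4) * t * l^*.
  by move=> tr; rewrite (rmorphM _ ('i / 4 * t)) (rmorphM _ ('i / 4)) /= conj_imaginary_div4 tr.
have cE : ((C (L c) u - C (L c) q * inv0 q * C ord0 u) * C (L b) q * (inv0 q * inv0 q))^*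
    = (C (L c) u - C (L c) q * inv0 q * C ord0 u) * C (L b) q * (inv0 q * inv0 q).
  by rewrite !(rmorphM, rmorphB) /= !xcoord_conj !inv0_conj.
rewrite (sum_conn_levi _ _ _ Sq) rmorphB /= cE.
rewrite (cm _ _ (theta_real (tube_diff q) tu)) levi_tube_conj.
rewrite tube_leviE; move: (theta tube q u) => t; ring.
Qed.

Lemma tube_ph_setting : ph_setting setT tube (1%:M : 'M[R[i]]_m) D (@tube_dom R n).
Proof.
split; [exact: tube_defining|exact: posdef_1|exact: tube_levi_constant|
  exact: open_tube_dom|by []|exact: tube_smooth|exact: tube_is_frame|
  exact: tube_is_reeb|exact: tube_is_coframe|exact: tube_is_levi|
  exact: tube_is_tanaka_webster].
Qed.

Lemma tube_point : S (ex R ord0).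
Proof.
have X j : xcoord j (ex R ord0) = (j == ord0)%:R.
  by rewrite /xcoord /= mxE eqxx.
split; first by rewrite /tube_dom /= X ltr01.
split=> //; rewrite /tube; under eq_bigr do rewrite X.
by rewrite sum_delta eqxx mulr1 subrr.
Qed.

(** At the point e_0 the vector Z is real and tangent, with h = r = 1, the equality case of both
    bounds. *)
Lemma tube_sharp b0 : let p := ex R (@ord0 n) in
  let Z : 'rV[R[i]]_m := delta_mx 0 (L b0) in
  [/\ T10 tube p Z, Z != 0,
    hol_sec_curv D p Z = 2^-1 * (dual_normsq 1%:M tube p)^-1 &
    2^-1 * (dual_normsq 1%:M tube p)^-1 = 2^-1 * `|hol_sec_tors D p Z|].
Proof.
move=> p Z; have Sp := tube_point; have N0 := normsq_neq0 tube_ph_setting Sp.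
have ZE j : Z 0 j = (j == L b0)%:R by rewrite mxE eqxx.
have TZ : T10 tube p Z.
  rewrite /T10; under eq_bigr do rewrite ZE.
  by rewrite sum_delta tube_rho1 xcoord_ex mulr0.
have Z0 : Z != 0.
  apply/eqP => /rowP/(_ (L b0)); rewrite ZE mxE eqxx => /eqP.
  by rewrite oner_eq0.
have h1 : hform 1%:M Z Z = 1.
  rewrite hform1; under eq_bigr do rewrite [X in X^*]ZE rmorph_nat.
  by rewrite sum_delta ZE eqxx.
have Q1 : q2 tube p Z Z = 1.
  transitivity (\sum_j Z 0 j * (j == L b0)%:R); last by rewrite sum_delta ZE eqxx.
  apply: eq_bigr => j _; under eq_bigr do rewrite [X in _ * X]ZE.
  rewrite sum_delta tube_rho2 mulrC; exact: erefl.
have [Kf Af] := hol_sec_formulas tube_ph_setting Sp TZ Z0.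
split=> //.
  by rewrite Kf h1 Q1 normr1; field.
by rewrite Af h1 Q1 normr1 mulr1 mul1r.
Qed.

End TubeExample.

Theorem corollary1p4 (R : realType) (n : nat) (hn : (1 <= n)%N) :
  (forall (U : set (Cn R n.+1)) (rho : Cn R n.+1 -> R) (a : 'M[R[i]]_n.+1),
     defining_function U rho -> posdef_hermitian a ->
     levi_constant_along U rho a -> C_convex U rho ->
     [/\ forall C0 : R, C0 < 2^-1 -> positive_hol_sec_curv U rho C0,
         strictly_C_convex U rho -> positive_hol_sec_curv U rho 2^-1 &
         forall p (D : ph_data R n) Z, hypersurface U rho p ->
           ph_structure_near U rho p D -> T10 rho p Z -> Z != 0 ->
           2^-1 * (dual_normsq a rho p)^-1 <= hol_sec_curv D p Z /\
           2^-1 * `| hol_sec_tors D p Z | <= 2^-1 * (dual_normsq a rho p)^-1]) /\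
  (exists (rho : Cn R n.+1 -> R) (a : 'M[R[i]]_n.+1),
     [/\ defining_function setT rho, posdef_hermitian a,
         levi_constant_along setT rho a & C_convex setT rho] /\
     exists p (D : ph_data R n) Z,
       [/\ hypersurface setT rho p, ph_structure_near setT rho p D,
           T10 rho p Z & Z != 0] /\
       hol_sec_curv D p Z = 2^-1 * (dual_normsq a rho p)^-1 /\
       2^-1 * (dual_normsq a rho p)^-1 = 2^-1 * `| hol_sec_tors D p Z |).
Proof.
split.
  move=> U rho a dU pa lc cv.
  have setting p D : hypersurface U rho p -> ph_structure_near U rho p D ->
      exists2 W, ph_setting U rho a D W & (W `&` hypersurface U rho) p.
    move=> hp [W [[oW Wp WU sD] [fr re co le tw]]].
    by exists W => //; split.
  split.
  - move=> C0 hC p D Z hp ph TZ Z0; have [W H Sp] := setting p D hp ph.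
    exact: (hol_sec_lt H).
  - move=> scv p D Z hp ph TZ Z0; have [W H Sp] := setting p D hp ph.
    exact: (hol_sec_half H).
  - move=> p D Z hp ph TZ Z0; have [W H Sp] := setting p D hp ph.
    exact: (hol_sec_bounds H).
exists (@tube R n), 1%:M; split.
  split; [exact: tube_defining|exact: posdef_1|exact: tube_levi_constant|].
  exact: tube_C_convex.
(* The hypothesis 1 <= n supplies the index of a tangent coordinate direction. *)
have [TZ Z0 KZ AZ] := @tube_sharp R n (Ordinal hn).
have [Wp hp] := @tube_point R n.
exists (ex R ord0), (@tube_data R n), (delta_mx 0 (lift ord0 (Ordinal hn))).
split; last by split.
split=> //; have H := @tube_ph_setting R n.
exists (@tube_dom R n); split.
  by split; [exact: phs_open H| | |exact: phs_smooth H].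
by split; [exact: phs_frame H|exact: phs_reeb H|exact: phs_coframe H|
  exact: phs_levi H|exact: phs_tw H].
Qed.
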